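(* Let $K$ be an algebraically closed field of characteristic $2$ and let $A$ be one of the algebras $\Lambda_4$, $\Lambda_5$, $\Lambda_6$, $\Lambda_7$, $\Lambda_8$. Then: (i) $\dim_K HH^0(A)=5$. (ii) $\dim_K HH^1(A)=2$. (iii) $\dim_K HH^2(A)=2$.
   Context: For a finite-dimensional $K$-algebra $A$, $HH^n(A)=\mathrm{Ext}^n_{A^e}(A,A)$ with $A^e=A^{\mathrm{op}}\otimes_K A$ is the $n$-th Hochschild cohomology space. Paths are composed from left to right ($\alpha\beta$ means first $\alpha$, then $\beta$). The following are bound quiver algebras over $K$ with vertices $1,2,3$. $\Lambda_4$: arrows $\alpha:1\to3$, $\gamma:3\to2$, $\delta:1\to2$, $\beta:2\to1$; relations $\delta\beta\delta=\alpha\gamma$, $(\beta\delta)^3\beta=0$, $\gamma\beta\alpha=\gamma\beta\delta\beta\alpha$. $\Lambda_5$: arrows $\alpha:2\to2$, $\beta:1\to2$, $\gamma:2\to1$, $\delta:2\to3$, $\sigma:3\to2$; relations $\alpha^2=\gamma\beta$, $\alpha^3=\delta\sigma$, $\beta\delta=0$, $\sigma\gamma=0$, $\alpha\delta=0$, $\sigma\alpha=0$, $\beta\gamma=\beta\alpha\gamma$. $\Lambda_6$: arrows $\alpha:1\to2$, $\beta:2\to1$, $\delta:2\to3$, $\gamma:3\to2$; relations $\alpha\delta\gamma\delta=0$, $\gamma\delta\gamma\beta=0$, $\alpha\beta=\alpha\delta\gamma\beta$, $\beta\alpha=\delta\gamma\delta\gamma$. $\Lambda_7$: arrows $\alpha:1\to1$,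 $\sigma:1\to3$, $\gamma:3\to2$, $\delta:1\to2$, $\beta:2\to1$; relations $\beta\delta=\beta\alpha\delta$, $\alpha\sigma=0$, $\alpha\delta=\sigma\gamma$, $\gamma\beta\alpha=0$, $\alpha^2=\delta\beta$. $\Lambda_8$: arrows $\alpha:1\to1$, $\sigma:3\to1$, $\gamma:2\to3$, $\delta:2\to1$, $\beta:1\to2$; relations $\delta\beta=\delta\alpha\beta$, $\sigma\alpha=0$, $\delta\alpha=\gamma\sigma$, $\alpha\beta\gamma=0$, $\alpha^2=\beta\delta$. *)

(* Defs.v *)
From HB Require Import structures.
From mathcomp Require Import all_boot all_order all_algebra all_field.
From mathcomp Require Import finmap.
From mathcomp Require Import monalg.

Set Implicit Arguments.
Unset Strict Implicit.
Unset Printing Implicit Defensive.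

Import GRing.Theory.
Local Open Scope ring_scope.

Section LinearExtension.
Variables (I : choiceType) (R : nzRingType) (V : lmodType R).

(* {malg R[I]} is the free left R-module on I. *)
Definition linext (h : I -> V) (g : {malg R[I]}) : V :=
  \sum_(k <- msupp g) g@_k *: h k.

Lemma linextEw (d : {fset I}) (h : I -> V) g : (msupp g `<=` d)%fset ->
  linext h g = \sum_(k <- d) g@_k *: h k.
Proof.
move=> le; rewrite /linext (big_fset_incl _ le) //= => k _ /mcoeff_outdom ->.
by rewrite scale0r.
Qed.

Lemma linext_is_linear h : linear (linext h).
Proof.
move=> c g1 g2; pose d := (msupp g1 `|` msupp g2)%fset.
have le1 : (msupp g1 `<=` d)%fset by apply: fsubsetUl.
have le2 : (msupp g2 `<=` d)%fset by apply: fsubsetUr.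
have le : (msupp (c *: g1 + g2) `<=` d)%fset.
  apply: fsubset_trans (msuppD_le _ _) _; apply: fsetSU; exact: msuppZ_le.
rewrite (linextEw _ le) (linextEw _ le1) (linextEw _ le2) scaler_sumr.
rewrite -big_split /=; apply: eq_bigr => k _.
by rewrite mcoeffD mcoeffZ scalerDl scalerA.
Qed.

HB.instance Definition _ h :=
  GRing.isLinear.Build R {malg R[I]} V *:%R (linext h) (linext_is_linear h).

Lemma linextU h c k : linext h << c *g k >> = c *: h k.
Proof. by rewrite (linextEw _ msuppU_le) big_seq_fset1 mcoeffUU. Qed.

Lemma malg_sumE (g : {malg R[I]}) : g = \sum_(k <- msupp g) g@_k *: << k >>.
Proof.
rewrite {1}[g]monalgE; apply: eq_bigr => k _.
by apply/malgP => k'; rewrite mcoeffZ !mcoeffU mulrnAr mulr1.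
Qed.

Lemma linear_malg_eq (f1 f2 : {linear {malg R[I]} -> V}) :
  (forall k, f1 << k >> = f2 << k >>) -> f1 =1 f2.
Proof.
move=> eqf g; rewrite [g]malg_sumE !linear_sum; apply: eq_bigr => k _.
by rewrite !linearZ /= eqf.
Qed.

End LinearExtension.

(* A finite nonempty quiver.  Nonemptiness is only there to make the path
   algebra an algType, as MathComp algebras are nontrivial rings. *)
Record quiver := Quiver {
  vertex : finType;
  arrow : finType;
  source : arrow -> vertex;
  target : arrow -> vertex;
  vertex_witness : vertex
}.

(* [is_qpath v s]: the arrows of s compose, from left to right, to a path
   starting at the vertex v. *)
Fixpoint is_qpath (Q : quiver) (v : vertex Q) (s : seq (arrow Q)) : bool :=
  if s is a :: s' then (source a == v) && is_qpath (target a) s' else true.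

Definition qpath (Q : quiver) :=
  {p : vertex Q * seq (arrow Q) | is_qpath p.1 p.2}.

HB.instance Definition _ Q := SubChoice.on (qpath Q).

Section Paths.
Variable Q : quiver.
Implicit Types (v : vertex Q) (a : arrow Q) (p q r : qpath Q).

Definition path_source p : vertex Q := (sval p).1.
Definition path_arrows p : seq (arrow Q) := (sval p).2.
Definition path_target p : vertex Q :=
  last (path_source p) (map (@target Q) (path_arrows p)).

Definition vertex_path v : qpath Q := exist _ (v, [::]) isT.

Lemma arrow_path_subproof a : is_qpath (source a) [:: a].
Proof. by rewrite /= eqxx. Qed.

Definition arrow_path a : qpath Q :=
  exist _ (source a, [:: a]) (arrow_path_subproof a).

(* p followed by q; [insub] succeeds whenever the endpoints match, by
   [pcat_SomeP] below. *)
Definition pcat p q : option (qpath Q) :=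
  if path_target p == path_source q
  then insub (path_source p, path_arrows p ++ path_arrows q) else None.

Lemma is_qpath_cat v (s1 s2 : seq (arrow Q)) :
  is_qpath v (s1 ++ s2) =
  is_qpath v s1 && is_qpath (last v (map (@target Q) s1)) s2.
Proof. by elim: s1 v => //= a s1 IH v; rewrite IH andbA. Qed.

Lemma qpath_inj p q :
  path_source p = path_source q -> path_arrows p = path_arrows q -> p = q.
Proof.
rewrite /path_source /path_arrows => e1 e2; apply: val_inj.
by rewrite /=; case: (sval p) (sval q) e1 e2 => [v s] [v' s'] /= -> ->.
Qed.

Lemma pcat_SomeP p q r :
  pcat p q = Some r <->
  [/\ path_target p = path_source q, path_source r = path_source p
    & path_arrows r = path_arrows p ++ path_arrows q].
Proof.
rewrite /pcat; split.
  case: eqP => // e; case: insubP => //= u _ eu [<-].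
  by rewrite /path_source /path_arrows eu.
case=> e1 e2 e3; rewrite e1 eqxx -e2 -e3.
have -> : (path_source r, path_arrows r) = sval r
  by rewrite /path_source /path_arrows; case: (sval r).
exact: valK.
Qed.

Lemma pcat_total p q : path_target p = path_source q -> {r | pcat p q = Some r}.
Proof.
move=> e; have pq : is_qpath (path_source p) (path_arrows p ++ path_arrows q).
  by rewrite is_qpath_cat (valP p) /= -/(path_target p) e (valP q).
exists (exist (fun x : vertex Q * seq (arrow Q) => is_qpath x.1 x.2) (_, _) pq).
by apply/pcat_SomeP; split.
Qed.

Lemma path_target_cat p q r :
  pcat p q = Some r -> path_target r = path_target q.
Proof.
move=> /pcat_SomeP[e1 e2 e3]; rewrite /path_target e2 e3 map_cat last_cat.
by rewrite -/(path_target p) e1.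
Qed.

Lemma pcatA p q r :
  obind (pcat p) (pcat q r) = obind (pcat^~ r) (pcat p q).
Proof.
case: (path_target q =P path_source r) => [eqr|neqr]; last first.
  have -> : pcat q r = None by rewrite /pcat; case: eqP.
  case E: (pcat p q) => [s|] //=; rewrite /pcat (path_target_cat E).
  by case: eqP.
case: (path_target p =P path_source q) => [epq|nepq]; last first.
  have -> : pcat p q = None by rewrite /pcat; case: eqP.
  case E: (pcat q r) => [s|] //=; case/pcat_SomeP: E => _ e _.
  by rewrite /pcat e; case: eqP.
have [s es] := pcat_total eqr; have [t et] := pcat_total epq.
rewrite es et /=.
have tt := path_target_cat et; move: (es) (et).
move=> /pcat_SomeP[_ s1 s2] /pcat_SomeP[_ t1 t2].
have [u eu] : {u | pcat p s = Some u} by apply: pcat_total; rewrite s1.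
rewrite eu; case/pcat_SomeP: eu => _ u1 u2; apply/esym/pcat_SomeP.
by split; rewrite ?tt // ?t1 // u2 s2 t2 catA.
Qed.

Lemma pcat0p v p :
  pcat (vertex_path v) p = if v == path_source p then Some p else None.
Proof.
case: eqP => [e|ne]; last by rewrite /pcat /path_target /=; case: eqP.
by apply/pcat_SomeP; split.
Qed.

Lemma pcatp0 v p :
  pcat p (vertex_path v) = if path_target p == v then Some p else None.
Proof.
case: eqP => [e|ne]; last by rewrite /pcat; case: eqP.
by apply/pcat_SomeP; split => //; rewrite cats0.
Qed.

End Paths.

Definition path_algebra (K : fieldType) (Q : quiver) := {malg K[qpath Q]}.

HB.instance Definition _ (K : fieldType) (Q : quiver) :=
  GRing.Lmodule.copy (path_algebra K Q) {malg K[qpath Q]}.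

(* Locked only to keep unification from unfolding {malg _}. *)
HB.lock Definition path_elt (K : fieldType) (Q : quiver) (p : qpath Q) :
  path_algebra K Q := << p >>.

HB.lock Definition palg_mul (K : fieldType) (Q : quiver)
    (x y : path_algebra K Q) : path_algebra K Q :=
  linext (fun p => linext (fun q => oapp (@path_elt K Q) 0 (pcat p q)) y) x.

Section PathAlgebra.
Variables (K : fieldType) (Q : quiver).
Local Notation KQ := (path_algebra K Q).
Local Notation path_elt := (@path_elt K Q).
Local Notation palg_mul := (@palg_mul K Q).
Implicit Types (p q r : qpath Q) (x y z : KQ).

Definition palg_one : KQ := \sum_(v : vertex Q) path_elt (vertex_path v).

Definition path_mul p q : KQ := oapp path_elt 0 (pcat p q).

Lemma palg_mulUU p q : palg_mul (path_elt p) (path_elt q) = path_mul p q.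
Proof.
have E t : path_elt t = << t >> by rewrite path_elt.unlock.
by rewrite palg_mul.unlock (E p) (E q) !linextU !scale1r.
Qed.

Lemma palg_mul_linearl y c x z :
  palg_mul (c *: x + z) y = c *: palg_mul x y + palg_mul z y.
Proof. rewrite palg_mul.unlock; exact: linext_is_linear. Qed.

Lemma palg_mul_linearr x c y z :
  palg_mul x (c *: y + z) = c *: palg_mul x y + palg_mul x z.
Proof.
have E t : palg_mul x t =
  \sum_(p <- msupp x) x@_p *: linext (path_mul p) t by rewrite palg_mul.unlock.
rewrite !E scaler_sumr -big_split /=.
apply: eq_bigr => p _.
rewrite [linext _ _](linext_is_linear (path_mul p) c y z) scalerDr !scalerA.
by rewrite (mulrC c).
Qed.

Lemma palg_mulDl : left_distributive palg_mul +%R.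
Proof.
by move=> x y z; have := palg_mul_linearl z 1 x y; rewrite !scale1r.
Qed.

Lemma palg_mulDr : right_distributive palg_mul +%R.
Proof.
by move=> x y z; have := palg_mul_linearr x 1 y z; rewrite !scale1r.
Qed.

Lemma palg_mul0l : left_zero 0 palg_mul.
Proof. by move=> x; apply: (addrI (palg_mul 0 x)); rewrite -palg_mulDl !addr0. Qed.

Lemma palg_mul0r : right_zero 0 palg_mul.
Proof. by move=> x; apply: (addrI (palg_mul x 0)); rewrite -palg_mulDr !addr0. Qed.

Lemma palg_scalerAl (c : K) x y : c *: palg_mul x y = palg_mul (c *: x) y.
Proof.
by rewrite -[c *: x]addr0 palg_mul_linearl palg_mul0l addr0.
Qed.

Lemma palg_scalerAr (c : K) x y : c *: palg_mul x y = palg_mul x (c *: y).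
Proof.
by rewrite -[c *: y]addr0 palg_mul_linearr palg_mul0r addr0.
Qed.

Lemma palg_ind (P : KQ -> Prop) :
  (forall c x y, P x -> P y -> P (c *: x + y)) -> P 0 ->
  (forall p, P (path_elt p)) -> forall x, P x.
Proof.
move=> Plin P0 + x; rewrite path_elt.unlock => Pp; rewrite (malg_sumE x).
elim/big_rec: _ => [|p y _ Py].
  exact: P0.
exact: (Plin _ << p >>).
Qed.

Lemma palg_mulA : associative palg_mul.
Proof.
move=> x y z; elim/palg_ind: x => [c x x' IH IH'||p].
- by rewrite !(palg_mul_linearl _ c) IH IH'.
- by rewrite !palg_mul0l.
elim/palg_ind: y => [c y y' IH IH'||q].
- by rewrite palg_mul_linearl !palg_mul_linearr palg_mul_linearl IH IH'.
- by rewrite !(palg_mul0l, palg_mul0r).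
elim/palg_ind: z => [c z z' IH IH'||r].
- by rewrite !palg_mul_linearr IH IH'.
- by rewrite !palg_mul0r.
rewrite !palg_mulUU.
have -> : palg_mul (path_elt p) (path_mul q r)
   = oapp path_elt 0 (obind (pcat p) (pcat q r)).
  rewrite /path_mul; case: (pcat q r) => [s|] /=; first exact: palg_mulUU.
  exact: palg_mul0r.
rewrite pcatA /path_mul; case: (pcat p q) => [s|] /=.
  by rewrite palg_mulUU.
by rewrite palg_mul0l.
Qed.

Lemma palg_mul1l : left_id palg_one palg_mul.
Proof.
elim/palg_ind => [c x x' IH IH'||p].
- by rewrite palg_mul_linearr IH IH'.
- exact: palg_mul0r.
rewrite /palg_one (big_morph _ (fun x y => palg_mulDl x y (path_elt p))
  (palg_mul0l _)).
rewrite (bigD1 (path_source p)) //=.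
rewrite palg_mulUU /path_mul pcat0p eqxx big1 ?addr0 //= => v ne.
by rewrite palg_mulUU /path_mul pcat0p (negPf ne).
Qed.

Lemma palg_mul1r : right_id palg_one palg_mul.
Proof.
elim/palg_ind => [c x x' IH IH'||p].
- by rewrite palg_mul_linearl IH IH'.
- exact: palg_mul0l.
rewrite /palg_one (big_morph _ (palg_mulDr (path_elt p)) (palg_mul0r _)).
rewrite (bigD1 (path_target p)) //=.
rewrite palg_mulUU /path_mul pcatp0 eqxx big1 ?addr0 //= => v ne.
by rewrite palg_mulUU /path_mul pcatp0 eq_sym (negPf ne).
Qed.

Lemma palg_one_neq0 : palg_one != 0.
Proof.
pose w := vertex_witness Q; pose f := @mcoeff _ K (vertex_path w).
have fE (v : vertex Q) : f << vertex_path v >> = (v == w)%:R.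
  rewrite /f mcoeffU; congr (_ *+ nat_of_bool _).
  apply/eqP/eqP => [/(congr1 (@path_source Q))|->] //.
have f1 : f (\sum_(v : vertex Q) << vertex_path v >>) = 1.
  rewrite /f raddf_sum (eq_bigr (fun v => (v == w)%:R)) => [|v _]; last exact: fE.
  by rewrite (bigD1 w) //= eqxx big1 ?addr0 // => v /negPf ->.
apply/eqP; rewrite /palg_one path_elt.unlock => /(congr1 f); rewrite [LHS]f1.
by rewrite [RHS]mcoeff0 => /eqP; rewrite oner_eq0.
Qed.

HB.instance Definition _ := GRing.Zmodule_isNzRing.Build KQ
  palg_mulA palg_mul1l palg_mul1r palg_mulDl palg_mulDr palg_one_neq0.

HB.instance Definition _ := GRing.Lmodule_isLalgebra.Build K KQ palg_scalerAl.

HB.instance Definition _ := GRing.Lalgebra_isAlgebra.Build K KQ palg_scalerAr.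

Definition arr (a : arrow Q) : KQ := path_elt (arrow_path a).

End PathAlgebra.

Arguments arr {K Q} a.

(* Membership in the two-sided ideal generated by the elements of S. *)
Definition in_ideal (R : nzRingType) (S : seq R) (x : R) : Prop :=
  exists n (u g v : 'I_n -> R),
    (forall i, g i \in S) /\ x = \sum_(i < n) u i * g i * v i.

(* A is isomorphic, as a K-algebra, to KQ/I where I is the two-sided ideal of
   KQ generated by [rels]. *)
Definition presented_by (K : fieldType) (Q : quiver)
    (rels : seq (path_algebra K Q)) (A : falgType K) : Prop :=
  exists phi : {lrmorphism path_algebra K Q -> A},
    (forall a : A, exists x, phi x = a) /\
    (forall x, phi x = 0 <-> in_ideal rels x).

Section ConverseAlgebra.
Variable K : fieldType.

HB.instance Definition _ (V : lmodType K) := GRing.Lmodule.on V^c.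
HB.instance Definition _ (V : vectType K) := Vector.on V^c.

Lemma converse_scalerAl (A : falgType K) (c : K) (x y : A^c) :
  c *: (x * y) = (c *: x : A^c) * y.
Proof. exact: (scalerAr c (y : A) (x : A)). Qed.

Lemma converse_scalerAr (A : falgType K) (c : K) (x y : A^c) :
  c *: (x * y) = x * (c *: y : A^c).
Proof. exact: (scalerAl c (y : A) (x : A)). Qed.

HB.instance Definition _ (A : falgType K) :=
  GRing.Lmodule_isLalgebra.Build K A^c (@converse_scalerAl A).
HB.instance Definition _ (A : falgType K) :=
  GRing.Lalgebra_isAlgebra.Build K A^c (@converse_scalerAr A).

End ConverseAlgebra.

(* A (x) B has basis (e_i (x) f_j), where (e_i) and (f_j) are bases of A and B;
   an element is represented by the matrix of its coordinates. *)
Definition tensor (K : fieldType) (A B : falgType K) :=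
  'M[K]_(\dim {:A}, \dim {:B}).

HB.instance Definition _ (K : fieldType) (A B : falgType K) :=
  Vector.copy (tensor A B) 'M[K]_(\dim {:A}, \dim {:B}).

HB.lock Definition tens (K : fieldType) (A B : falgType K) (a : A) (b : B) :
    tensor A B :=
  \matrix_(i, j) (coord (vbasis {:A}) i a * coord (vbasis {:B}) j b).

(* The linear map A (x) B -> V induced by a bilinear map f. *)
HB.lock Definition tensor_lift (K : fieldType) (A B : falgType K)
    (V : lmodType K) (f : A -> B -> V) (t : tensor A B) : V :=
  \sum_i \sum_j t i j *: f (vbasis {:A})`_i (vbasis {:B})`_j.

Definition tensor_mul (K : fieldType) (A B : falgType K) (s t : tensor A B) :
    tensor A B :=
  tensor_lift (fun a b =>
    tensor_lift (fun a' b' => tens (a * a') (b * b')) t) s.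

Section Tensor.
Variables (K : fieldType) (A B : falgType K).
Local Notation T := (tensor A B).

Lemma tensor_lift_linear (V : lmodType K) (f : A -> B -> V) c s t :
  tensor_lift f (c *: s + t) = c *: tensor_lift f s + tensor_lift f t.
Proof.
rewrite tensor_lift.unlock scaler_sumr -big_split; apply: eq_bigr => i _ /=.
rewrite scaler_sumr -big_split; apply: eq_bigr => j _ /=.
by rewrite !mxE scalerDl scalerA.
Qed.

Lemma tens_linearl (b : B) c (a a' : A) :
  tens (c *: a + a') b = c *: tens a b + tens a' b.
Proof.
by rewrite tens.unlock; apply/matrixP => i j; rewrite !mxE linearP mulrDl mulrA.
Qed.

Lemma tens_linearr (a : A) c (b b' : B) :
  tens a (c *: b + b') = c *: tens a b + tens a b'.
Proof.
rewrite tens.unlock; apply/matrixP => i j; rewrite !mxE linearP mulrDr.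
by rewrite mulrCA.
Qed.

Definition bilinear_map (V : lmodType K) (f : A -> B -> V) : Prop :=
  (forall b, linear (f^~ b)) /\ (forall a, linear (f a)).

Lemma tensor_lift_tens (V : lmodType K) (f : A -> B -> V) :
  bilinear_map f -> forall a b, tensor_lift f (tens a b) = f a b.
Proof.
move=> [fl fr] a b.
pose Fl b0 := GRing.isLinear.Build K A V *:%R (f^~ b0) (fl b0).
pose fL b0 : {linear A -> V} := HB.pack (f^~ b0) (Fl b0).
pose Fr a0 := GRing.isLinear.Build K B V *:%R (f a0) (fr a0).
pose fR a0 : {linear B -> V} := HB.pack (f a0) (Fr a0).
rewrite -[RHS]/(fL b a) [in RHS](coord_vbasis (memvf a)) linear_sum.
rewrite tensor_lift.unlock; apply: eq_bigr => i _; rewrite linearZZ.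
rewrite -[fL b _]/(fR (vbasis {:A})`_i b) [in RHS](coord_vbasis (memvf b)).
rewrite linear_sum scaler_sumr; apply: eq_bigr => j _.
by rewrite linearZZ scalerA tens.unlock mxE.
Qed.

Lemma tens_bilinear : bilinear_map (@tens K A B).
Proof.
by split=> [b c a a'|a c b b']; [apply: tens_linearl|apply: tens_linearr].
Qed.

Lemma tensor_ind (P : T -> Prop) :
  (forall c s t, P s -> P t -> P (c *: s + t)) -> P 0 ->
  (forall a b, P (tens a b)) -> forall t, P t.
Proof.
move=> Plin P0 Pt t.
have -> : t = \sum_i \sum_j
    t i j *: tens ((vbasis {:A})`_i) ((vbasis {:B})`_j).
  apply/matrixP => i j; rewrite summxE (bigD1 i) //= summxE (bigD1 j) //=.
  have bE (V : vectType K) (k l : 'I_(\dim {:V})) :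
      coord (vbasis {:V}) k (vbasis {:V})`_l = (k == l)%:R.
    by rewrite coord_free; [rewrite eq_sym|exact: basis_free (vbasisP _)].
  rewrite tens.unlock !mxE !bE !eqxx !mulr1.
  rewrite big1 => [|j' ne]; last by rewrite !mxE !bE (eq_sym j) (negPf ne) !mulr0.
  rewrite big1 ?addr0 // => i' ne; rewrite summxE big1 // => j' _.
  by rewrite !mxE !bE (eq_sym i) (negPf ne) mul0r mulr0.
have PD x y : P x -> P y -> P (x + y).
  by move=> Px Py; rewrite -[x]scale1r; apply: Plin.
apply: big_rec => // i x _ Px; apply: PD => //.
by apply: big_rec => // j y _ Py; apply: Plin.
Qed.

Lemma tensor_lift0 (V : lmodType K) (f : A -> B -> V) : tensor_lift f 0 = 0.
Proof.
rewrite tensor_lift.unlock big1 // => i _; rewrite big1 // => j _.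
by rewrite mxE scale0r.
Qed.

Lemma tensor_lift2_linear (V : lmodType K) (s : T) (f : A -> B -> A -> B -> V) :
  forall c t t',
  tensor_lift (fun a b => tensor_lift (f a b) (c *: t + t')) s =
  c *: tensor_lift (fun a b => tensor_lift (f a b) t) s
  + tensor_lift (fun a b => tensor_lift (f a b) t') s.
Proof.
move=> c t t'; have E g : tensor_lift g s =
  \sum_i \sum_j s i j *: g (vbasis {:A})`_i (vbasis {:B})`_j :> V.
  by rewrite tensor_lift.unlock.
rewrite !E scaler_sumr -big_split; apply: eq_bigr => i _ /=.
rewrite scaler_sumr -big_split; apply: eq_bigr => j _ /=.
rewrite tensor_lift_linear scalerDr !scalerA.
by rewrite (mulrC c).
Qed.

Lemma tensor_mul_linearl (t : T) c s s' :
  tensor_mul (c *: s + s') t = c *: tensor_mul s t + tensor_mul s' t.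
Proof. exact: tensor_lift_linear. Qed.

Lemma tens_mul_bilinear (a : A) (b : B) :
  bilinear_map (fun a' b' => tens (a * a') (b * b')).
Proof.
split=> [b' c x y|a' c x y].
  by rewrite mulrDr -scalerAr tens_linearl.
by rewrite mulrDr -scalerAr tens_linearr.
Qed.

Lemma tensor_mul_linearr (s : T) c t t' :
  tensor_mul s (c *: t + t') = c *: tensor_mul s t + tensor_mul s t'.
Proof. exact: tensor_lift2_linear. Qed.

Lemma tensor_mul_tens (a a' : A) (b b' : B) :
  tensor_mul (tens a b) (tens a' b') = tens (a * a') (b * b').
Proof.
rewrite /tensor_mul tensor_lift_tens.
  by rewrite (tensor_lift_tens (tens_mul_bilinear a b)).
split=> [b0 c x y|a0 c x y].
  elim/tensor_ind: (tens a' b') => [d s t IHs IHt||u v].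
  - by rewrite !tensor_lift_linear IHs IHt !scalerDr !scalerA (mulrC d) addrACA.
  - by rewrite !tensor_lift0 scaler0 addr0.
  rewrite !(tensor_lift_tens (tens_mul_bilinear _ _)) mulrDl -scalerAl.
  by rewrite tens_linearl.
elim/tensor_ind: (tens a' b') => [d s t IHs IHt||u v].
- by rewrite !tensor_lift_linear IHs IHt !scalerDr !scalerA (mulrC d) addrACA.
- by rewrite !tensor_lift0 scaler0 addr0.
rewrite !(tensor_lift_tens (tens_mul_bilinear _ _)) mulrDl -scalerAl.
by rewrite tens_linearr.
Qed.

Lemma tensor_mul0l : left_zero (0 : T) (@tensor_mul K A B).
Proof. by move=> t; rewrite /tensor_mul tensor_lift0. Qed.

Lemma tensor_mul0r : right_zero (0 : T) (@tensor_mul K A B).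
Proof.
move=> t; have := tensor_mul_linearr t (-1) 0 0.
by rewrite scaler0 addr0 scaleN1r addNr.
Qed.

Lemma tensor_mulA : associative (@tensor_mul K A B).
Proof.
move=> x y z; elim/tensor_ind: x => [c x x' IH IH'||a b].
- by rewrite !tensor_mul_linearl IH IH'.
- by rewrite !tensor_mul0l.
elim/tensor_ind: y => [c y y' IH IH'||a' b'].
- by rewrite tensor_mul_linearl !tensor_mul_linearr tensor_mul_linearl IH IH'.
- by rewrite !(tensor_mul0l, tensor_mul0r).
elim/tensor_ind: z => [c z z' IH IH'||a'' b''].
- by rewrite !tensor_mul_linearr IH IH'.
- by rewrite !tensor_mul0r.
by rewrite !tensor_mul_tens !mulrA.
Qed.

Lemma tensor_mul1l : left_id (tens 1 1) (@tensor_mul K A B).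
Proof.
elim/tensor_ind => [c x x' IH IH'||a b].
- by rewrite tensor_mul_linearr IH IH'.
- by rewrite tensor_mul0r.
by rewrite tensor_mul_tens !mul1r.
Qed.

Lemma tensor_mul1r : right_id (tens 1 1) (@tensor_mul K A B).
Proof.
elim/tensor_ind => [c x x' IH IH'||a b].
- by rewrite tensor_mul_linearl IH IH'.
- by rewrite tensor_mul0l.
by rewrite tensor_mul_tens !mulr1.
Qed.

Lemma tensor_mulDl : left_distributive (@tensor_mul K A B) +%R.
Proof.
by move=> x y z; have := tensor_mul_linearl z 1 x y; rewrite !scale1r.
Qed.

Lemma tensor_mulDr : right_distributive (@tensor_mul K A B) +%R.
Proof.
by move=> x y z; have := tensor_mul_linearr x 1 y z; rewrite !scale1r.
Qed.

Lemma tensor_one_neq0 : tens (1 : A) (1 : B) != 0.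
Proof.
have nz (V : falgType K) : exists i, coord (vbasis {:V}) i (1 : V) != 0.
  apply/existsP; apply: contraT => /existsPn z.
  have := oner_neq0 V; rewrite (coord_vbasis (memvf (1 : V))) big1 ?eqxx // => i _.
  by move/negPn/eqP: (z i) => ->; rewrite scale0r.
have [[i ni] [j nj]] := (nz A, nz B).
apply/eqP => /matrixP/(_ i j)/eqP; rewrite tens.unlock !mxE mulf_eq0.
by rewrite (negPf ni) (negPf nj).
Qed.

HB.instance Definition _ := GRing.Zmodule_isNzRing.Build (tensor A B)
  tensor_mulA tensor_mul1l tensor_mul1r tensor_mulDl tensor_mulDr
  tensor_one_neq0.

Lemma tensor_scalerAl (c : K) (s t : T) : c *: (s * t) = (c *: s) * t.
Proof.
by have := tensor_mul_linearl t c s 0; rewrite tensor_mul0l !addr0.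
Qed.

Lemma tensor_scalerAr (c : K) (s t : T) : c *: (s * t) = s * (c *: t).
Proof.
by have := tensor_mul_linearr s c t 0; rewrite tensor_mul0r !addr0.
Qed.

HB.instance Definition _ :=
  GRing.Lmodule_isLalgebra.Build K (tensor A B) tensor_scalerAl.
HB.instance Definition _ :=
  GRing.Lalgebra_isAlgebra.Build K (tensor A B) tensor_scalerAr.

End Tensor.

(* A^e = A^op (x)_K A, where A^op is MathComp's converse ring A^c. *)
Definition enveloping (K : fieldType) (A : falgType K) : algType K :=
  tensor A^c A.

(* A as a left A^e-module: (a (x) b) *: m = b * m * a (see [env_act_tens]). *)
Definition regular_bimodule (K : fieldType) (A : falgType K) : Type := A.

HB.instance Definition _ (K : fieldType) (A : falgType K) :=
  GRing.Zmodule.copy (regular_bimodule A) A.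

Definition env_act (K : fieldType) (A : falgType K) (t : tensor A^c A) (m : A) :
    A :=
  tensor_lift (fun (a : A^c) (b : A) => b * m * (a : A)) t.

Section RegularBimodule.
Variables (K : fieldType) (A : falgType K).
Implicit Types (s t : tensor A^c A) (m : A).

Lemma env_act_tens (a : A^c) (b m : A) :
  env_act (tens a b) m = b * m * (a : A).
Proof.
apply: tensor_lift_tens; split=> [b' c x y|a' c x y].
  by rewrite mulrDr scalerAr.
by rewrite !mulrDl -!scalerAl.
Qed.

Lemma env_actDl m s t : env_act (s + t) m = env_act s m + env_act t m.
Proof.
by rewrite -[s]scale1r /env_act tensor_lift_linear !scale1r.
Qed.

Lemma env_actZl m c s : env_act (c *: s) m = c *: env_act s m.
Proof.
by rewrite -[c *: s]addr0 /env_act tensor_lift_linear tensor_lift0 addr0.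
Qed.

Lemma env_act0l m : env_act 0 m = 0.
Proof. exact: tensor_lift0. Qed.

Lemma env_actP c t m m' :
  env_act t (c *: m + m') = c *: env_act t m + env_act t m'.
Proof.
elim/tensor_ind: t => [d s t IHs IHt||a b].
- by rewrite !env_actDl !env_actZl IHs IHt !scalerDr !scalerA (mulrC c) addrACA.
- by rewrite !env_act0l scaler0 addr0.
by rewrite !env_act_tens mulrDr mulrDl -scalerAr -scalerAl.
Qed.

Lemma env_actDr t : {morph env_act t : m m' / m + m'}.
Proof. by move=> m m'; have := env_actP 1 t m m'; rewrite !scale1r. Qed.

Lemma env_act0r t : env_act t 0 = 0.
Proof. by apply: (addrI (env_act t 0)); rewrite -env_actDr !addr0. Qed.

Lemma env_actZr c t m : env_act t (c *: m) = c *: env_act t m.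
Proof. by have := env_actP c t m 0; rewrite env_act0r !addr0. Qed.

Lemma env_actA s t m : env_act s (env_act t m) = env_act (s * t) m.
Proof.
elim/tensor_ind: s => [c s s' IH IH'||a b].
- by rewrite mulrDl -scalerAl !env_actDl !env_actZl IH IH'.
- by rewrite mul0r !env_act0l.
elim/tensor_ind: t => [c t t' IH IH'||a' b'].
- by rewrite mulrDr -scalerAr !env_actDl !env_actZl env_actP IH IH'.
- by rewrite mulr0 !env_act0l env_act0r.
have -> : tens a b * tens a' b' = tens (a * a') (b * b') by apply: tensor_mul_tens.
by rewrite !env_act_tens !mulrA.
Qed.

Lemma env_act1 m : env_act 1 m = m.
Proof.
have -> : 1 = tens 1 1 :> tensor A^c A by [].
by rewrite env_act_tens mul1r mulr1.
Qed.

HB.instance Definition _ :=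
  @GRing.Zmodule_isLmodule.Build (enveloping A) (regular_bimodule A)
    (@env_act K A) env_actA env_act1 env_actDr env_actDl.

End RegularBimodule.

Definition projective (R : nzRingType) (P : lmodType R) : Prop :=
  forall (U V : lmodType R) (g : {linear U -> V}) (f : {linear P -> V}),
    (forall v, exists u, g u = v) ->
    exists h : {linear P -> U}, forall x, g (h x) = f x.

Record proj_resolution (R : nzRingType) (M : lmodType R) := ProjResolution {
  res_mod :> nat -> lmodType R;
  res_diff : forall n, {linear res_mod n.+1 -> res_mod n};
  res_aug : {linear res_mod 0 -> M};
  res_projective : forall n, projective (res_mod n);
  res_aug_surj : forall m, exists x, res_aug x = m;
  res_exact0 : forall x, res_aug x = 0 <-> exists y, res_diff 0 y = x;
  res_exactS : forall n x, res_diff n x = 0 <-> exists y, res_diff n.+1 y = x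
}.

Section Ext.
Variables (K : fieldType) (R : algType K) (M N : lmodType R).
Variable P : proj_resolution M.

Definition cocycle n (f : P n -> N) : Prop := forall x, f (res_diff P n x) = 0.

Definition coboundary n : (P n -> N) -> Prop :=
  if n is n'.+1
  then fun f => exists g : {linear P n' -> N}, forall x, f x = g (res_diff P n' x)
  else fun f => forall x, f x = 0.

(* The classes of b_0, ..., b_(d-1) form a K-basis of H^n(Hom_R(P, N)); K acts
   on N, hence on Hom_R(P n, N), through the central map c |-> c%:A : R. *)
Definition cohomology_basis n d (b : 'I_d -> {linear P n -> N}) : Prop :=
  (forall i, cocycle (b i)) /\
  (forall f : {linear P n -> N}, cocycle f ->
     exists! c : 'rV[K]_d,
       coboundary (fun x => f x - \sum_(i < d) (c 0 i)%:A *: b i x)).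

End Ext.

(* dim_K Ext^n_R(M, N) = d, for Ext computed from any projective resolution of
   M.  Projective resolutions exist by [proj_resolution_exists] below. *)
Definition dim_Ext_is (K : fieldType) (R : algType K) (n : nat)
    (M N : lmodType R) (d : nat) : Prop :=
  forall P : proj_resolution M,
    exists b : 'I_d -> {linear P n -> N}, cohomology_basis b.

Section ExistsResolution.
Variable R : nzRingType.

Lemma malg_projective (I : choiceType) : projective {malg R[I]}.
Proof.
move=> U V g f gs; have gs' v : exists u, g u == v.
  by have [u <-] := gs v; exists u.
exists (linext (fun i => xchoose (gs' (f << i >>)))) => x.
apply: (@linear_malg_eq I R V (g \o linext _) f) => i /=.
by rewrite linextU scale1r; apply/eqP/(xchooseP (gs' (f << i >>))).
Qed.

Definition kernel_cover (U V : lmodType R) (f : {linear U -> V}) :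
    {linear {malg R[U]} -> U} :=
  linext (fun u => if f u == 0 then u else 0).

Lemma kernel_coverP (U V : lmodType R) (f : {linear U -> V}) u :
  f u = 0 <-> exists y, kernel_cover f y = u.
Proof.
split=> [fu0|[y <-]].
  by exists << u >>; rewrite /kernel_cover /= linextU scale1r fu0 eqxx.
rewrite /kernel_cover /= /linext linear_sum big1 // => k _; rewrite linearZ /=.
by case: eqP => [->|_]; rewrite ?linear0 scaler0.
Qed.

Record stage := Stage {
  stage_src : lmodType R; stage_tgt : lmodType R;
  stage_map : {linear stage_src -> stage_tgt}
}.

Definition next_stage (s : stage) : stage :=
  Stage (kernel_cover (stage_map s)).

Lemma proj_resolution_exists (M : lmodType R) : inhabited (proj_resolution M).
Proof.
pose s0 := Stage (linext id : {linear {malg R[M]} -> M}).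
pose s n := iter n next_stage s0.
split; apply: (@ProjResolution R M (fun n => stage_src (s n))
  (fun n => stage_map (s n.+1)) (linext id)).
- by case=> [|n]; apply: malg_projective.
- by move=> m; exists << m >>; rewrite /= linextU scale1r.
- by move=> x; apply: kernel_coverP.
- by move=> n x; apply: kernel_coverP.
Qed.

End ExistsResolution.

Definition dim_HH_is (K : fieldType) (n : nat) (A : falgType K) (d : nat) :
    Prop :=
  @dim_Ext_is K (enveloping A) n (regular_bimodule A) (regular_bimodule A) d.

Variant vertex3 := v1 | v2 | v3.
Variant arrow4 := alpha4 | beta4 | gamma4 | delta4.
Variant arrow5 := alpha5 | beta5 | gamma5 | delta5 | sigma5.

Definition vertex3_code (v : vertex3) : 'I_3 :=
  match v with
  | v1 => @Ordinal 3 0 isT | v2 => @Ordinal 3 1 isT | v3 => @Ordinal 3 2 isT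
  end.
Definition vertex3_decode (i : 'I_3) : vertex3 := nth v3 [:: v1; v2] i.
Lemma vertex3_codeK : cancel vertex3_code vertex3_decode.
Proof. by case. Qed.
HB.instance Definition _ := Finite.copy vertex3 (can_type vertex3_codeK).

Definition arrow4_code (a : arrow4) : 'I_4 :=
  match a with
  | alpha4 => @Ordinal 4 0 isT | beta4 => @Ordinal 4 1 isT
  | gamma4 => @Ordinal 4 2 isT | delta4 => @Ordinal 4 3 isT
  end.
Definition arrow4_decode (i : 'I_4) : arrow4 :=
  nth delta4 [:: alpha4; beta4; gamma4] i.
Lemma arrow4_codeK : cancel arrow4_code arrow4_decode.
Proof. by case. Qed.
HB.instance Definition _ := Finite.copy arrow4 (can_type arrow4_codeK).

Definition arrow5_code (a : arrow5) : 'I_5 :=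
  match a with
  | alpha5 => @Ordinal 5 0 isT | beta5 => @Ordinal 5 1 isT
  | gamma5 => @Ordinal 5 2 isT | delta5 => @Ordinal 5 3 isT
  | sigma5 => @Ordinal 5 4 isT
  end.
Definition arrow5_decode (i : 'I_5) : arrow5 :=
  nth sigma5 [:: alpha5; beta5; gamma5; delta5] i.
Lemma arrow5_codeK : cancel arrow5_code arrow5_decode.
Proof. by case. Qed.
HB.instance Definition _ := Finite.copy arrow5 (can_type arrow5_codeK).

Definition quiver3 (E : finType) (st : E -> vertex3 * vertex3) : quiver :=
  @Quiver vertex3 E (fun a => (st a).1) (fun a => (st a).2) v1.

Definition Q4 : quiver := quiver3 (fun a : arrow4 =>
  match a with
  | alpha4 => (v1, v3) | gamma4 => (v3, v2)
  | delta4 => (v1, v2) | beta4 => (v2, v1)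
  end).

Definition Q5 : quiver := quiver3 (fun a : arrow5 =>
  match a with
  | alpha5 => (v2, v2) | beta5 => (v1, v2) | gamma5 => (v2, v1)
  | delta5 => (v2, v3) | sigma5 => (v3, v2)
  end).

Definition Q6 : quiver := quiver3 (fun a : arrow4 =>
  match a with
  | alpha4 => (v1, v2) | beta4 => (v2, v1)
  | delta4 => (v2, v3) | gamma4 => (v3, v2)
  end).

Definition Q7 : quiver := quiver3 (fun a : arrow5 =>
  match a with
  | alpha5 => (v1, v1) | sigma5 => (v1, v3) | gamma5 => (v3, v2)
  | delta5 => (v1, v2) | beta5 => (v2, v1)
  end).

Definition Q8 : quiver := quiver3 (fun a : arrow5 =>
  match a with
  | alpha5 => (v1, v1) | sigma5 => (v3, v1) | gamma5 => (v2, v3)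
  | delta5 => (v2, v1) | beta5 => (v1, v2)
  end).

Section Relations.
Variable K : fieldType.

Definition rels4 : seq (path_algebra K Q4) :=
  let α := arr (alpha4 : arrow Q4) in let β := arr (beta4 : arrow Q4) in
  let γ := arr (gamma4 : arrow Q4) in let δ := arr (delta4 : arrow Q4) in
  [:: δ * β * δ - α * γ;
      (β * δ) ^+ 3 * β;
      γ * β * α - γ * β * δ * β * α].

Definition rels5 : seq (path_algebra K Q5) :=
  let α := arr (alpha5 : arrow Q5) in let β := arr (beta5 : arrow Q5) in
  let γ := arr (gamma5 : arrow Q5) in let δ := arr (delta5 : arrow Q5) in
  let σ := arr (sigma5 : arrow Q5) in
  [:: α ^+ 2 - γ * β;
      α ^+ 3 - δ * σ;
      β * δ;
      σ * γ;
      α * δ;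
      σ * α;
      β * γ - β * α * γ].

Definition rels6 : seq (path_algebra K Q6) :=
  let α := arr (alpha4 : arrow Q6) in let β := arr (beta4 : arrow Q6) in
  let γ := arr (gamma4 : arrow Q6) in let δ := arr (delta4 : arrow Q6) in
  [:: α * δ * γ * δ;
      γ * δ * γ * β;
      α * β - α * δ * γ * β;
      β * α - δ * γ * δ * γ].

Definition rels7 : seq (path_algebra K Q7) :=
  let α := arr (alpha5 : arrow Q7) in let β := arr (beta5 : arrow Q7) in
  let γ := arr (gamma5 : arrow Q7) in let δ := arr (delta5 : arrow Q7) in
  let σ := arr (sigma5 : arrow Q7) in
  [:: β * δ - β * α * δ;
      α * σ;
      α * δ - σ * γ;
      γ * β * α;
      α ^+ 2 - δ * β].

Definition rels8 : seq (path_algebra K Q8) :=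
  let α := arr (alpha5 : arrow Q8) in let β := arr (beta5 : arrow Q8) in
  let γ := arr (gamma5 : arrow Q8) in let δ := arr (delta5 : arrow Q8) in
  let σ := arr (sigma5 : arrow Q8) in
  [:: δ * β - δ * α * β;
      σ * α;
      δ * α - γ * σ;
      α * β * γ;
      α ^+ 2 - β * δ].

Definition is_Lambda4 (A : falgType K) : Prop := presented_by rels4 A.
Definition is_Lambda5 (A : falgType K) : Prop := presented_by rels5 A.
Definition is_Lambda6 (A : falgType K) : Prop := presented_by rels6 A.
Definition is_Lambda7 (A : falgType K) : Prop := presented_by rels7 A.
Definition is_Lambda8 (A : falgType K) : Prop := presented_by rels8 A.

End Relations.

(* Main.v *)
Require Import Defs.
From HB Require Import structures.
From mathcomp Require Import all_boot all_order all_algebra all_field.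
From mathcomp Require Import finmap monalg.

(* Each of the five algebras has a basis of paths that is closed under
   multiplication up to 0: a finite Groebner basis of the relations consists of
   monomials and of differences of two monomials.  The paths span because the
   rewriting rules follow from the relations, and they are independent because
   the right action on them satisfies the relations.

   In characteristic 2, an element with coefficients 0 and 1 in such a basis is a
   finite list, and identities between explicit linear maps are decided by
   cancelling equal entries.  The first terms of a resolution of A by direct sums
   of bimodules A e_s (x) e_t A are exact thanks to explicit left A-linear
   contracting homotopies, and the cohomology of Hom(-, A), whose terms are sums
   of e_s A e_t, is read off from explicit contractions onto representatives.
   Comparison with an arbitrary projective resolution transfers the dimensions. *)

Set Implicit Arguments.
Unset Strict Implicit.
Unset Printing Implicit Defensive.

Import GRing.Theory.
Local Open Scope ring_scope.

(** * Comparison of two projective resolutions *)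

(** [dim_Ext_is] quantifies over all projective resolutions, while only the terms of degree at most
    3 of an explicit one are known; exactness in degrees 0, 1 and 2 is what HH^0, HH^1 and HH^2
    require. The comparison therefore runs one degree at a time, on an invariant that keeps only the
    current piece of the chain homotopies. No submodules are formed: A e_s (x) e_t A is a free
    bimodule of rank 1 with an idempotent endomorphism, so every term is a module of row vectors
    over A^e, and exactness says that p y is a boundary for every cycle y. The homotopies are linear
    on the left only, since a contraction by bimodule maps would make all higher cohomology vanish;
    left linearity still reduces each identity to finitely many elements e_s (x) b_j. The tables are
    certificates: whatever their origin, evaluation checks the identities they have to satisfy, and
    no rank is ever computed. *)

Section Modules.
Variable R : nzRingType.

Lemma linear_pack (U V : lmodType R) (f : U -> V) :
  linear f -> exists g : {linear U -> V}, g =1 f.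
Proof.
move=> lf; pose F := GRing.isLinear.Build R U V *:%R f lf.
pose g : {linear U -> V} := HB.pack f F.
by exists g.
Qed.

(** [projective] lifts along surjections, while here [g] only has to reach the image of [f]. A
    detour through the free module on P avoids forming that image: P is a retract of it by [s], and
    on the free module a lift is chosen generator by generator. *)
Lemma projective_lift (P U V : lmodType R) (f : {linear P -> V})
    (g : {linear U -> V}) :
  projective P -> (forall x, exists u, g u = f x) ->
  exists h : {linear P -> U}, forall x, g (h x) = f x.
Proof.
move=> pP fg; have fg' x : exists u, g u == f x.
  by have [u <-] := fg x; exists u.
pose pr : {linear {malg R[P]} -> P} := linext id.
have [|s prs] := @pP _ _ pr idfun.
  by move=> v; exists << v >>; rewrite /pr /= linextU scale1r.
pose h : {linear {malg R[P]} -> U} := linext (fun x => xchoose (fg' x)).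
have gh : g \o h =1 f \o pr.
  apply: (@linear_malg_eq _ _ _ (g \o h) (f \o pr)) => x /=.
  by rewrite !linextU !scale1r; apply/eqP/(xchooseP (fg' x)).
exists (h \o s) => x; rewrite -[RHS]/(f (idfun x)) -prs.
exact: gh.
Qed.

Lemma rV_projective k : projective 'rV[R]_k.
Proof.
move=> U V g f gs; have gs' v : exists u, g u == v.
  by have [u <-] := gs v; exists u.
pose h (x : 'rV[R]_k) := \sum_i x 0 i *: xchoose (gs' (f (delta_mx 0 i))).
have [|h' h'E] := @linear_pack _ _ h.
  move=> c x y; rewrite /h scaler_sumr -big_split; apply: eq_bigr => i _ /=.
  by rewrite !mxE scalerDl scalerA.
exists h' => x; rewrite h'E linear_sum [in RHS](row_sum_delta x) linear_sum.
apply: eq_bigr => i _ /=.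
by rewrite !linearZ /=; congr (_ *: _); apply/eqP/(xchooseP (gs' _)).
Qed.

End Modules.

(* [P] and [F] are the terms in some degree n of two resolutions of the same
   module, [F] being cut out by the idempotent [p]; [Z] and [W] are the kernels
   of the differentials leaving degree n, [cobP] and [cobF] the coboundaries
   with values in [N]. *)
Definition stage (R : nzRingType) (N P F : lmodType R) (p : {linear F -> F})
    (Z : P -> Prop) (W : F -> Prop) (cobP : (P -> N) -> Prop)
    (cobF : (F -> N) -> Prop) : Prop :=
  exists (f : {linear P -> F}) (g : {linear F -> P})
         (e : {linear P -> P}) (e' : {linear F -> F}),
  [/\ [/\ forall x, Z x -> W (f x), forall y, W y -> Z (g y),
          forall x, p (f x) = f x, forall y, g (p y) = g y
        & forall y, p (e' y) = e' y],
      (forall x, Z x -> e x = 0) /\ (forall x, Z (x - g (f x) - e x)),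
      (forall y, W y -> e' y = 0) /\ (forall y, W (p y - f (g y) - e' y)),
      (forall psi : {linear F -> N}, cobF psi -> cobP (psi \o f)) /\
      (forall phi : {linear P -> N}, cobP phi -> cobF (phi \o g))
    & (forall phi : {linear P -> N}, cobP (phi \o e)) /\
      (forall psi : {linear F -> N}, cobF (psi \o e'))].

Section Comparison.
Variables (R : nzRingType) (N : lmodType R).

(** No homotopy comes from below degree 0, so [e] and [e'] are 0. The lifts of the augmentations are
    composed with [p] to respect the summand it cuts out; [etap] makes this harmless. *)
Lemma stage0 (M P F : lmodType R) (eps : {linear P -> M}) (eta : {linear F -> M})
    (p : {linear F -> F}) :
  projective P -> projective F ->
  (forall m, exists x, eps x = m) -> (forall m, exists y, eta y = m) ->
  (forall y, eta (p y) = eta y) -> (forall y, p (p y) = p y) ->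
  @stage R N P F p (fun x => eps x = 0) (fun y => eta y = 0)
    (fun phi => forall x, phi x = 0) (fun psi => forall y, psi y = 0).
Proof.
move=> pP pF epsS etaS etap pp.
have [f fE] := projective_lift (f := eps) pP (fun x => etaS (eps x)).
have [g gE] := projective_lift (f := eta) pF (fun y => epsS (eta y)).
exists (p \o f), (g \o p), \0, \0; split=> /=.
- split=> [x xZ|y yW|x|y|y] //=; rewrite ?etap ?fE ?gE ?etap ?pp //.
  exact: linear0.
- split=> // x; rewrite subr0 linearB /= gE !etap fE; exact: subrr.
- split=> // x; rewrite subr0 linearB /= !etap fE gE etap; exact: subrr.
- by split=> psi h x /=.
- by split=> phi x /=; rewrite linear0.
Qed.

(** Inductive step of the comparison theorem. In [stage], [e] is the part h d of a homotopy from the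
    identity to g f that comes from the degree below. The rest, 1 - g f - h d, has values in cycles,
    so it lifts along the next differential, and the lift is the next h. On the side of F the
    identity is replaced by [p]. Any cochain composed with h d is a coboundary, which is all that
    cohomology needs. *)
Lemma stageS (P' P F' F : lmodType R) (p : {linear F -> F})
    (p' : {linear F' -> F'}) (d : {linear P' -> P}) (D : {linear F' -> F})
    (Z : P -> Prop) (W : F -> Prop) cobP cobF :
  projective P -> projective P' -> projective F -> projective F' ->
  (forall x, Z x <-> exists y, d y = x) ->
  (forall y, W y -> exists z, D z = p y) -> (forall z, W (D z)) ->
  (forall z, p (D z) = D z) -> (forall z, D (p' z) = D z) ->
  (forall z, p' (p' z) = p' z) -> (forall y, p (p y) = p y) ->
  @stage R N P F p Z W cobP cobF ->
  @stage R N P' F' p' (fun x => d x = 0) (fun y => D y = 0)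
    (fun phi => exists ga : {linear P -> N}, forall x, phi x = ga (d x))
    (fun psi => exists ga : {linear F -> N}, forall y, psi y = ga (D y)).
Proof.
move=> pP pP' pF pF' Zd WD WDz pD Dp' pp' pp.
case=> f [g [e [e' [[fZ gW pf gp pe'] [eZ eH] [e'W e'H] _ _]]]].
have Zdz z : Z (d z) by apply/Zd; exists z.
have [f' f'E] : exists f' : {linear P' -> F'}, forall x, D (f' x) = f (d x).
  apply: (projective_lift (f := f \o d)) => //= x.
  by have [z zE] := WD _ (fZ _ (Zdz x)); exists z; rewrite zE pf.
have [g' g'E] : exists g' : {linear F' -> P'}, forall y, d (g' y) = g (D y).
  apply: (projective_lift (f := g \o D)) => //= y.
  by have /Zd[z <-] := gW _ (WDz y); exists z.
have [h hE] : exists h : {linear P -> P'}, forall x, d (h x) = x - g (f x) - e x.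
  apply: (projective_lift (f := (idfun \- (g \o f)) \- e)) => //= x.
  exact/Zd/eH.
have [k kE] : exists k : {linear F -> F'},
    forall y, D (k y) = p y - f (g y) - e' y.
  apply: (projective_lift (f := (p \- (f \o g)) \- e')) => //= y.
  have [z zE] := WD _ (e'H y); exists z.
  by rewrite zE !linearB /= pf pp pe'.
exists (p' \o f'), (g' \o p'), (h \o d), (p' \o k \o D); split=> /=.
- split=> [x x0|y y0|x|y|y] //=; rewrite ?pp' //.
  + by rewrite Dp' f'E x0 linear0.
  + by rewrite g'E Dp' y0 linear0.
- split=> x /=; first by move=> ->; rewrite linear0.
  rewrite !linearB /= g'E hE !Dp' f'E.
  by rewrite (eZ _ (Zdz x)) subr0 subrr.
- split=> y /=; first by move=> ->; rewrite !linear0.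
  rewrite !linearB /= !Dp' f'E kE g'E Dp' pD.
  by rewrite (e'W _ (WDz y)) subr0 subrr.
- split=> [psi|phi] [ga gaE] /=.
    by exists (ga \o f) => x /=; rewrite gaE Dp' f'E.
  by exists (ga \o g) => x /=; rewrite gaE g'E Dp'.
- split=> [phi|psi] /=; first by exists (phi \o h).
  by exists (psi \o p' \o k).
Qed.

End Comparison.

Section Transfer.
Variables (K : fieldType) (R : algType K) (N : lmodType R).

Lemma scalar_comb_linear (U : lmodType R) m (c : 'rV[K]_m)
    (b : 'I_m -> {linear U -> N}) :
  exists s : {linear U -> N}, forall x, s x = \sum_i (c 0 i)%:A *: b i x.
Proof.
apply: linear_pack => a x y; rewrite scaler_sumr -big_split.
apply: eq_bigr => i _ /=; rewrite linearP scalerDr !scalerA.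
by rewrite mulr_algl mulr_algr.
Qed.

(** A cocycle phi kills Z, which contains x - g f x - e x; hence phi = phi g f + phi e with phi e a
    coboundary, and pullbacks along f and g are mutually inverse on cohomology. Coboundaries are
    abstract predicates so that degree 0 and the positive degrees are treated together. *)
Lemma stage_cohomology (P F : lmodType R) (p : {linear F -> F})
    (Z : P -> Prop) (W : F -> Prop) (cobP : (P -> N) -> Prop)
    (cobF : (F -> N) -> Prop) m (b : 'I_m -> {linear F -> N}) :
  (forall f f', cobP f -> cobP f' -> cobP (fun x => f x + f' x)) ->
  (forall f f', f =1 f' -> cobP f -> cobP f') ->
  (forall f f', cobF f -> cobF f' -> cobF (fun x => f x - f' x)) ->
  (forall f f', f =1 f' -> cobF f -> cobF f') ->
  @stage R N P F p Z W cobP cobF ->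
  (forall i y, W y -> b i y = 0) -> (forall i y, b i (p y) = b i y) ->
  (forall psi : {linear F -> N}, (forall y, W y -> psi y = 0) ->
     (forall y, psi (p y) = psi y) ->
     exists! c : 'rV[K]_m,
       cobF (fun y => psi y - \sum_i (c 0 i)%:A *: b i y)) ->
  exists b' : 'I_m -> {linear P -> N},
    (forall i x, Z x -> b' i x = 0) /\
    (forall phi : {linear P -> N}, (forall x, Z x -> phi x = 0) ->
     exists! c : 'rV[K]_m,
       cobP (fun y => phi y - \sum_i (c 0 i)%:A *: b' i y)).
Proof.
move=> cobPD cobPe cobFB cobFe.
case=> f [g [e [e' [[fZ gW pf gp pe'] [eZ eH] [e'W e'H] [cf cg] [ce ce']]]]].
move=> bW bp bP; exists (fun i => b i \o f); split=> [i x xZ|phi phiZ] /=.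
  exact/bW/fZ.
have [||c [cE cU]] := bP (phi \o g); rewrite /=.
- by move=> y yW; apply/phiZ/gW.
- by move=> y; rewrite gp.
have phiE x : phi x = phi (g (f x)) + phi (e x).
  by apply/eqP; rewrite -subr_eq0 opprD addrA -!linearB phiZ.
exists c; split.
  have [s sE] := scalar_comb_linear c b.
  have /cf/cobPD/(_ (ce phi)) : cobF ((phi \o g) \- s).
    by apply: cobFe cE => y; rewrite /= sE.
  by apply: cobPe => x; rewrite /= sE [in RHS]phiE addrAC.
move=> c' c'E; apply: cU.
have [s sE] := scalar_comb_linear c' b.
have seq y : s y = s (f (g y)) + s (e' y).
  rewrite !sE -big_split; apply: eq_bigr => i _ /=.
  rewrite -scalerDr; congr (_ *: _); rewrite -bp.
  by apply/eqP; rewrite -subr_eq0 opprD addrA -!linearB bW.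
have /cg/cobFB/(_ (ce' s)) : cobP (phi \- (s \o f)).
  by apply: cobPe c'E => x; rewrite /= sE.
by apply: cobFe => y; rewrite /= -sE [in RHS]seq opprD addrA.
Qed.

End Transfer.

(** * Free bimodules over an algebra with a multiplicative basis *)

(* A list of basis elements stands for their sum over F_2; [canc] removes the
   pairs of equal entries. *)
Section Mod2.
Variable T : eqType.
Implicit Types l : seq T.

Definition canc l : seq T :=
  foldr (fun x acc => if x \in acc then rem x acc else x :: acc) [::] l.

(** In characteristic 2 the concatenation stands for the difference. *)
Definition eq2 l1 l2 : bool := nilp (canc (l1 ++ l2)).

Variables (V : zmodType) (V2 : forall v : V, v + v = 0).

Lemma sum_canc (f : T -> V) l : \sum_(x <- canc l) f x = \sum_(x <- l) f x.
Proof.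
elim: l => //= x l IH; rewrite big_cons -IH; case: ifP => [xl|_]; last first.
  by rewrite big_cons.
by rewrite [in RHS](perm_big _ (perm_to_rem xl)) big_cons addrA V2 add0r.
Qed.

Lemma eq2_sum (f : T -> V) l1 l2 :
  eq2 l1 l2 -> \sum_(x <- l1) f x = \sum_(x <- l2) f x.
Proof.
move/nilP/(congr1 (fun l => \sum_(x <- l) f x)).
rewrite sum_canc big_cat big_nil /=.
set s1 := \sum_(x <- l1) _; set s2 := \sum_(x <- l2) _ => e.
by rewrite -[s1]addr0 -(V2 s2) addrA [s1 + s2]e add0r.
Qed.

End Mod2.

(** A sparse table: an absent key gives the empty list, which stands for 0, and repeated entries of
    a key are added. *)
Definition lookup (T : eqType) (U : Type) (tab : seq (T * seq U)) (x : T) : seq U :=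
  flatten [seq e.2 | e <- tab & e.1 == x].

Section FreeModules.
Variable R : nzRingType.

(** The position is a natural number, so that entries of the tables can be used as they are; a
    position out of range gives 0. *)
Definition gen k (r : R) (g : nat) : 'rV[R]_k := \row_h (r *+ (h == g :> nat)).

Lemma gen_out k r g : (k <= g)%N -> gen k r g = 0.
Proof.
move=> kg; apply/rowP => h; rewrite !mxE; case: eqP => // e.
by move: (ltn_ord h); rewrite e ltnNge kg.
Qed.

Lemma gen_is_linear k g : linear ((gen k)^~ g : R^o -> _).
Proof.
move=> c r s; apply/rowP => h; rewrite !mxE mulrnDl.
by congr (_ + _); rewrite -mulrnAr.
Qed.

Lemma genD k r s g : gen k (r + s) g = gen k r g + gen k s g.
Proof. by have := gen_is_linear k g 1 r s; rewrite !scale1r. Qed.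

Lemma genZ k c r g : gen k (c * r) g = c *: gen k r g.
Proof. by apply/rowP => h; rewrite !mxE mulrnAr. Qed.

Lemma gen0 k g : gen k 0 g = 0.
Proof. by apply/rowP => h; rewrite !mxE mul0rn. Qed.

Lemma row_gen k (x : 'rV[R]_k) : x = \sum_(h < k) gen k (x 0 h) h.
Proof.
apply/rowP => h; rewrite summxE (bigD1 h) //= big1 => [|g ne].
  by rewrite addr0 mxE eqxx.
by rewrite mxE; case: eqP => // /val_inj e; rewrite e eqxx in ne.
Qed.

(** The linear map on a free module with prescribed values at the generators. Differentials,
    idempotents and cochains all have this form. *)
Definition lc (V : lmodType R) k (nu : 'I_k -> V) (x : 'rV[R]_k) : V :=
  \sum_h x 0 h *: nu h.

Lemma lc_is_linear (V : lmodType R) k (nu : 'I_k -> V) : linear (lc nu).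
Proof.
move=> c x y; rewrite /lc scaler_sumr -big_split; apply: eq_bigr => h _ /=.
by rewrite !mxE scalerDl scalerA.
Qed.

HB.instance Definition _ (V : lmodType R) k (nu : 'I_k -> V) :=
  GRing.isLinear.Build R 'rV[R]_k V *:%R (lc nu) (lc_is_linear nu).

Lemma lc_gen (V : lmodType R) k (nu : 'I_k -> V) r (h : 'I_k) :
  lc nu (gen k r h) = r *: nu h.
Proof.
rewrite /lc (bigD1 h) //= mxE eqxx big1 ?addr0 // => g ne.
by rewrite mxE; case: eqP => [/val_inj e|]; [rewrite e eqxx in ne|rewrite scale0r].
Qed.

Lemma lcE (V : lmodType R) k (f : {linear 'rV[R]_k -> V}) x :
  lc (fun h => f (gen k 1 h)) x = f x.
Proof.
rewrite [in RHS](row_gen x) linear_sum; apply: eq_bigr => h _.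
by rewrite -linearZ -genZ mulr1.
Qed.

Lemma comp_lc (V V' : lmodType R) k (f : {linear V -> V'}) (nu : 'I_k -> V) x :
  f (lc nu x) = lc (f \o nu) x.
Proof. by rewrite /lc linear_sum; apply: eq_bigr => h _; rewrite linearZ. Qed.

Lemma eq_lc (V : lmodType R) k (nu nu' : 'I_k -> V) x :
  nu =1 nu' -> lc nu x = lc nu' x.
Proof. by move=> e; apply: eq_bigr => h _; rewrite e. Qed.

End FreeModules.

Section Char2.
Variables (K : fieldType) (charK : 2%N \in [pchar K]).

Lemma char2_vect (V : lmodType K) (v : V) : v + v = 0.
Proof. by rewrite -mulr2n -scaler_nat pcharf0 // scale0r. Qed.

Lemma char2_mod (R : algType K) (V : lmodType R) (v : V) : v + v = 0.
Proof. by rewrite -[v]scale1r -scalerDl (char2_vect (1 : R)) scale0r. Qed.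

End Char2.

Lemma scalar_swap (K : fieldType) (R : algType K) (V : lmodType R) (r : R) c
    (v : V) : r *: (c%:A *: v) = c%:A *: (r *: v).
Proof. by rewrite !scalerA mulr_algl mulr_algr. Qed.

(** * Bimodules as modules over A^e *)

Section Bimodules.
Variables (K : fieldType) (A : falgType K).
Local Notation R := (enveloping A).
Local Notation N := (regular_bimodule A).

(* Acts on an A-bimodule by left multiplication by [l] and right multiplication
   by [r]. *)
Definition bim (l r : A) : R := tens (r : A^c) l.

Lemma bimM l r l' r' : bim l r * bim l' r' = bim (l * l') (r' * r).
Proof. exact: tensor_mul_tens. Qed.

Lemma bim_act l r (m : N) : bim l r *: m = (l * (m : A) * r : A).
Proof. exact: env_act_tens. Qed.

Lemma bimPl c l l' r : bim (c *: l + l') r = c *: bim l r + bim l' r.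
Proof. exact: tens_linearr. Qed.

Lemma bimPr c l r r' : bim l (c *: r + r') = c *: bim l r + bim l r'.
Proof. exact: tens_linearl. Qed.

Lemma bim0l r : bim 0 r = 0.
Proof.
by have := bimPl (-1) 0 0 r; rewrite scaler0 addr0 scaleN1r addNr.
Qed.

Lemma bim0r l : bim l 0 = 0.
Proof.
by have := bimPr (-1) l 0 0; rewrite scaler0 addr0 scaleN1r addNr.
Qed.

Lemma bimZl c l r : bim (c *: l) r = c *: bim l r.
Proof. by rewrite -[c *: l]addr0 bimPl bim0l addr0. Qed.

Lemma bimZr c l r : bim l (c *: r) = c *: bim l r.
Proof. by rewrite -[c *: r]addr0 bimPr bim0r addr0. Qed.

Lemma bimDr l r r' : bim l (r + r') = bim l r + bim l r'.
Proof. by rewrite -[r]scale1r bimPr !scale1r. Qed.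

Lemma bim_sumr l (I : Type) (s : seq I) (F : I -> A) :
  bim l (\sum_(i <- s) F i) = \sum_(i <- s) bim l (F i).
Proof. exact: (big_morph _ (bimDr l) (bim0r l)). Qed.

Lemma bim_scalar c : bim c%:A 1 = c%:A.
Proof. exact: bimZl. Qed.

Lemma scalar_act c (m : N) : c%:A *: m = (c *: (m : A) : A).
Proof. by rewrite -bim_scalar bim_act mulr1 mulr_algl. Qed.

Lemma rV_bim_ind k (P : 'rV[R]_k -> Prop) :
  (forall c x y, P x -> P y -> P (c%:A *: x + y)) -> P 0 ->
  (forall l r (g : 'I_k), P (gen k (bim l r) g)) -> forall x, P x.
Proof.
move=> Plin P0 Pg x; rewrite (row_gen x); elim/big_ind: _ => // [y z Py Pz|h _].
  by rewrite -[y]scale1r -[1]scale1r; apply: Plin.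
elim/tensor_ind: (x 0 h) => [c s t Ps Pt||r l].
- by rewrite genD -mulr_algl genZ; apply: Plin.
- by rewrite gen0.
- exact: Pg.
Qed.

End Bimodules.

(* [(i, g, j)] stands for b_i (x) b_j in the summand A (x) A indexed by [g].  The
   algebra has a basis b_0, ..., b_(n-1) such that b_i * b_j = b_(mul i j), an
   index that is at least n standing for 0. *)
Definition triple : Type := (nat * nat * nat)%type.

Section Tables.
Variables (n : nat) (mul : nat -> nat -> nat).

(** Right multiplications compose in the opposite order, whence [mul u.2 t.2] on the right. Terms
    with a zero factor are dropped because they would otherwise survive cancellation. *)
Definition tab_comp (d : seq (seq triple)) (l : seq triple) : seq triple :=
  [seq v <- [seq (mul t.1.1 u.1.1, u.1.2, mul u.2 t.2)
            | t <- l, u <- nth [::] d t.1.2] | (v.1.1 < n)%N && (v.2 < n)%N].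

(* Table of the idempotent cutting out the sum of the A e_s (x) e_t A, for
   (s, t) in [ty], from a free bimodule. *)
Definition tab_idem (ty : seq (nat * nat)) : seq (seq triple) :=
  [seq [:: ((nth (0, 0) ty g).1, g, (nth (0, 0) ty g).2)] | g <- iota 0 (size ty)]%N.

(* Unlike [tab_comp], which extends a table to a bimodule morphism, this extends
   a table on the elements 1 (x) b_j to a left A-linear map. *)
Definition tab_htpy (s : seq (nat * nat * seq triple)) (l : seq triple) : seq triple :=
  [seq v <- [seq (mul t.1.1 u.1.1, u.1.2, u.2) | t <- l, u <- lookup s (t.1.2, t.2)]
  | (v.1.1 < n)%N].

(* [(g, j)] is the cochain sending the generator [g] to b_j and the other ones
   to 0. *)
Definition tab_cochain (d : seq (seq triple)) (l : seq (nat * nat)) :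
    seq (nat * nat) :=
  [seq v <- flatten [seq [seq (h, mul (mul u.1.1 c.2) u.2)
                    | u <- nth [::] d h, c <- [seq c <- l | c.1 == u.1.2]]
                    | h <- iota 0 (size d)] | (v.2 < n)%N].

Definition tab_lin (T : Type) k (tau : seq (nat * nat * seq T))
    (l : seq (nat * nat)) : seq T :=
  flatten [seq lookup tau c | c <- l & (c.1 < k)%N && (c.2 < n)%N].

End Tables.

Section BasedAlgebra.
Variables (K : fieldType) (A : falgType K) (charK : 2%N \in [pchar K]).
Variables (n : nat) (b : nat -> A) (mul : nat -> nat -> nat).
Hypotheses (b_out : forall i, (n <= i)%N -> b i = 0).
Hypotheses (bM : forall i j, b i * b j = b (mul i j)).
Variable (cf : 'I_n -> {scalar A}).
Hypotheses (cfE : forall a, a = \sum_j cf j a *: b j).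
Hypotheses (cfb : forall i j : 'I_n, cf i (b j) = (i == j)%:R).
Local Notation R := (enveloping A).
Local Notation N := (regular_bimodule A).

Definition ev k (l : seq triple) : 'rV[R]_k :=
  \sum_(t <- l) gen k (bim (b t.1.1) (b t.2)) t.1.2.

Definition dmap k0 k d : 'I_k0 -> 'rV[R]_k := fun h => ev k (nth [::] d h).

Let V2 (V : lmodType R) (v : V) : v + v = 0. Proof. exact: char2_mod. Qed.
Let A2 (V : lmodType K) (v : V) : v + v = 0. Proof. exact: char2_vect. Qed.

Lemma ev_eq2 k l1 l2 : eq2 l1 l2 -> ev k l1 = ev k l2.
Proof. by apply: eq2_sum; apply: V2. Qed.

Lemma ev_filter k l :
  ev k [seq v <- l | (v.1.1 < n)%N && (v.2 < n)%N] = ev k l.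
Proof.
rewrite /ev big_filter [RHS](bigID (fun v => (v.1.1 < n)%N && (v.2 < n)%N)) /=.
rewrite [X in _ = _ + X]big1 ?addr0 // => v; rewrite negb_and -!leqNgt.
by case/orP => /b_out ->; rewrite ?bim0l ?bim0r gen0.
Qed.

Lemma ev_comp k0 k d l : (size d <= k0)%N ->
  lc (@dmap k0 k d) (ev k0 l) = ev k (tab_comp n mul d l).
Proof.
move=> dk; rewrite ev_filter /ev linear_sum big_allpairs_dep /=.
apply: eq_bigr => t _; case: (ltnP t.1.2 k0) => [lt|ge]; last first.
  by rewrite gen_out // linear0 nth_default ?big_nil // (leq_trans dk).
rewrite (lc_gen _ _ (Ordinal lt)) /dmap /ev scaler_sumr /=.
by apply: eq_bigr => u _; rewrite -genZ bimM !bM.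
Qed.

(** The value at 1 (x) a, in summand [g], of the left linear map given by the table. Nothing relates
    it to right multiplication, so [a] has to be expanded in the basis. *)
Definition hrow k (s : seq (nat * nat * seq triple)) g (a : A) : 'rV[R]_k :=
  \sum_(j < n) (cf j a)%:A *: ev k (lookup s (g, j : nat)).

Lemma hrow_lin k s g c x y :
  hrow k s g (c *: x + y) = c%:A *: hrow k s g x + hrow k s g y.
Proof.
rewrite /hrow scaler_sumr -big_split; apply: eq_bigr => j _ /=.
by rewrite linearP scalerA -scalerDl mulr_algl scalerA -scalerDl.
Qed.

Lemma hrow_b k s g (j : 'I_n) : hrow k s g (b j) = ev k (lookup s (g, j : nat)).
Proof.
rewrite /hrow (bigD1 j) //= big1 => [|i ne]; rewrite cfb.
  by rewrite eqxx !scale1r addr0.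
by rewrite (negPf ne) !scale0r.
Qed.

Definition hfun k s g h (r : A^c) (l : A) : R := bim l 1 * (hrow k s g r) 0 h.

Lemma hfun_bilinear k s g h : bilinear_map (@hfun k s g h).
Proof.
split=> [l c r r'|r c l l']; rewrite /hfun.
  by rewrite hrow_lin !mxE mulrDr mulr_algl -scalerAr.
by rewrite bimPl mulrDl -scalerAl.
Qed.

(** As this map is not A^e-linear, [lc] cannot define it; each coordinate is induced by a K-bilinear
    map on A^op x A. *)
Definition htpy k0 k s (x : 'rV[R]_k0) : 'rV[R]_k :=
  \row_h \sum_(g < k0) tensor_lift (@hfun k s g h) (x 0 g).

Lemma htpyP k0 k s c x y :
  @htpy k0 k s (c%:A *: x + y) = c%:A *: htpy k s x + htpy k s y.
Proof.
apply/rowP => h; rewrite !mxE mulr_sumr -big_split; apply: eq_bigr => g _ /=.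
by rewrite !mxE mulr_algl tensor_lift_linear mulr_algl.
Qed.

Lemma htpy0 k0 k s : @htpy k0 k s 0 = 0.
Proof.
apply/rowP => h; rewrite !mxE big1 // => g _.
by rewrite mxE tensor_lift0.
Qed.

Lemma htpy_gen k0 k s l r (g : 'I_k0) :
  htpy k s (gen k0 (bim l r) g) = bim l 1 *: hrow k s g r.
Proof.
apply/rowP => h; rewrite !mxE (bigD1 g) //= big1 => [|g' ne]; rewrite mxE.
  by rewrite eqxx mulr1n addr0 tensor_lift_tens //; apply: hfun_bilinear.
by case: eqP => [/val_inj e|_]; [rewrite e eqxx in ne|rewrite tensor_lift0].
Qed.

Lemma htpyZ k0 k s l x : @htpy k0 k s (bim l 1 *: x) = bim l 1 *: htpy k s x.
Proof.
elim/rV_bim_ind: x => [c x y Px Py||l' r g].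
- by rewrite scalerDr scalar_swap !htpyP Px Py scalerDr scalar_swap.
- by rewrite scaler0 htpy0 scaler0.
by rewrite -genZ bimM mulr1 !htpy_gen scalerA bimM mulr1.
Qed.

Lemma htpy_ev k0 k s l : all (fun t => (t.1.2 < k0) && (t.2 < n))%N l ->
  htpy k s (ev k0 l) = ev k (tab_htpy n mul s l).
Proof.
have htpyD x y : @htpy k0 k s (x + y) = htpy k s x + htpy k s y.
  by have := htpyP k s 1 x y; rewrite !scale1r.
move=> /allP lk; rewrite /tab_htpy /ev (big_morph _ htpyD (htpy0 _ _ _)).
rewrite big_filter [RHS]big_mkcond /= big_allpairs_dep /=.
rewrite big_seq [RHS]big_seq; apply: eq_bigr => t /lk /andP[tk tn].
rewrite (htpy_gen _ _ _ _ (Ordinal tk)) (hrow_b _ _ _ (Ordinal tn)) /=.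
rewrite /ev scaler_sumr; apply: eq_bigr => u _.
rewrite -genZ bimM mulr1 bM; case: ltnP => // /b_out ->.
by rewrite bim0l gen0.
Qed.

Definition pmap k ty : 'I_k -> 'rV[R]_k := dmap k (tab_idem ty).

Lemma pmap_gen k ty l r (g : 'I_k) : size ty = k ->
  lc (@pmap k ty) (gen k (bim l r) g) =
  \sum_(j < n) (cf j r)%:A *: (bim l 1 *:
     ev k [:: ((nth (0, 0) ty g).1, val g, mul (nth (0, 0) ty g).2 j)%N]).
Proof.
move=> tyk; rewrite lc_gen /pmap /dmap (nth_map 0%N) ?size_iota ?tyk //.
rewrite nth_iota ?tyk // add0n /ev !big_seq1 /= -genZ bimM {1}(cfE r) mulr_sumr.
rewrite bim_sumr.
rewrite (big_morph (fun s => gen k s g) (fun r s => genD k r s g) (gen0 _ _ _)).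
apply: eq_bigr => j _; rewrite big_seq1 /= -!genZ; congr (gen _ _ _).
by rewrite bimM mulr1 -scalerAr bimZr bM mulr_algl.
Qed.

(* One-sided linearity of the homotopy reduces the identity [D s + q = p] to the
   elements b_s (x) b_j of each summand A b_s (x) b_t A. *)
Lemma htpy_id k k' s ty (D : {linear 'rV[R]_k' -> 'rV[R]_k})
    (q : 'rV[R]_k -> 'rV[R]_k) :
  size ty = k ->
  (forall c x y, q (c%:A *: x + y) = c%:A *: q x + q y) ->
  (forall l x, q (bim l 1 *: x) = bim l 1 *: q x) ->
  (forall g j, (g < k)%N -> (j < n)%N ->
     let t := ((nth (0, 0) ty g).1, g, mul (nth (0, 0) ty g).2 j)%N in
     (t.2 < n)%N -> D (htpy k' s (ev k [:: t])) + q (ev k [:: t]) = ev k [:: t]) ->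
  forall x, let y := lc (@pmap k ty) x in D (htpy k' s y) + q y = y.
Proof.
move=> tyk qP qZ chk; pose Phi z := D (htpy k' s z) + q z.
have PhiP c x y : Phi (c%:A *: x + y) = c%:A *: Phi x + Phi y.
  by rewrite /Phi htpyP qP linearP scalerDr addrACA.
have PhiZ l x : Phi (bim l 1 *: x) = bim l 1 *: Phi x.
  by rewrite /Phi htpyZ qZ linearZ scalerDr.
have Phi0 : Phi 0 = 0.
  by have := PhiZ 0 0; rewrite bim0l !scale0r.
suff Phip x : Phi (lc (@pmap k ty) x) = lc (@pmap k ty) x by [].
elim/rV_bim_ind: x => [c x y Px Py||l r g].
- by rewrite linearP PhiP Px Py.
- by rewrite linear0 Phi0.
rewrite pmap_gen //; elim/big_ind: _ => // [x y Px Py|j _].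
  by rewrite -[x]scale1r -[1]scale1r PhiP Px Py.
set t := (_, _, _); rewrite -[in LHS](addr0 (_ *: _)) PhiP Phi0 addr0 PhiZ.
case: (ltnP t.2 n) => [tn|/b_out t0]; first by congr (_ *: (_ *: _)); apply: chk.
have -> : ev k [:: t] = 0 by rewrite /ev big_seq1 t0 bim0r gen0.
by rewrite Phi0.
Qed.

(** * Cochains with values in the algebra *)

Definition nu k (l : seq (nat * nat)) : {ffun 'I_k -> A} :=
  [ffun h : 'I_k => \sum_(c <- l) b c.2 *+ (c.1 == h)].

(** Hom(R^k, A) is identified with A^k by evaluation at the generators; this is then composition
    with the differential. *)
Definition coface k0 k d (psi : {ffun 'I_k0 -> A}) : {ffun 'I_k -> A} :=
  [ffun h => lc (psi : 'I_k0 -> N) (@dmap k k0 d h) : A].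

(** Only K-linearity is asked: the homotopies between cochain spaces need not be induced by bimodule
    maps. *)
Definition ext (V : lmodType K) k (F : nat -> nat -> V) (psi : {ffun 'I_k -> A}) :
  V := \sum_(g < k) \sum_(j < n) cf j (psi g) *: F g j.

Lemma nu_eq2 k l1 l2 : eq2 l1 l2 -> nu k l1 = nu k l2.
Proof.
by move=> e; apply/ffunP => h; rewrite !ffunE; apply: eq2_sum e; apply: A2.
Qed.

Lemma nu_cat k l1 l2 : nu k (l1 ++ l2) = nu k l1 + nu k l2.
Proof. by apply/ffunP => h; rewrite !ffunE big_cat. Qed.

Lemma nu_nil k : nu k [::] = 0.
Proof. by apply/ffunP => h; rewrite !ffunE big_nil. Qed.

Lemma nu_flatten k (T : Type) (f : T -> seq (nat * nat)) (s : seq T) :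
  nu k (flatten [seq f x | x <- s]) = \sum_(x <- s) nu k (f x).
Proof.
by elim: s => [|x s IH]; rewrite /= ?big_nil ?big_cons ?nu_nil // nu_cat IH.
Qed.

Lemma lc_cochainP k c (psi psi' : {ffun 'I_k -> A}) x :
  lc ((c *: psi + psi') : 'I_k -> N) x =
  c%:A *: lc (psi : 'I_k -> N) x + lc (psi' : 'I_k -> N) x.
Proof.
rewrite /lc scaler_sumr -big_split; apply: eq_bigr => h _ /=.
rewrite -scalar_swap -scalerDr scalar_act; congr (_ *: _).
by rewrite !ffunE.
Qed.

Lemma coface_linear k0 k d : linear (@coface k0 k d).
Proof.
move=> c x y; apply/ffunP => h; rewrite !ffunE lc_cochainP scalar_act.
by [].
Qed.

Lemma lc_coface k0 k d (psi : {ffun 'I_k0 -> A}) x :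
  lc (@coface k0 k d psi : 'I_k -> N) x =
  lc (psi : 'I_k0 -> N) (lc (@dmap k k0 d) x).
Proof.
rewrite -[lc (dmap _ _) x]/(\sum_h _) linear_sum; apply: eq_bigr => h _.
by rewrite ffunE linearZ.
Qed.

Lemma ext_linear (V : lmodType K) k F : linear (@ext V k F).
Proof.
move=> c x y; rewrite /ext scaler_sumr -big_split; apply: eq_bigr => g _ /=.
rewrite scaler_sumr -big_split; apply: eq_bigr => j _ /=.
by rewrite !ffunE linearP scalerDl scalerA.
Qed.

Lemma nu1_sum k (psi : {ffun 'I_k -> A}) :
  psi = \sum_(g < k) \sum_(j < n) cf j (psi g) *: nu k [:: (val g, val j)].
Proof.
apply/ffunP => h; rewrite sum_ffunE (bigD1 h) //= addrC big1 ?add0r => [|g ne].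
  rewrite {1}(cfE (psi h)) sum_ffunE; apply: eq_bigr => j _.
  by rewrite !ffunE big_seq1 eqxx.
rewrite sum_ffunE big1 // => j _; rewrite !ffunE big_seq1.
by case: eqP => [/val_inj e|]; [rewrite e eqxx in ne|rewrite scaler0].
Qed.

Lemma linear_nu (V : lmodType K) k (L1 L2 : {ffun 'I_k -> A} -> V) :
  linear L1 -> linear L2 ->
  (forall g j, (g < k)%N -> (j < n)%N ->
     L1 (nu k [:: (g, j)]) = L2 (nu k [:: (g, j)])) -> L1 =1 L2.
Proof.
move=> /linear_pack[f1 e1] /linear_pack[f2 e2] e psi.
rewrite -e1 -e2 [psi]nu1_sum !linear_sum; apply: eq_bigr => g _.
rewrite !linear_sum; apply: eq_bigr => j _; rewrite !linearZ /=.
by rewrite e1 e2 e.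
Qed.

Lemma ext_nu (V : lmodType K) k (F : nat -> nat -> V) l :
  ext F (nu k l) = \sum_(c <- l | (c.1 < k)%N && (c.2 < n)%N) F c.1 c.2.
Proof.
have [f fE] := linear_pack (@ext_linear V k F).
have -> : nu k l = \sum_(c <- l) nu k [:: c].
  by rewrite -nu_flatten flatten_map1 map_id.
rewrite -fE linear_sum [RHS]big_mkcond; apply: eq_bigr => -[g j] _ /=.
rewrite fE /ext; case: (ltnP g k) => [gk|ge] /=; last first.
  rewrite big1 // => h _; rewrite big1 // => i _; rewrite ffunE big_seq1 /=.
  case: eqP => [e|_]; last by rewrite linear0 scale0r.
  by move: (ltn_ord h); rewrite -e ltnNge ge.
rewrite (bigD1 (Ordinal gk)) //= addrC big1 ?add0r => [|h ne]; last first.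
  rewrite big1 // => i _; rewrite ffunE big_seq1 /=.
  case: eqP => [e|_]; last by rewrite linear0 scale0r.
  by case/eqP: ne; apply: val_inj.
case: ltnP => [jn|/b_out j0].
  rewrite (bigD1 (Ordinal jn)) //= ffunE big_seq1 eqxx (cfb _ (Ordinal jn)).
  rewrite eqxx scale1r addrC big1 ?add0r // => i ne.
  by rewrite (cfb _ (Ordinal jn)) (negPf ne) scale0r.
by rewrite big1 // => i _; rewrite ffunE big_seq1 j0 mul0rn linear0 scale0r.
Qed.

Lemma ext_tab_lin k k' tau l :
  ext (fun g j => nu k' (lookup tau (g, j))) (nu k l) = nu k' (tab_lin n k tau l).
Proof.
rewrite ext_nu /tab_lin nu_flatten big_filter.
by apply: eq_bigr => -[].
Qed.

(** The range condition matters: [gen] and [nu] send an index of at least [k0] to 0, while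
    [tab_cochain] would match two such indices with each other. *)
Lemma coface_nu k0 k d l : (size d <= k)%N ->
  all (all (fun t => t.1.2 < k0)%N) d ->
  @coface k0 k d (nu k0 l) = nu k (tab_cochain n mul d l).
Proof.
move=> dk /all_nthP dall; apply/ffunP => h; rewrite !ffunE /dmap /ev linear_sum.
have termE u : (u.1.2 < k0)%N ->
    lc (nu k0 l : 'I_k0 -> N) (gen k0 (bim (b u.1.1) (b u.2)) u.1.2) =
    (\sum_(c <- [seq c <- l | c.1 == u.1.2]) b (mul (mul u.1.1 c.2) u.2) : A).
  move=> uk; rewrite (lc_gen _ _ (Ordinal uk)) bim_act ffunE /= mulr_sumr mulr_suml.
  rewrite big_filter [RHS]big_mkcond; apply: eq_bigr => c _.
  by case: eqP => _; rewrite ?mulr0 ?mul0r // mulr1n !bM.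
rewrite big_filter [RHS]big_mkcond big_flatten big_map.
rewrite -[X in iota _ X]subn0 -/(index_iota 0 (size d)) big_mkord.
have inner (h' : nat) : \sum_(v <- [seq (h', mul (mul u.1.1 c.2) u.2) |
      u <- nth [::] d h', c <- [seq c <- l | c.1 == u.1.2]])
      (if (v.2 < n)%N then b v.2 *+ (v.1 == h) else 0) =
    (\sum_(u <- nth [::] d h') \sum_(c <- [seq c <- l | c.1 == u.1.2])
       b (mul (mul u.1.1 c.2) u.2)) *+ (h' == h).
  rewrite big_allpairs_dep -sumrMnl; apply: eq_bigr => u _.
  rewrite -sumrMnl; apply: eq_bigr => c _ /=.
  by case: ltnP => // /b_out ->; rewrite mul0rn.
under [RHS]eq_bigr => h' _ do rewrite inner.
case: (ltnP h (size d)) => [hd|ge].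
  rewrite [RHS](bigD1 (Ordinal hd)) //= eqxx [RHS]addrC.
  rewrite [X in _ = X + _]big1 ?add0r => [|h' ne].
    rewrite mulr1n big_seq [RHS]big_seq; apply: eq_bigr => u ud.
    by apply: termE; have /allP := dall [::] _ hd; apply.
  by case: eqP => // e; case/eqP: ne; apply: val_inj.
rewrite nth_default // big_nil big1 // => h' _; case: eqP => // e.
by move: (ltn_ord h'); rewrite e ltnNge ge.
Qed.

End BasedAlgebra.

(** * Hochschild cohomology from finite tables *)

(* Contraction of the complex of cochains onto its cohomology in one degree:
   representatives of the classes, projection onto them, and homotopies to the
   previous and from the next degree. *)
Record contraction := Contraction {
  classes : seq (seq (nat * nat));
  to_classes : seq (nat * nat * seq nat);
  htpy_prev : seq (nat * nat * seq (nat * nat));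
  htpy_next : seq (nat * nat * seq (nat * nat))
}.

Definition in_range k : seq (seq triple) -> bool :=
  all (all (fun t : triple => t.1.2 < k))%N.

(** With i for the classes and pi for [to_classes], the clauses after the range checks are: the
    classes are cocycles fixed by the idempotent p; p = i pi + d s + s' d' on every basis cochain;
    pi i = 1; pi d = 0. Together they split the cohomology off the complex. Degree 0 is the case of
    an empty [d] and [k0] = 0. *)
Definition contracts n (mul : nat -> nat -> nat) (k0 k k' : nat) ty d d' h :=
  let pid := tab_idem ty in
  [&& [&& size ty == k, size d <= k, size d' <= k', in_range k0 d & in_range k d'],
      all (fun l => eq2 (tab_cochain n mul d' l) [::] &&
                    eq2 (tab_cochain n mul pid l) l) (classes h),
      all (fun g => all (fun j =>
         eq2 (tab_cochain n mul pid [:: (g, j)])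
          (flatten [seq nth [::] (classes h) i | i <- lookup (to_classes h) (g, j)]
           ++ tab_cochain n mul d (tab_lin n k (htpy_prev h) [:: (g, j)])
           ++ tab_lin n k' (htpy_next h) (tab_cochain n mul d' [:: (g, j)])))
        (iota 0 n)) (iota 0 k),
      all (fun i => eq2 (tab_lin n k (to_classes h) (nth [::] (classes h) i)) [:: i])
        (iota 0 (size (classes h)))
    & all (fun g => all (fun j =>
         eq2 (tab_lin n k (to_classes h) (tab_cochain n mul d [:: (g, j)])) [::])
        (iota 0 n)) (iota 0 k0)]%N.

Section BasedAlgebra.
Variables (K : fieldType) (A : falgType K) (charK : 2%N \in [pchar K]).
Variables (n : nat) (b : nat -> A) (mul : nat -> nat -> nat).
Hypotheses (b_out : forall i, (n <= i)%N -> b i = 0).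
Hypotheses (bM : forall i j, b i * b j = b (mul i j)).
Variable (cf : 'I_n -> {scalar A}).
Hypotheses (cfE : forall a, a = \sum_j cf j a *: b j).
Hypotheses (cfb : forall i j : 'I_n, cf i (b j) = (i == j)%:R).
Local Notation R := (enveloping A).
Local Notation N := (regular_bimodule A).

Definition unit_row m (i : nat) : 'rV[K]_m := \row_h (h == i :> nat)%:R.

Lemma ext_unit_row k m (tau : seq (nat * nat * seq nat)) l :
  ext cf (fun g j : nat => \sum_(i <- lookup tau (g, j)) unit_row m i) (nu b k l) =
  \sum_(i <- tab_lin n k tau l) unit_row m i.
Proof.
rewrite (ext_nu b_out cfb) /tab_lin big_flatten big_map big_filter.
by apply: eq_bigr => -[].
Qed.

Lemma all_iota p m : all p (iota 0 m) -> forall i, (i < m)%N -> p i.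
Proof. by move/allP => h i im; apply: h; rewrite mem_iota. Qed.

Lemma contraction_basis k0 k k' ty d d' h :
  contracts n mul k0 k k' ty d d' h ->
  let m := size (classes h) in
  forall psi : {ffun 'I_k -> A},
  coface b k (tab_idem ty) psi = psi -> coface b k' d' psi = 0 ->
  exists! c : 'rV[K]_m, exists chi : {ffun 'I_k0 -> A},
    psi - \sum_(i < m) c 0 i *: nu b k (nth [::] (classes h) i) = coface b k d chi.
Proof.
case/and5P => /and5P[/eqP tyk dk dk' dr dr'] _.
move=> /all_iota exC /all_iota clC /all_iota prC.
move=> m psi psip psid.
have A2 (V : lmodType K) (v : V) : v + v = 0 by apply: char2_vect.
have pidk : (size (tab_idem ty) <= k)%N by rewrite size_map size_iota tyk.
have pidr : in_range k (tab_idem ty).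
  apply/allP => l /mapP[g]; rewrite mem_iota add0n tyk /= => gk -> /=.
  by rewrite gk.
pose Pi (g j : nat) : 'rV[K]_m :=
  \sum_(i <- lookup (to_classes h) (g, j)) unit_row m i.
pose prevF (g j : nat) := nu b k0 (lookup (htpy_prev h) (g, j)).
pose nextF (g j : nat) := nu b k (lookup (htpy_next h) (g, j)).
pose cl i := nu b k (nth [::] (classes h) i).
pose comb (c : 'rV[K]_m) := \sum_i c 0 i *: cl i.
have comb_lin : linear comb.
  move=> a x y; rewrite /comb scaler_sumr -big_split; apply: eq_bigr => i _ /=.
  by rewrite !mxE scalerDl scalerA.
have comb_unit i : comb (unit_row m i) = cl i.
  rewrite /comb; case: (ltnP i m) => [im|ge].
    rewrite (bigD1 (Ordinal im)) //= mxE eqxx scale1r big1 ?addr0 // => j ne.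
    rewrite mxE; case: eqP => [e|_]; last by rewrite scale0r.
    by case/eqP: ne; apply: val_inj.
  rewrite /cl nth_default // nu_nil big1 // => j _; rewrite mxE.
  by case: eqP => [e|]; [move: (ltn_ord j); rewrite e ltnNge ge|rewrite scale0r].
pose L (psi : {ffun 'I_k -> A}) := comb (ext cf Pi psi) +
  (coface b k d (ext cf prevF psi) + ext cf nextF (coface b k' d' psi)).
have L_lin : linear L.
  move=> c x y; rewrite /L !(ext_linear, coface_linear) comb_lin.
  by rewrite !scalerDr [RHS]addrACA; congr (_ + _); rewrite addrACA.
have [comb' comb'E] := linear_pack comb_lin.
have LE : coface b k (tab_idem ty) =1 L.
  apply: (linear_nu cfE (coface_linear _ _ _) L_lin) => g j gk jn.
  rewrite /L (ext_tab_lin b_out cfb) !(coface_nu b_out bM) //.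
  rewrite (ext_tab_lin b_out cfb) (nu_eq2 charK b k (all_iota (exC g gk) jn)).
  rewrite !nu_cat nu_flatten; congr (_ + _).
  have -> : ext cf Pi (nu b k [:: (g, j)]) = Pi g j.
    by rewrite (ext_nu b_out cfb) big_mkcond big_seq1 /= gk jn.
  rewrite -comb'E linear_sum.
  by apply: eq_bigr => i _; rewrite comb'E comb_unit.
(* On a cocycle the summand through [d'] vanishes, so psi is the combination with coefficients pi
   psi plus a coboundary. *)
exists (ext cf Pi psi); split.
  exists (ext cf prevF psi).
  rewrite -[X in X - _]psip LE /L psid -/(comb _) addrC addKr.
  have [e eE] := linear_pack (ext_linear cf nextF (k := k')).
  by rewrite -eE linear0 addr0.
move=> c [chi chiE].
have [e eE] := linear_pack (ext_linear cf Pi (k := k)).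
have e_cl i : (i < m)%N -> e (cl i) = unit_row m i.
  move=> im; rewrite eE ext_unit_row.
  by rewrite (eq2_sum (A2 _) _ (clC i im)) big_seq1.
have [cd cdE] := linear_pack (coface_linear b k d (k0 := k0)).
have e_prev : e \o cd =1 fun=> 0.
  have lin0 : linear (fun _ : {ffun 'I_k0 -> A} => 0 : 'rV[K]_m).
    by move=> a x y; rewrite scaler0 addr0.
  apply: (linear_nu cfE (linearP (e \o cd)) lin0) => g j gk jn /=.
  rewrite cdE (coface_nu b_out bM) // eE ext_unit_row.
  by rewrite (eq2_sum (A2 _) _ (all_iota (prC g gk) jn)) big_nil.
(* Uniqueness: pi kills the coboundary and returns the coefficients of a combination of classes. *)
have := e_prev chi; rewrite /= cdE -chiE linearB linear_sum eE => /subr0_eq ->.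
rewrite [RHS](row_sum_delta c); apply: eq_bigr => i _.
rewrite linearZ /= e_cl //; congr (_ *: _).
by apply/rowP => j; rewrite !mxE.
Qed.

Lemma class_props k0 k k' ty d d' h :
  contracts n mul k0 k k' ty d d' h -> forall i,
  coface b k' d' (nu b k (nth [::] (classes h) i)) = 0 /\
  coface b k (tab_idem ty) (nu b k (nth [::] (classes h) i)) =
  nu b k (nth [::] (classes h) i).
Proof.
case/and5P => /and5P[/eqP tyk dk dk' dr dr'] clC _ _ _ i.
have pidk : (size (tab_idem ty) <= k)%N by rewrite size_map size_iota tyk.
have pidr : in_range k (tab_idem ty).
  apply/allP => l /mapP[g]; rewrite mem_iota add0n tyk /= => gk -> /=.
  by rewrite gk.
rewrite !(coface_nu b_out bM) //.
case: (ltnP i (size (classes h))) => [im|ge].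
  have /andP[/(nu_eq2 charK b k') -> /(nu_eq2 charK b k) ->] :=
    all_nthP [::] clC i im.
  by rewrite nu_nil.
have tab0 d0 : tab_cochain n mul d0 [::] = [::].
  rewrite /tab_cochain /=; elim: (iota _ _) => //= x s.
  by case: (nth _ _ _) => [|u us] //=; elim: us.
by rewrite nth_default // !tab0 !nu_nil.
Qed.

End BasedAlgebra.

(* The beginning of a bimodule resolution of an algebra with basis
   b_0, ..., b_(n-1), the vertex idempotents coming first.  The term of degree k
   is the sum of the A b_s (x) b_t A for (s, t) in the k-th list of types; the
   homotopies are left A-linear. *)
Record resolution := Resolution {
  types0 : seq (nat * nat); types1 : seq (nat * nat);
  types2 : seq (nat * nat); types3 : seq (nat * nat);
  diff1 : seq (seq triple); diff2 : seq (seq triple); diff3 : seq (seq triple);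
  homotopy0 : seq (nat * nat * seq triple); homotopy1 : seq (nat * nat * seq triple);
  homotopy2 : seq (nat * nat * seq triple);
  contr0 : contraction; contr1 : contraction; contr2 : contraction
}.

(** * Certificates for a truncated bimodule resolution *)

Section Checks.
Variables (n : nat) (mul : nat -> nat -> nat).

Definition is_diff (ty0 ty1 : seq (nat * nat)) (d : seq (seq triple)) : bool :=
  [&& size d == size ty1, in_range (size ty0) d
    & all (fun l => eq2 (tab_comp n mul (tab_idem ty0) l) l) d &&
      all (fun h => eq2 (tab_comp n mul d (nth [::] (tab_idem ty1) h)) (nth [::] d h))
        (iota 0 (size ty1))].

Definition is_complex (d d' : seq (seq triple)) : bool :=
  all (fun l => eq2 (tab_comp n mul d l) [::]) d'.

Definition idem_types (ty : seq (nat * nat)) : bool :=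
  all (fun e => [&& mul e.1 e.1 == e.1, mul e.2 e.2 == e.2, e.1 < n & e.2 < n])%N ty.

Definition is_htpy (ty : seq (nat * nat)) (d : seq (seq triple))
    (s : seq (nat * nat * seq triple)) (q : triple -> seq triple) : bool :=
  all (fun g => all (fun j =>
    let t := ((nth (0, 0) ty g).1, g, mul (nth (0, 0) ty g).2 j) in
    (t.2 < n) ==>
      eq2 (tab_comp n mul d (tab_htpy n mul s [:: t]) ++ q t) [:: t])
    (iota 0 n))%N (iota 0 (size ty)).

(** The left linear section a -> \sum_v a e_v (x) e_v of the multiplication map, at the image of
    [t]. It serves as the homotopy in degree -1. *)
Definition aug_section (k : nat) (t : triple) : seq triple :=
  [seq v <- [seq (mul (mul (mul t.1.1 t.1.2) t.2) v, v, v) | v <- iota 0 k]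
  | (v.1.1 < n)%N].

Definition resolution_ok (r : resolution) : bool :=
  [&& [&& types0 r == [seq (v, v) | v <- iota 0 (size (types0 r))],
          idem_types (types0 r), idem_types (types1 r), idem_types (types2 r)
        & idem_types (types3 r)],
      [&& is_diff (types0 r) (types1 r) (diff1 r),
          is_diff (types1 r) (types2 r) (diff2 r)
        & is_diff (types2 r) (types3 r) (diff3 r)],
      [&& all (fun l => eq2 [seq v <- [seq mul (mul t.1.1 t.1.2) t.2 | t <- l]
                            | (v < n)%N] [::]) (diff1 r),
          is_complex (diff1 r) (diff2 r) & is_complex (diff2 r) (diff3 r)],
      [&& is_htpy (types0 r) (diff1 r) (homotopy0 r) (aug_section (size (types0 r))),
          is_htpy (types1 r) (diff2 r) (homotopy1 r)
            (fun t => tab_htpy n mul (homotopy0 r) (tab_comp n mul (diff1 r) [:: t]))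
        & is_htpy (types2 r) (diff3 r) (homotopy2 r)
            (fun t => tab_htpy n mul (homotopy1 r) (tab_comp n mul (diff2 r) [:: t]))]
    & [&& contracts n mul 0 (size (types0 r)) (size (types1 r)) (types0 r) [::]
            (diff1 r) (contr0 r),
          contracts n mul (size (types0 r)) (size (types1 r)) (size (types2 r))
            (types1 r) (diff1 r) (diff2 r) (contr1 r)
        & contracts n mul (size (types1 r)) (size (types2 r)) (size (types3 r))
            (types2 r) (diff2 r) (diff3 r) (contr2 r)]].

End Checks.

Section BasedAlgebra.
Variables (K : fieldType) (A : falgType K) (charK : 2%N \in [pchar K]).
Variables (n : nat) (b : nat -> A) (mul : nat -> nat -> nat).
Hypotheses (b_out : forall i, (n <= i)%N -> b i = 0).
Hypotheses (bM : forall i j, b i * b j = b (mul i j)).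
Variable (cf : 'I_n -> {scalar A}).
Hypotheses (cfE : forall a, a = \sum_j cf j a *: b j).
Hypotheses (cfb : forall i j : 'I_n, cf i (b j) = (i == j)%:R).
Local Notation R := (enveloping A).
Local Notation N := (regular_bimodule A).

Lemma size_idem ty : size (tab_idem ty) = size ty.
Proof. by rewrite size_map size_iota. Qed.

Section Cohomology.
Variables (P : lmodType R) (Z : P -> Prop) (cobP : (P -> N) -> Prop).
Hypothesis cobPD : forall f f', cobP f -> cobP f' -> cobP (fun x => f x + f' x).
Hypothesis cobPe : forall f f', f =1 f' -> cobP f -> cobP f'.

(** A linear map from the explicit term to A is the family of its values at the generators, to which
    [contraction_basis] applies; [stage_cohomology] then carries the classes to P. *)
Lemma level_cohomology k0 ty k' d d' h (W : 'rV[R]_(size ty) -> Prop) cobF :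
  contracts n mul k0 (size ty) k' ty d d' h ->
  @stage R N P 'rV[R]_(size ty) (lc (pmap b ty)) Z W cobP cobF ->
  (forall psi, cobF psi <-> exists chi : {ffun 'I_k0 -> A},
     forall y, psi y = lc (coface b (size ty) d chi : 'I_(size ty) -> N) y) ->
  (forall y, W y -> exists z : 'rV[R]_k', lc (dmap b _ d') z = lc (pmap b ty) y) ->
  (forall z : 'rV[R]_k', W (lc (dmap b _ d') z)) ->
  exists b' : 'I_(size (classes h)) -> {linear P -> N},
    (forall i x, Z x -> b' i x = 0) /\
    (forall phi : {linear P -> N}, (forall x, Z x -> phi x = 0) ->
     exists! c : 'rV[K]_(size (classes h)),
       cobP (fun y => phi y - \sum_i (c 0 i)%:A *: b' i y)).
Proof.
move=> hC st cobE exW Wd.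
pose cl i : {ffun 'I_(size ty) -> A} := nu b (size ty) (nth [::] (classes h) i).
pose bF (i : 'I_(size (classes h))) : {linear 'rV[R]_(size ty) -> N} :=
  lc (cl i : 'I_(size ty) -> N).
have clP i := class_props charK b_out bM hC i.
have bFp i y : bF i (lc (pmap b ty) y) = bF i y.
  by rewrite -[LHS](lc_coface b (tab_idem ty) (cl i)) (clP i).2.
have lc0 k x : lc ((0 : {ffun 'I_k -> A}) : 'I_k -> N) x = 0.
  by rewrite /lc big1 // => i _; rewrite ffunE scaler0.
apply: (stage_cohomology cobPD cobPe _ _ st (b := bF)).
- move=> f f' /cobE[x xE] /cobE[x' x'E]; apply/cobE; exists (x - x') => y.
  have -> : x - x' = (-1) *: x' + x by rewrite scaleN1r addrC.
  rewrite xE x'E.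
  by rewrite coface_linear lc_cochainP !scaleN1r addrC.
- by move=> f f' ff' /cobE[x xE]; apply/cobE; exists x => y; rewrite -ff'.
- move=> i y /exW[z zE]; rewrite -bFp -zE.
  by rewrite -[LHS](lc_coface b d' (cl i)) (clP i).1 lc0.
- exact: bFp.
move=> psi psiW psip.
pose ps : {ffun 'I_(size ty) -> A} :=
  [ffun h : 'I_(size ty) => psi (gen (size ty) 1 h) : A].
have psE x : lc (ps : 'I_(size ty) -> N) x = psi x.
  by rewrite -[RHS]lcE; apply: eq_lc => g; rewrite ffunE.
have ps_of k (f : {ffun 'I_k -> A}) (x : 'I_k) :
    lc (f : 'I_k -> N) (gen k 1 x) = f x.
  by rewrite lc_gen scale1r.
have [||c [[chi chiE] cU]] := contraction_basis charK b_out bM cfE cfb hC (psi := ps).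
- by apply/ffunP => g; rewrite -!ps_of lc_coface !psE psip.
- by apply/ffunP => g; rewrite -!ps_of lc_coface psE psiW // lc0.
have combE (c' : 'rV[K]_(size (classes h))) y :
    lc (ps - \sum_i c' 0 i *: cl i : 'I_(size ty) -> N) y =
    psi y - \sum_i (c' 0 i)%:A *: bF i y.
  have -> : ps - \sum_i c' 0 i *: cl i = (-1) *: \sum_i c' 0 i *: cl i + ps.
    by rewrite scaleN1r addrC.
  rewrite lc_cochainP psE !scaleN1r addrC; congr (_ - _).
  elim/big_rec2: _ => [|i u v _ IH]; first exact: lc0.
  by rewrite lc_cochainP IH.
exists c; split.
  by apply/cobE; exists chi => y; rewrite -combE chiE.
move=> c' /cobE[chi' chi'E]; apply: cU; exists chi'.
by apply/ffunP => g; rewrite -!ps_of combE chi'E.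
Qed.


End Cohomology.

(** The identity D s + q = p exhibits p x as the boundary of s (p x) when q vanishes there. In use,
    q is the section after the augmentation, or the previous homotopy after the previous
    differential, hence 0 on cycles. *)
Lemma is_htpy_id ty k' d s q qt :
  is_htpy n mul ty d s qt -> (size d <= k')%N ->
  (forall c x y, q (c%:A *: x + y) = c%:A *: q x + q y) ->
  (forall l x, q (bim l 1 *: x) = bim l 1 *: q x) ->
  (forall t : triple, (t.1.2 < size ty)%N -> (t.2 < n)%N ->
     q (ev b (size ty) [:: t]) = ev b (size ty) (qt t)) ->
  forall x : 'rV[R]_(size ty), q (lc (pmap b ty) x) = 0 ->
  exists z : 'rV[R]_k', lc (dmap b _ d) z = lc (pmap b ty) x.
Proof.
move=> /all_iota sC dk qP qZ qE x q0.
exists (htpy b cf k' s (lc (pmap b ty) x)); rewrite -[LHS]addr0 -q0.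
apply: (htpy_id b_out bM cfE erefl qP qZ) => g j gk jn /= tn; rewrite qE //.
rewrite (htpy_ev b_out bM cfb) /= ?gk ?tn //.
rewrite (ev_comp b_out bM) // /ev -big_cat; apply: (ev_eq2 charK b).
by have := all_iota (sC g gk) jn; rewrite /= tn.
Qed.

Lemma is_diffP ty0 ty1 d : is_diff n mul ty0 ty1 d ->
  [/\ (size d <= size ty1)%N,
      forall z : 'rV[R]_(size ty1),
        lc (pmap b ty0) (lc (dmap b (size ty0) d) z) = lc (dmap b (size ty0) d) z
    & forall z : 'rV[R]_(size ty1),
        lc (dmap b (size ty0) d) (lc (pmap b ty1) z) = lc (dmap b (size ty0) d) z].
Proof.
case/and3P => /eqP szd _ /andP[/allP pd /all_iota dp].
split=> [|z|z]; rewrite ?szd // comp_lc; apply: eq_lc => h.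
  rewrite /= /dmap (ev_comp b_out bM) ?size_idem //; apply: (ev_eq2 charK b).
  by apply/pd/mem_nth; rewrite szd.
rewrite /= /pmap /dmap (ev_comp b_out bM) ?szd //; apply: (ev_eq2 charK b).
exact: dp.
Qed.

Lemma is_complexP k0 k1 k2 d d' : is_complex n mul d d' -> (size d <= k1)%N ->
  forall z : 'rV[R]_k2, lc (@dmap _ _ b k1 k0 d) (lc (dmap b k1 d') z) = 0.
Proof.
move=> /allP dd dk z; rewrite comp_lc /lc big1 // => h _.
rewrite /= (ev_comp b_out bM) //; case: (ltnP h (size d')) => [hd|ge].
  by rewrite (ev_eq2 charK b _ (dd _ (mem_nth _ hd))) /ev big_nil scaler0.
by rewrite nth_default // /ev big_nil scaler0.
Qed.

Lemma idem_typesP ty : idem_types n mul ty ->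
  forall z : 'rV[R]_(size ty), lc (pmap b ty) (lc (pmap b ty) z) = lc (pmap b ty) z.
Proof.
move=> /allP ok z; rewrite comp_lc; apply: eq_lc => h.
rewrite /= /pmap /dmap (ev_comp b_out bM) ?size_idem //.
rewrite (nth_map 0%N) ?size_iota // nth_iota // add0n.
have /and4P[/eqP e1 /eqP e2 l1 l2] := ok _ (mem_nth (0, 0)%N (ltn_ord h)).
rewrite /tab_comp /= (nth_map 0%N) ?size_iota // nth_iota // add0n /=.
by rewrite e1 e2 l1 l2.
Qed.

Theorem resolution_HH r :
  resolution_ok n mul r -> 1 = \sum_(v < size (types0 r)) b v ->
  [/\ dim_HH_is 0 A (size (classes (contr0 r))),
      dim_HH_is 1 A (size (classes (contr1 r)))
    & dim_HH_is 2 A (size (classes (contr2 r)))].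
Proof.
case/and5P => [/and5P[/eqP ty0E id0 id1 id2 id3] /and3P[df1 df2 df3]
  /and3P[/allP aug1 cx12 cx23] /and3P[ht0 ht1 ht2] /and3P[co0 co1 co2]] one.
set k0 := size (types0 r) in one *.
have nth0 g : (g < k0)%N -> nth (0, 0)%N (types0 r) g = (g, g).
  by move=> gk; rewrite ty0E (nth_map 0%N) ?size_iota // nth_iota.
have [d1k pd1 d1p] := is_diffP df1; have [d2k pd2 d2p] := is_diffP df2.
have [d3k pd3 d3p] := is_diffP df3.
have pp0 := idem_typesP id0; have pp1 := idem_typesP id1.
have pp2 := idem_typesP id2; have pp3 := idem_typesP id3.
pose eta : {linear 'rV[R]_k0 -> N} := lc (fun v : 'I_k0 => b v : N).
have etag l s (v : 'I_k0) : eta (gen k0 (bim l s) v) = (l * b v * s : A).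
  by rewrite /eta /= lc_gen bim_act.
have bvv (v : 'I_k0) : b v * b v = b v.
  have /and4P[/eqP e _ _ _] := allP id0 _ (mem_nth (0, 0)%N (ltn_ord v)).
  by move: e; rewrite nth0 //= => e; rewrite bM e.
have etap y : eta (lc (pmap b (types0 r)) y) = eta y.
  rewrite comp_lc; apply: eq_lc => v.
  rewrite /= /pmap /dmap (nth_map 0%N) ?size_iota // nth_iota // add0n nth0 //.
  by rewrite /ev big_seq1 etag /= bvv bvv.
(* [X0] is \sum_v e_v (x) e_v, a preimage of 1 under multiplication. *)
pose X0 := ev b k0 [seq (v, v, v) | v <- iota 0 k0].
pose q0 y := bim (eta y : A) 1 *: X0.
have X0E (F : nat -> 'rV[R]_k0) : \sum_(v <- iota 0 k0) F v = \sum_(v < k0) F v.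
  by rewrite -[X in iota 0 X]subn0 -/(index_iota 0 k0) big_mkord.
have etaX : eta X0 = (1 : A).
  rewrite /X0 /ev big_map X0E linear_sum one; apply: eq_bigr => v _.
  by rewrite etag !bvv.
have etaS m : exists y, eta y = m.
  by exists (bim (m : A) 1 *: X0); rewrite linearZ etaX /= bim_act !mulr1.
have ex0 y : eta y = 0 ->
    exists z : 'rV[R]_(size (types1 r)),
      lc (dmap b _ (diff1 r)) z = lc (pmap b (types0 r)) y.
  move=> y0; apply: (is_htpy_id ht0 d1k (q := q0)).
  - move=> c x z; rewrite /q0 linearP scalar_act bimPl scalerDl.
    by rewrite scalerA mulr_algl.
  - move=> l x; rewrite /q0 linearZ /= bim_act mulr1.
    by rewrite scalerA bimM mulr1.
  - move=> t tk tn; rewrite /q0 {1}/ev big_seq1 (etag _ _ (Ordinal tk)) /= !bM.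
    rewrite /X0 /aug_section /ev scaler_sumr big_filter [RHS]big_mkcond !big_map.
    apply: eq_bigr => v _ /=; rewrite -genZ bimM mulr1 bM.
    by case: ltnP => // /b_out ->; rewrite bim0l gen0.
  - by rewrite /q0 etap y0 bim0l scale0r.
have exS ty0 ty1 ty2 d d' s s' :
    is_diff n mul ty0 ty1 d -> (size d' <= size ty2)%N ->
    is_htpy n mul ty1 d' s' (fun t => tab_htpy n mul s (tab_comp n mul d [:: t])) ->
    forall y, lc (dmap b (size ty0) d) y = 0 ->
    exists z : 'rV[R]_(size ty2), lc (dmap b (size ty1) d') z = lc (pmap b ty1) y.
  move=> df dk ht y y0; have [dk0 _ dp] := is_diffP df.
  have /and3P[_ /allP dr _] := df.
  pose q (x : 'rV[R]_(size ty1)) :=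
    htpy b cf (size ty1) s (lc (dmap b (size ty0) d) x).
  apply: (is_htpy_id ht dk (q := q)); rewrite /q.
  - by move=> c x z; rewrite linearP htpyP.
  - by move=> l x; rewrite linearZ htpyZ.
  - move=> t tk tn; rewrite (ev_comp b_out bM) // (htpy_ev b_out bM cfb) //.
    apply/allP => v; rewrite mem_filter => /andP[/andP[_ ->]].
    rewrite andbT => /allpairsPdep[t' [u [_ ud ->]]] /=.
    case: (ltnP t'.1.2 (size d)) => [lt|ge]; last by rewrite nth_default in ud.
    by have /allP := dr _ (mem_nth [::] lt); apply.
  - by rewrite dp y0 htpy0.
pose p (ty : seq (nat * nat)) : {linear 'rV[R]_(size ty) -> 'rV[R]_(size ty)} :=
  lc (pmap b ty).
pose D (ty0 ty1 : seq (nat * nat)) d :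
    {linear 'rV[R]_(size ty1) -> 'rV[R]_(size ty0)} := lc (dmap b (size ty0) d).
pose D1 := D (types0 r) (types1 r) (diff1 r).
pose D2 := D (types1 r) (types2 r) (diff2 r).
pose D3 := D (types2 r) (types3 r) (diff3 r).
have etaD z : eta (D1 z) = 0.
  rewrite comp_lc /lc big1 // => h _; rewrite [X in _ *: X](_ : _ = 0) ?scaler0 //.
  have /and3P[/eqP sz1 /allP dr _] := df1.
  have hd : (h < size (diff1 r))%N by rewrite sz1.
  have := aug1 _ (mem_nth [::] hd); have /allP := dr _ (mem_nth [::] hd).
  rewrite /= /dmap; set l := nth _ _ _ => lr /(eq2_sum (@char2_vect _ charK _) b).
  rewrite big_nil big_filter big_mkcond big_map => e; rewrite -[RHS]e.
  rewrite /ev linear_sum big_seq [RHS]big_seq; apply: eq_bigr => t /lr tk.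
  rewrite (etag _ _ (Ordinal tk)) /= !bM.
  by case: ltnP => // /b_out ->.
have cobE n0 ty (psi : 'rV[R]_(size ty) -> N) d :
    (exists ga : {linear 'rV[R]_n0 -> N}, forall y,
       psi y = ga (lc (dmap b n0 d : 'I_(size ty) -> _) y)) <->
    exists chi : {ffun 'I_n0 -> A}, forall y,
      psi y = lc (coface b (size ty) d chi : 'I_(size ty) -> N) y.
  split=> [[ga gaE]|[chi chiE]].
    exists [ffun h : 'I_n0 => ga (gen n0 1 h) : A] => y.
    rewrite gaE lc_coface -[LHS]lcE; apply: eq_lc => g; rewrite ffunE.
    by [].
  by exists (lc (chi : 'I_n0 -> N)) => y; rewrite chiE lc_coface.
have st0 (P : proj_resolution N) : stage (N := N) (p (types0 r))
    (fun x => res_aug P x = 0) (fun y => eta y = 0)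
    (fun phi : P 0 -> N => forall x, phi x = 0) (fun psi => forall y, psi y = 0).
  apply: stage0 => //; try exact: rV_projective; try exact: res_projective.
  exact: res_aug_surj.
have st1 (P : proj_resolution N) : stage (N := N) (p (types1 r))
    (fun x => res_diff P 0 x = 0) (fun y => D1 y = 0)
    (fun phi : P 1 -> N => exists ga : {linear P 0 -> N},
       forall x, phi x = ga (res_diff P 0 x))
    (fun psi => exists ga : {linear 'rV[R]_k0 -> N}, forall y,
       psi y = ga (D1 y)).
  apply: stageS (st0 P) => //; try exact: rV_projective; try exact: res_projective.
  exact: res_exact0.
have D12z z : D1 (D2 z) = 0.
  exact: is_complexP.
have D23 z : D2 (D3 z) = 0.
  exact: is_complexP.
have st2 (P : proj_resolution N) : stage (N := N) (p (types2 r))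
    (fun x => res_diff P 1 x = 0) (fun y => D2 y = 0)
    (fun phi : P 2 -> N => exists ga : {linear P 1 -> N},
       forall x, phi x = ga (res_diff P 1 x))
    (fun psi => exists ga : {linear 'rV[R]_(size (types1 r)) -> N}, forall y,
       psi y = ga (D2 y)).
  apply: stageS (st1 P) => //; try exact: rV_projective; try exact: res_projective.
    exact: res_exactS.
  by move=> y; apply: exS df1 d2k ht1 y.
have cocZ (P : proj_resolution N) i (Z : P i -> Prop) (phi : P i -> N) :
    (forall x, Z x <-> exists y, res_diff P i y = x) ->
    (forall x, Z x -> phi x = 0) <-> cocycle phi.
  move=> Zd; split=> [Z0 x|c0 x /Zd[y <-]]; last exact: c0.
  by apply: Z0; apply/Zd; exists x.
have finish (P : proj_resolution N) i (Z : P i -> Prop) m :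
    (forall x, Z x <-> exists y, res_diff P i y = x) ->
    (exists b' : 'I_m -> {linear P i -> N},
      (forall i x, Z x -> b' i x = 0) /\
      (forall phi : {linear P i -> N}, (forall x, Z x -> phi x = 0) ->
       exists! c : 'rV[K]_m,
         coboundary (fun y => phi y - \sum_i (c 0 i)%:A *: b' i y))) ->
    exists b : 'I_m -> {linear P i -> N}, cohomology_basis b.
  move=> Zd [b' [b'Z b'P]]; exists b'; split=> [j|f fc].
    by apply/(cocZ _ _ _ _ Zd); apply: b'Z.
  by apply: b'P; apply/(cocZ _ _ _ _ Zd).
have cobD (P : proj_resolution N) i (f f' : P i -> N) :
    coboundary f -> coboundary f' -> coboundary (fun x => f x + f' x).
  case: i f f' => [|i] f f' /=.
    by move=> f0 f0' x; rewrite f0 f0' addr0.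
  by move=> [g gE] [g' g'E]; exists (g \+ g') => x; rewrite gE g'E.
have cobe (P : proj_resolution N) i (f f' : P i -> N) :
    f =1 f' -> coboundary f -> coboundary f'.
  case: i f f' => [|i] f f' /= ff'.
    by move=> f0 x; rewrite -ff'.
  by move=> [g gE]; exists g => x; rewrite -ff'.
split=> P.
- apply: (finish _ _ _ _ (@res_exact0 _ _ P)).
  apply: (level_cohomology (@cobD P 0) (@cobe P 0) co0 (st0 P)) => //.
  (* The term below degree 0 has rank 0, so coboundaries are 0. *)
  move=> psi; split=> [psi0|[chi chiE] y].
    exists 0 => y; rewrite psi0 lc_coface.
    by rewrite /lc big_ord0.
  by rewrite chiE lc_coface /lc big_ord0.
- apply: (finish _ _ _ _ (@res_exactS _ _ P 0)).
  apply: (level_cohomology (@cobD P 1) (@cobe P 1) co1 (st1 P)) => [psi|y|//].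
    exact: cobE.
  by apply: exS df1 d2k ht1 y.
- apply: (finish _ _ _ _ (@res_exactS _ _ P 1)).
  apply: (level_cohomology (@cobD P 2) (@cobe P 2) co2 (st2 P)) => [psi|y|//].
    exact: cobE.
  by apply: exS df2 d3k ht2 y.
Qed.

End BasedAlgebra.

(** * Multiplicative bases of bound quiver algebras *)

Definition word_val (R : pzRingType) (T : Type) (f : T -> R) (w : seq T) : R :=
  \prod_(a <- w) f a.

Definition poly_val (R : pzRingType) (T : Type) (f : T -> R) (p : seq (seq T)) : R :=
  \sum_(w <- p) word_val f w.

Lemma word_val_cat (R : pzRingType) (T : Type) (f : T -> R) u w :
  word_val f (u ++ w) = word_val f u * word_val f w.
Proof. exact: big_cat. Qed.

Lemma rmorph_poly_val (R R' : pzRingType) (T : Type) (f : T -> R)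
    (phi : {rmorphism R -> R'}) p :
  phi (poly_val f p) = poly_val (phi \o f) p.
Proof. by rewrite rmorph_sum; apply: eq_bigr => w _; rewrite rmorph_prod. Qed.

(* A step [s] of a derivation appends to the list of known relations [E] the
   relation \sum u * E_k * v, the sum being over the (u, k, v) in [s]. *)
Definition derive (E : seq (seq (seq nat)))
    (steps : seq (seq (seq nat * nat * seq nat))) : seq (seq (seq nat)) :=
  foldl (fun E s => rcons E (canc (flatten
    [seq [seq t.1.1 ++ w ++ t.2 | w <- nth [::] E t.1.2] | t <- s]))) E steps.

Lemma derive_sound (R : pzRingType) (f : nat -> R) E steps :
  (forall x : R, x + x = 0) -> (forall p, p \in E -> poly_val f p = 0) ->
  forall p, p \in derive E steps -> poly_val f p = 0.
Proof.
move=> R2; elim: steps E => //= s steps IH E E0; apply: IH => p.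
rewrite mem_rcons inE => /orP[/eqP->|/E0 //].
rewrite /poly_val sum_canc // big_flatten big_map big1 // => t _.
have Ek : poly_val f (nth [::] E t.1.2) = 0.
  case: (ltnP t.1.2 (size E)) => [lt|ge]; first exact/E0/mem_nth.
  by rewrite nth_default // /poly_val big_nil.
rewrite big_map; under eq_bigr do rewrite !word_val_cat.
by rewrite -mulr_sumr -mulr_suml -/(poly_val _ _) Ek mul0r mulr0.
Qed.

Section PathAlgebras.
Variables (K : fieldType) (Q : quiver).
Local Notation KQ := (path_algebra K Q).
Local Notation vpath v := (path_elt K (vertex_path v) : KQ).

Lemma path_mulE (p q : qpath Q) :
  path_elt K p * path_elt K q = oapp (@path_elt K Q) 0 (pcat p q) :> KQ.
Proof. exact: palg_mulUU. Qed.

Lemma mul_path_vertex (p : qpath Q) v :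
  path_elt K p * vpath v = (if path_target p == v then path_elt K p else 0) :> KQ.
Proof. by rewrite path_mulE pcatp0; case: ifP. Qed.

Lemma mul_vertex_path v (p : qpath Q) :
  vpath v * path_elt K p = (if v == path_source p then path_elt K p else 0) :> KQ.
Proof. by rewrite path_mulE pcat0p; case: ifP. Qed.

(** The leading vertex tells apart the trivial paths, which all have the empty word; before a
    nonempty path it is absorbed. *)
Lemma path_eltE (p : qpath Q) :
  path_elt K p = vpath (path_source p) * word_val arr (path_arrows p).
Proof.
case: p => -[v s]; rewrite /path_source /path_arrows /=.
elim: s v => [|a s IH] v /= vs.
  rewrite /word_val big_nil mulr1; congr path_elt.
  by apply: qpath_inj.
have /andP[/eqP av as_] := vs.
rewrite /word_val big_cons.
have -> : vpath v * (arr a * word_val arr s) =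
    arr a * (vpath (target a) * word_val arr s).
  rewrite !mulrA mul_vertex_path mul_path_vertex /= {1}/path_source /= -av eqxx.
  by rewrite /path_target /= eqxx.
rewrite -(IH _ as_) path_mulE.
have [r rE] : {r | pcat (arrow_path a) (exist _ (target a, s) as_) = Some r}.
  by apply: pcat_total.
rewrite rE /=; have /pcat_SomeP[_ r1 r2] := rE; congr path_elt.
by apply: qpath_inj; rewrite ?r1 ?r2 /path_source /path_arrows /= ?av.
Qed.

End PathAlgebras.

Definition vnum (v : vertex3) : nat :=
  match v with v1 => 0 | v2 => 1 | v3 => 2 end.

Definition vdec (i : nat) : vertex3 := nth v3 [:: v1; v2] i.

Lemma vnumK : cancel vnum vdec. Proof. by case. Qed.

Lemma vdecK i : (i < 3)%N -> vnum (vdec i) = i.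
Proof. by case: i => [|[|[|]]]. Qed.

(* A candidate multiplicative basis of a bound quiver algebra: paths, written as
   a source and a list of letters, with the table of their products by the
   arrows (an index past the end stands for 0). *)
Record path_basis := PathBasis {
  basis_paths : seq (nat * seq nat);
  arrow_table : seq (seq nat);
  relations : seq (seq (seq nat));
  derivation : seq (seq (seq nat * nat * seq nat))
}.

Section Numeric.
Variables (E : finType) (st : E -> vertex3 * vertex3) (lt : nat -> E) (nl : nat).
Variable B : path_basis.

Let n := size (basis_paths B).
Definition letter_source a := vnum (st (lt a)).1.
Definition letter_target a := vnum (st (lt a)).2.
Definition bsource i := (nth (0, [::]) (basis_paths B) i).1%N.
Definition bword i := (nth (0, [::]) (basis_paths B) i).2%N.
Definition btarget i := last (bsource i) [seq letter_target a | a <- bword i].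
Definition act i a := nth n (nth [::] (arrow_table B) i) a.
Definition actw i w := foldl act i w.
Definition bmul i j :=
  if [&& i < n, j < n & btarget i == bsource j]%N then actw i (bword j) else n.

(** Certifies that b_i times the arrow is b_j, or 0 if j is out of range: the two words form a
    derived relation. The extra empty relation covers the case where the longer word is itself the
    normal form. *)
Definition act_ok i a : bool :=
  let j := act i a in
  if btarget i == letter_source a then
    ((j < n)%N ==> (bsource j == bsource i) && (btarget j == letter_target a)) &&
    has (fun p => eq2 p
          (rcons (bword i) a :: if (j < n)%N then [:: bword j] else [::]))
      ([::] :: derive (relations B) (derivation B))
  else (n <= j)%N.

(** The checks [act_ok] give spanning. Independence rests on two others: walking from a source along
    the word of b_i ends at i, and every relation acts on the right of every index as 0. *)
Definition path_basis_ok : bool :=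
  [&& [&& take 3 (basis_paths B) == [:: (0, [::]); (1, [::]); (2, [::])]%N,
          size (arrow_table B) == n,
          all (fun e => all (fun a => a < nl)%N e.2 && (e.1 < 3)%N) (basis_paths B),
          all (all (all (fun a => a < nl)%N)) (relations B)
        & all (fun i => actw (bsource i) (bword i) == i) (iota 0 n)],
      all (fun i => all (act_ok i) (iota 0 nl)) (iota 0 n)
    & all (fun i => all (fun p =>
        eq2 [seq j <- [seq actw i w | w <- p] | (j < n)%N] [::]) (relations B))
        (iota 0 n)].

Lemma act_out i a : path_basis_ok -> (n <= i)%N -> (n <= act i a)%N.
Proof.
case/and3P => /and5P[_ /eqP sz _ _ _] _ _ ni.
by rewrite /act [nth [::] _ i]nth_default ?sz // nth_nil.
Qed.

Lemma actw_out i w : path_basis_ok -> (n <= i)%N -> (n <= actw i w)%N.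
Proof. by move=> ok; elim: w i => //= a w IH i ni; apply/IH/act_out. Qed.

Lemma basis_vertices : path_basis_ok ->
  (2 < n)%N /\ forall v, (v < 3)%N -> bsource v = v /\ bword v = [::].
Proof.
case/and3P => /and5P[/eqP t3 _ _ _ _] _ _.
have n3 : (2 < n)%N.
  have := congr1 size t3; rewrite size_take /n; case: ltnP => [h _|_ /= ->] //.
  exact: ltnW.
split=> // v v3; rewrite /bsource /bword -(nth_take _ v3) t3.
by case: v v3 => [|[|[|]]].
Qed.

Section Algebra.
Variables (K : fieldType) (charK : 2%N \in [pchar K]) (A : falgType K).
Let Q := quiver3 st.
Let letter_arrow (a : nat) : path_algebra K Q := arr (lt a : arrow Q).
Variable phi : {lrmorphism path_algebra K Q -> A}.
Hypothesis phi_surj : forall a, exists x, phi x = a.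
Hypothesis phi_ker : forall x, phi x = 0 <->
  in_ideal [seq poly_val letter_arrow p | p <- relations B] x.
Hypothesis ok : path_basis_ok.
Variable li : E -> nat.
Hypotheses (liK : cancel li lt) (li_nl : forall a, (li a < nl)%N).
Hypothesis ltK : forall a, (a < nl)%N -> li (lt a) = a.

Local Notation vpath v := (path_elt K (vertex_path (v : vertex Q))).
Let f (a : nat) : A := phi (letter_arrow a).
Let e (v : nat) : A := phi (vpath (vdec v)).
Let b (i : nat) : A := if (i < n)%N then e (bsource i) * word_val f (bword i) else 0.

Lemma basis_out i : (n <= i)%N -> b i = 0.
Proof. by rewrite /b leqNgt => /negPf ->. Qed.

Lemma derived_relation0 p :
  p \in derive (relations B) (derivation B) -> poly_val f p = 0.
Proof.
apply: derive_sound => [x|q qr]; first exact: char2_vect.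
have inI : in_ideal [seq poly_val letter_arrow p | p <- relations B]
    (poly_val letter_arrow q).
  exists 1%N, (fun=> 1), (fun=> poly_val letter_arrow q), (fun=> 1).
  by rewrite big_ord1 mul1r mulr1; split=> // _; apply: map_f.
by have := (phi_ker _).2 inI; rewrite rmorph_poly_val.
Qed.

Lemma vertex_mul_arrow v a :
  e v * f a = if letter_source a == vnum (vdec v) then f a else 0.
Proof.
rewrite /e /f -rmorphM /letter_arrow /arr mul_vertex_path.
rewrite {1}/path_source /= /letter_source.
rewrite (can_eq vnumK) eq_sym; case: ifP => // _; exact: rmorph0.
Qed.

Lemma arrow_mul_vertex a v :
  f a * e v = if letter_target a == vnum (vdec v) then f a else 0.
Proof.
rewrite /e /f -rmorphM /letter_arrow /arr mul_path_vertex.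
rewrite {1}/path_target /= /letter_target.
rewrite (can_eq vnumK); case: ifP => // _; exact: rmorph0.
Qed.

Lemma vertex_mul_vertex u v :
  e u * e v = if vnum (vdec u) == vnum (vdec v) then e u else 0.
Proof.
rewrite /e -rmorphM mul_path_vertex {1}/path_target /=.
rewrite (can_eq vnumK); case: ifP => // _; exact: rmorph0.
Qed.

Lemma bsource3 i : (bsource i < 3)%N.
Proof.
case/and3P: ok => /and5P[_ _ /allP h _ _] _ _; rewrite /bsource.
case: (ltnP i n) => [ni|ge]; last by rewrite nth_default.
by have /andP[] := h _ (mem_nth (0, [::])%N ni).
Qed.

Lemma basis_mul_vertex i v : (v < 3)%N ->
  b i * e v = if btarget i == v then b i else 0.
Proof.
move=> v3; rewrite /b; case: ifP => [_|]; last by rewrite mul0r if_same.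
rewrite /btarget; case: (lastP (bword i)) => [|w a].
  rewrite /word_val big_nil mulr1 vertex_mul_vertex !vdecK //; exact: bsource3.
rewrite map_rcons last_rcons -cats1 word_val_cat /word_val big_seq1 -!mulrA.
rewrite arrow_mul_vertex.
by rewrite vdecK //; case: ifP => // _; rewrite !mulr0.
Qed.

Lemma letter_source3 a : (letter_source a < 3)%N.
Proof. by rewrite /letter_source; case: (st _).1. Qed.

Lemma basis_mul_arrow i a : (a < nl)%N -> b i * f a = b (act i a).
Proof.
move=> al; case: (ltnP i n) => [ni|ge]; last first.
  by rewrite !basis_out ?mul0r ?act_out.
case/and3P: ok => _ /all_iota/(_ i ni)/all_iota/(_ a al) h _.
(* Inserting the source idempotent makes the product vanish when the endpoints do not match. *)
have fE : f a = e (letter_source a) * f a.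
  by rewrite vertex_mul_arrow vdecK ?eqxx ?letter_source3.
rewrite fE mulrA basis_mul_vertex ?letter_source3 //; move: h; rewrite /act_ok.
case: ifP => [_|_ h]; last first.
  by rewrite mul0r basis_out.
case/andP => hj /hasP[p pE pt].
have p0 : poly_val f p = 0.
  move: pE; rewrite inE => /orP[/eqP->|/derived_relation0 //].
  by rewrite /poly_val big_nil.
move: pt => /(eq2_sum (@char2_vect _ charK _) (word_val f)).
rewrite -/(poly_val _ _) p0 big_cons -cats1 word_val_cat {2}/word_val big_seq1.
rewrite {1 2}/b ni -mulrA; set j := act i a in hj *; case: ifP hj => /= [jn|_] hj.
  rewrite big_seq1 => /esym/eqP; rewrite addr_eq0 => /eqP ->.
  have /andP[/eqP -> _] := hj.
  by rewrite mulrN; apply/eqP; rewrite eq_sym -addr_eq0 char2_vect.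
by rewrite big_nil addr0 => <-; rewrite mulr0.
Qed.

Lemma basis_mul_word i w : all (fun a => a < nl)%N w ->
  b i * word_val f w = b (actw i w).
Proof.
elim: w i => [|a w IH] i /=; first by rewrite /word_val big_nil mulr1.
by case/andP => al wl; rewrite /word_val big_cons mulrA basis_mul_arrow // IH.
Qed.

Lemma basis_mul i j : b i * b j = b (bmul i j).
Proof.
rewrite /bmul; case: (ltnP i n) => [ni|ge] /=; last first.
  by rewrite (basis_out ge) mul0r (basis_out (leqnn n)).
case: (ltnP j n) => [nj|ge] /=; last first.
  by rewrite (basis_out ge) mulr0 (basis_out (leqnn n)).
rewrite {2}/b nj mulrA basis_mul_vertex ?bsource3 //; case: ifP => _; last first.
  by rewrite mul0r (basis_out (leqnn n)).
apply: basis_mul_word; case/and3P: ok => /and5P[_ _ /allP h _ _] _ _.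
by have /andP[] := h _ (mem_nth (0, [::])%N nj).
Qed.

Lemma basis_vertex v : (v < 3)%N -> b v = e v.
Proof.
move=> v3; have [n3 /(_ v v3)[s w]] := basis_vertices ok.
by rewrite /b (leq_trans v3 n3) s w /word_val big_nil mulr1.
Qed.

Lemma one_vertices : 1 = \sum_(v < 3) b v.
Proof.
rewrite -(rmorph1 phi) -[1 in LHS]/(palg_one K Q) /palg_one rmorph_sum.
rewrite (reindex (fun i : 'I_3 => vdec i)) /=; last first.
  exists vertex3_code => [i _|v _]; last by case: v.
  by apply: val_inj; case: i => [[|[|[|]]]].
by apply: eq_bigr => i _; rewrite basis_vertex.
Qed.

(** A path is sent to the basis element reached by walking along its arrows from the index of its
    source, or to 0 if the walk leaves the range. *)
Lemma basis_span a : exists c : 'rV[K]_n, a = \sum_i c 0 i *: b i.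
Proof.
have [x <-] := phi_surj a; elim/palg_ind: x => [c x y [cx ex] [cy ey]||p].
- exists (c *: cx + cy); rewrite linearP /= ex ey scaler_sumr -big_split.
  by apply: eq_bigr => i _; rewrite !mxE scalerDl scalerA.
- exists 0; rewrite linear0 big1 // => i _; rewrite mxE scale0r //.
have -> : phi (path_elt K p) =
    b (actw (vnum (path_source p)) [seq li a | a <- path_arrows p]).
  rewrite path_eltE rmorphM /= rmorph_prod -basis_mul_word; last first.
    by apply/allP => x /mapP[a' _ ->].
  rewrite basis_vertex; last by case: (path_source p).
  rewrite /e vnumK; congr (_ * _); rewrite /word_val big_map.
  by apply: eq_bigr => a' _; rewrite /f /letter_arrow /= liK.
set i := actw _ _; exists (unit_row _ n i).
case: (ltnP i n) => [ni|ge].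
  rewrite (bigD1 (Ordinal ni)) //= mxE eqxx scale1r big1 ?addr0 // => j ne.
  rewrite mxE; case: eqP => [ji|]; last by rewrite scale0r.
  by case/eqP: ne; apply: val_inj.
rewrite basis_out // big1 // => j _; rewrite mxE.
by case: eqP => [ji|]; [move: (ltn_ord j); rewrite ji ltnNge ge|rewrite scale0r].
Qed.

(** * Independence through the right action *)

Local Notation row i := (unit_row K n i).

Lemma row_out i : (n <= i)%N -> row i = 0.
Proof.
move=> ge; apply/rowP => j; rewrite !mxE; case: eqP => // ji.
by move: (ltn_ord j); rewrite ji ltnNge ge.
Qed.

Let rlin (g : nat -> 'rV[K]_n) (r : 'rV[K]_n) : 'rV[K]_n := \sum_i r 0 i *: g i.

Lemma rlin_linear g : linear (rlin g).
Proof.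
move=> c x y; rewrite /rlin scaler_sumr -big_split; apply: eq_bigr => i _ /=.
by rewrite !mxE scalerDl scalerA.
Qed.

Lemma rlin0 g : rlin g 0 = 0.
Proof. by rewrite /rlin big1 // => i _; rewrite mxE scale0r. Qed.

Lemma rlin_row g i : rlin g (row i) = if (i < n)%N then g i else 0.
Proof.
case: ltnP => [ni|ge]; last by rewrite row_out ?rlin0.
rewrite /rlin (bigD1 (Ordinal ni)) //= mxE eqxx scale1r big1 ?addr0 // => j ne.
rewrite mxE; case: eqP => [ji|]; last by rewrite scale0r.
by case/eqP: ne; apply: val_inj.
Qed.

Lemma rlin_comp g g' r : rlin g' (rlin g r) = rlin (fun i => rlin g' (g i)) r.
Proof.
have [h hE] := linear_pack (rlin_linear g').
rewrite -hE [in LHS]/rlin linear_sum; apply: eq_bigr => i _.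
by rewrite linearZ hE.
Qed.

Let walk (p : qpath Q) : nat :=
  actw (vnum (path_source p)) [seq li a | a <- path_arrows p].

(** A walk that leaves the range never returns, so ending in range forces every intermediate index
    to be in range, where [act_ok] controls the target. *)
Lemma actw_target (v : vertex Q) (s : seq (arrow Q)) i :
  ((i < n)%N -> btarget i = vnum v) -> is_qpath v s ->
  (actw i [seq li a | a <- s] < n)%N ->
  btarget (actw i [seq li a | a <- s]) = vnum (last v (map (@target Q) s)).
Proof.
elim: s v i => [|a s IH] v i iv //= /andP[/eqP av as_] jn.
have ni : (i < n)%N.
  by rewrite ltnNge; apply: contraL jn => ge; rewrite -leqNgt actw_out ?act_out.
apply: IH => // j_n.
case/and3P: ok => _ /all_iota/(_ i ni)/all_iota/(_ _ (li_nl a)) + _.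
rewrite /act_ok iv // -av /letter_source liK eqxx j_n /=.
case/andP => /andP[_ /eqP ->] _.
by rewrite /letter_target liK.
Qed.

Lemma walk_target p : (walk p < n)%N -> btarget (walk p) = vnum (path_target p).
Proof.
apply: actw_target; last exact: (valP p).
move=> _; set v := vnum _; have v3 : (v < 3)%N by rewrite /v; case: (path_source p).
have [_ /(_ v v3)[s w]] := basis_vertices ok.
by rewrite /btarget s w.
Qed.

(* The right regular representation of the algebra on its would-be basis,
   evaluated at 1; it kills the ideal of relations. *)
Let Psi : path_algebra K Q -> 'rV[K]_n := linext (fun p => row (walk p)).

Lemma Psi_linear : linear Psi.
Proof. exact: linext_is_linear. Qed.

Lemma Psi_path p : Psi (path_elt K p) = row (walk p).
Proof. by rewrite path_elt.unlock /Psi linextU scale1r. Qed.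

Lemma Psi0 : Psi 0 = 0.
Proof. by have := Psi_linear (-1) 0 0; rewrite scaler0 addr0 scaleN1r addNr. Qed.

(** Checked on paths, right multiplication by [y] becomes a linear operator on rows. *)
Lemma Psi_mul y g :
  (forall p, Psi (path_elt K p * y) = rlin g (row (walk p))) ->
  forall x, Psi (x * y) = rlin g (Psi x).
Proof.
move=> Pp; elim/palg_ind => [c x x' Px Px'||p].
- by rewrite mulrDl -scalerAl !Psi_linear rlin_linear Px Px'.
- by rewrite mul0r Psi0 rlin0.
- by rewrite Pp Psi_path.
Qed.

Lemma Psi_vertex (v : vertex Q) x : Psi (x * vpath v) =
  rlin (fun i => if btarget i == vnum v then row i else 0) (Psi x).
Proof.
apply: Psi_mul => p; rewrite mul_path_vertex rlin_row.
case: ltnP => [/walk_target ->|ge]; last first.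
  by case: ifP => _; rewrite ?Psi0 // Psi_path row_out.
by rewrite (can_eq vnumK); case: ifP => _; rewrite ?Psi0 ?Psi_path.
Qed.

Lemma Psi_arrow (a : arrow Q) x :
  Psi (x * arr a) = rlin (fun i => row (act i (li a))) (Psi x).
Proof.
apply: Psi_mul => p; rewrite rlin_row /arr path_mulE.
case: (path_target p =P path_source (arrow_path a)) => [e1|ne].
  have [r rE] := pcat_total e1; rewrite rE /= Psi_path.
  have /pcat_SomeP[_ r1 r2] := rE.
  have -> : walk r = act (walk p) (li a).
    by rewrite /walk r1 r2 map_cat /actw foldl_cat.
  by case: ltnP => // ge; rewrite row_out ?act_out.
have -> : pcat p (arrow_path a) = None by rewrite /pcat; case: eqP.
rewrite /= Psi0; case: ltnP => // wn; rewrite row_out //.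
case/and3P: ok => _ /all_iota/(_ _ wn)/all_iota/(_ _ (li_nl a)) + _.
rewrite /act_ok walk_target // /letter_source liK (can_eq vnumK).
by case: eqP => // e1; case: ne.
Qed.

Lemma Psi_word (s : seq (arrow Q)) x : Psi (x * word_val arr s) =
  rlin (fun i => row (actw i [seq li a | a <- s])) (Psi x).
Proof.
elim: s x => [|a s IH] x.
  rewrite /word_val big_nil mulr1 /rlin [LHS](row_sum_delta (Psi x)).
  by apply: eq_bigr => i _; congr (_ *: _); apply/rowP => j; rewrite !mxE.
rewrite /word_val big_cons mulrA IH Psi_arrow rlin_comp; apply: eq_bigr => i _.
by rewrite rlin_row /=; case: ltnP => // ge; rewrite row_out ?actw_out.
Qed.

Lemma Psi_letters w x : all (fun a => a < nl)%N w ->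
  Psi (x * word_val letter_arrow w) = rlin (fun i => row (actw i w)) (Psi x).
Proof.
move=> /allP wl.
have -> : word_val letter_arrow w = word_val arr [seq (lt a : arrow Q) | a <- w].
  by rewrite /word_val big_map.
rewrite Psi_word -map_comp (_ : [seq _ | a <- w] = w) //.
by rewrite -[RHS]map_id; apply/eq_in_map => a /wl; apply: ltK.
Qed.

Lemma Psi_rel p x : p \in relations B -> Psi (x * poly_val letter_arrow p) = 0.
Proof.
move=> pB; rewrite /poly_val mulr_sumr.
have [h hE] := linear_pack Psi_linear; rewrite -hE linear_sum.
case/and3P: ok => /and5P[_ _ _ /allP/(_ p pB)/allP pl _] _ chk.
rewrite big_seq (eq_bigr (fun w => rlin (fun i => row (actw i w)) (Psi x))).
  rewrite -big_seq /rlin exchange_big big1 //= => i _; rewrite -scaler_sumr.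
  have /allP/(_ p pB) := all_iota chk (ltn_ord i).
  move/(eq2_sum (@char2_vect _ charK _) (fun j => row j)).
  rewrite big_nil big_filter big_mkcond big_map => e1.
  rewrite (eq_bigr (fun w => if (actw i w < n)%N then row (actw i w) else 0)).
    by rewrite e1 scaler0.
  by move=> w _; case: ltnP => // ge; rewrite row_out.
by move=> w wp; rewrite hE Psi_letters ?pl.
Qed.

(** In u g v the left factor is harmless because [Psi_rel] holds after any element, the right one
    because it acts on rows by linear operators, which preserve 0. *)
Lemma Psi_ideal x : phi x = 0 -> Psi x = 0.
Proof.
move/phi_ker => [m [u [g [v [gB ->]]]]].
have [h hE] := linear_pack Psi_linear; rewrite -hE linear_sum big1 // => i _.
have /mapP[p pB ->] := gB i; rewrite hE.
have := Psi_rel (u i) pB; set y := u i * _ => y0.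
elim/palg_ind: (v i) => [c z z' Pz Pz'||q].
- by rewrite mulrDr -scalerAr Psi_linear Pz Pz' scaler0 addr0.
- by rewrite mulr0 Psi0.
by rewrite path_eltE mulrA Psi_word Psi_vertex y0 !rlin0.
Qed.

(** [Psi] sends the path lifting b_i to the i-th unit row and vanishes on the kernel of [phi]. *)
Lemma basis_free (c : 'rV[K]_n) : \sum_i c 0 i *: b i = 0 -> c = 0.
Proof.
pose bb i : path_algebra K Q :=
  vpath (vdec (bsource i)) * word_val letter_arrow (bword i).
have bbE (i : 'I_n) : b i = phi (bb i).
  by rewrite /b ltn_ord /bb rmorphM rmorph_prod.
rewrite (eq_bigr (fun i => phi (c 0 i *: bb i))) => [|i _]; last first.
  by rewrite linearZ bbE.
rewrite -linear_sum => /Psi_ideal.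
have [h hE] := linear_pack Psi_linear; rewrite -hE linear_sum => e0.
rewrite [c]row_sum_delta -[RHS]e0; apply: eq_bigr => i _; rewrite linearZ hE.
congr (_ *: _); case/and3P: ok => /and5P[_ _ /allP wl _ /all_iota iE] _ _.
have /eqP {}iE := iE _ (ltn_ord i).
have /andP[il _] := wl _ (mem_nth (0, [::])%N (ltn_ord i)).
rewrite /bb Psi_letters // Psi_path rlin_row /walk /= vdecK ?bsource3 //.
have [n3 _] := basis_vertices ok; rewrite (leq_trans (bsource3 i) n3) iE.
by apply/rowP => j; rewrite !mxE.
Qed.

Lemma basis_coord : exists cf : 'I_n -> {scalar A},
  (forall a, a = \sum_j cf j a *: b j) /\
  (forall i j : 'I_n, cf i (b j) = (i == j)%:R).
Proof.
pose X := [tuple b i | i < n].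
have XE (i : 'I_n) : X`_i = b i by rewrite -tnth_nth tnth_mktuple.
have Xfree : free X.
  apply/freeP => k k0 i; have := @basis_free (\row_i k i).
  move=> /(_ _)/rowP/(_ i); rewrite !mxE; apply.
  rewrite -[RHS]k0; apply: eq_bigr => j _; rewrite mxE XE //.
exists (coord X); split=> [a|i j]; last first.
  by have := coord_free j i Xfree; rewrite XE eq_sym.
have aX : a \in <<X>>%VS.
  have [c ->] := basis_span a; apply: rpred_sum => i _; apply: rpredZ.
  by rewrite -XE; apply/memv_span/mem_nth; rewrite size_tuple.
by rewrite [LHS](coord_span aX); apply: eq_bigr => j _; rewrite XE.
Qed.

End Algebra.
End Numeric.

Definition mul_table (n : nat) (tab : seq (seq nat)) (i j : nat) : nat :=
  nth n (nth [::] tab i) j.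

Section PresentedAlgebras.
Variables (E : finType) (st : E -> vertex3 * vertex3) (lt : nat -> E) (nl : nat).
Variables (B : path_basis) (r : resolution).
Let n := size (basis_paths B).

(** Products are tabulated once, so that checking a resolution does not walk along words at each
    product. *)
Definition bmul_table : seq (seq nat) :=
  [seq [seq bmul st lt B i j | j <- iota 0 n] | i <- iota 0 n].

Lemma bmul_tableE i j : mul_table n bmul_table i j = bmul st lt B i j.
Proof.
rewrite /mul_table /bmul -/n; case: (ltnP i n) => [ni|ge] /=; last first.
  by rewrite [nth [::] _ _]nth_default ?nth_nil // size_map size_iota.
rewrite (nth_map 0%N) ?size_iota //; case: (ltnP j n) => [nj|ge] /=; last first.
  by rewrite nth_default // size_map size_iota.
by rewrite (nth_map 0%N) ?size_iota // !nth_iota // /bmul -/n ni nj.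
Qed.

Lemma presented_HH (K : fieldType) (charK : 2%N \in [pchar K]) (A : falgType K)
    (li : E -> nat) :
  cancel li lt -> (forall a, (li a < nl)%N) ->
  (forall a, (a < nl)%N -> li (lt a) = a) ->
  path_basis_ok st lt nl B -> resolution_ok n (mul_table n bmul_table) r ->
  size (types0 r) = 3 ->
  presented_by [seq poly_val (fun a => arr (lt a : arrow (quiver3 st)) :
    path_algebra K (quiver3 st)) p | p <- relations B] A ->
  [/\ dim_HH_is 0 A (size (classes (contr0 r))),
      dim_HH_is 1 A (size (classes (contr1 r)))
    & dim_HH_is 2 A (size (classes (contr2 r)))].
Proof.
move=> liK li_nl ltK ok rok ty3 [phi [phiS phiK]].
have [cf [cfE cfb]] := basis_coord charK phiS phiK ok liK li_nl ltK.
have mulE i j := basis_mul charK phiK ok i j.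
apply: (resolution_HH charK (@basis_out _ _ _ _ _ _ phi) _ cfE cfb rok).
  by move=> i j; rewrite bmul_tableE mulE.
rewrite ty3; exact: one_vertices phi ok.
Qed.

End PresentedAlgebras.

(** * The algebras Lambda_4 to Lambda_8 *)

Definition letter4 : nat -> arrow4 := nth delta4 [:: alpha4; beta4; gamma4].
Definition letter5 : nat -> arrow5 := nth sigma5 [:: alpha5; beta5; gamma5; delta5].

Definition index4 (a : arrow4) : nat :=
  match a with alpha4 => 0 | beta4 => 1 | gamma4 => 2 | delta4 => 3 end.
Definition index5 (a : arrow5) : nat :=
  match a with alpha5 => 0 | beta5 => 1 | gamma5 => 2 | delta5 => 3 | sigma5 => 4 end.

(** Recovers the endpoint function of a quiver built by [quiver3], up to conversion. *)
Definition ends (E : finType) (s t : E -> vertex3) (a : E) := (s a, t a).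

Definition resolves (E : finType) (st : E -> vertex3 * vertex3) lt nl B r : bool :=
  let n := size (basis_paths B) in
  path_basis_ok st lt nl B && resolution_ok n (mul_table n (bmul_table st lt B)) r
  && ([:: size (types0 r); size (classes (contr0 r)); size (classes (contr1 r));
          size (classes (contr2 r))] == [:: 3; 5; 2; 2])%N.

Lemma presented_HH522 (E : finType) (st : E -> vertex3 * vertex3) lt li nl B r
    (K : fieldType) (charK : 2%N \in [pchar K]) (A : falgType K)
    (rels : seq (path_algebra K (quiver3 st))) :
  cancel li lt -> (forall a, (li a < nl)%N) ->
  (forall a, (a < nl)%N -> li (lt a) = a) ->
  resolves st lt nl B r ->
  rels = [seq poly_val (fun a => arr (lt a : arrow (quiver3 st))) p | p <- relations B] ->
  presented_by rels A -> [/\ dim_HH_is 0 A 5, dim_HH_is 1 A 2 & dim_HH_is 2 A 2].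
Proof.
move=> liK linl ltK /andP[/andP[ok rok] /eqP[s0 c0 c1 c2]] -> pA.
by have := presented_HH charK liK linl ltK ok rok s0 pA; rewrite c0 c1 c2.
Qed.

Local Open Scope nat_scope.

(** Letters 0, 1, 2, 3 are α, β, γ, δ; vertices are numbered from 0. The rules include δβδ -> αγ and
    γβδβα -> γβα. The first derivation step is the overlap δβδβδ of the former with itself, which
    yields δβαγ -> αγβδ. *)
Definition path_basis4 : path_basis :=
  PathBasis
     [:: (0,[::]); (1,[::]); (2,[::]); (0,[:: 0]); (0,[:: 3]); (1,[:: 1]);
     (2,[:: 2]); (0,[:: 0; 2]); (0,[:: 3; 1]); (1,[:: 1; 0]); (1,[:: 1; 3]);
     (2,[:: 2; 1]); (0,[:: 0; 2; 1]); (0,[:: 3; 1; 0]); (1,[:: 1; 0; 2]);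
     (1,[:: 1; 3; 1]); (2,[:: 2; 1; 0]); (2,[:: 2; 1; 3]); (0,[:: 0; 2; 1; 3]);
     (1,[:: 1; 0; 2; 1]); (1,[:: 1; 3; 1; 0]); (2,[:: 2; 1; 3; 1]); (0,[:: 0; 2;
     1; 3; 1]); (1,[:: 1; 0; 2; 1; 3])]
     [:: [:: 3; 24; 24; 4]; [:: 24; 5; 24; 24]; [:: 24; 24; 6; 24]; [:: 24; 24;
     7; 24]; [:: 24; 8; 24; 24]; [:: 9; 24; 24; 10]; [:: 24; 11; 24; 24];
     [:: 24; 12; 24; 24]; [:: 13; 24; 24; 7]; [:: 24; 24; 14; 24]; [:: 24; 15;
     24; 24]; [:: 16; 24; 24; 17]; [:: 24; 24; 24; 18]; [:: 24; 24; 18; 24];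
     [:: 24; 19; 24; 24]; [:: 20; 24; 24; 14]; [:: 24; 24; 24; 24]; [:: 24; 21;
     24; 24]; [:: 24; 22; 24; 24]; [:: 24; 24; 24; 23]; [:: 24; 24; 23; 24];
     [:: 16; 24; 24; 24]; [:: 24; 24; 24; 24]; [:: 24; 24; 24; 24]]
     [:: [:: [:: 3; 1; 3]; [:: 0; 2]]; [:: [:: 1; 3; 1; 3; 1; 3; 1]]; [:: [:: 2;
     1; 0]; [:: 2; 1; 3; 1; 0]]]
     [:: [:: ([::],0,[:: 1; 3]); ([:: 3; 1],0,[::])]; [:: ([::],2,[:: 2]);
     ([:: 2; 1],3,[::])]; [:: ([::],1,[::]); ([:: 1],0,[:: 1; 3; 1])];
     [:: ([::],5,[:: 0]); ([:: 1; 0],2,[::])]; [:: ([::],4,[:: 1]);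
     ([:: 2],5,[::])]; [:: ([::],3,[:: 1; 0]); ([:: 0],2,[::]);
     ([:: 3],6,[::])]; [:: ([::],4,[::]); ([::],7,[:: 3])];
     [:: ([:: 1],0,[::])]; [:: ([:: 1],8,[::])]; [:: ([:: 1],3,[::])];
     [:: ([::],9,[::]); ([:: 2; 1],0,[::])]; [:: ([::],8,[::]);
     ([:: 0],2,[::])]; [:: ([::],8,[:: 2]); ([:: 0; 2; 1],0,[::])]].

(** Degree 1 is indexed by the arrows β, δ, γ, α and degree 2 by the relations. [diff2] is the
    noncommutative derivative: an arrow a in a word u a v contributes u (x) v, reduced to the basis;
    the monomial relation is taken as βδβαγβ. The centre has basis αγβδβ, βαγβδ, γβα, αγβ + βαγ, 1;
    HH^1 has the derivations β -> βαγβ and δ -> αγ. *)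
Definition resolution4 : resolution :=
  Resolution
     [:: (0,0); (1,1); (2,2)]
     [:: (1,0); (0,1); (2,1); (0,2)]
     [:: (0,1); (1,0); (2,2)]
     [:: (1,2); (0,0); (2,0); (1,1)]
     [:: [:: (5,0,0); (1,1,5)]; [:: (0,0,4); (4,1,1)]; [:: (6,1,1); (2,2,6)];
     [:: (0,0,3); (3,2,2)]]
     [:: [:: (4,0,4); (0,1,10); (8,1,1); (3,2,1); (0,3,6)]; [:: (1,0,22);
     (10,0,12); (23,0,0); (5,1,19); (20,2,5); (15,3,11)]; [:: (6,0,3); (6,0,13);
     (17,0,3); (11,1,9); (2,2,9); (2,2,20); (11,3,2); (21,3,2)]]
     [:: [:: (15,0,20); (19,0,9); (19,0,20); (1,1,3); (20,2,2)]; [:: (0,0,19);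
     (12,0,15); (22,0,5); (4,1,0); (4,1,8); (3,2,11)]; [:: (11,0,15); (11,0,19);
     (21,0,5); (21,0,15); (21,0,19); (6,1,0); (2,2,21)]; [:: (5,0,14); (5,0,23);
     (15,0,10); (15,0,14); (19,0,1); (1,1,4); (1,1,7); (9,2,6)]]
     [:: ((0,3),[:: (0,3,2)]); ((0,4),[:: (0,1,1)]); ((0,7),[:: (3,2,1);
     (0,3,6)]); ((0,8),[:: (4,0,0); (0,1,5)]); ((0,12),[:: (7,0,0); (3,2,5);
     (0,3,11)]); ((0,13),[:: (4,0,3); (0,1,9); (8,3,2)]); ((0,18),[:: (4,0,7);
     (0,1,14); (13,2,1); (8,3,6)]); ((0,22),[:: (4,0,12); (18,0,0); (0,1,19);
     (13,2,5); (8,3,11)]); ((1,5),[:: (1,0,0)]); ((1,9),[:: (1,0,3); (5,3,2)]);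
     ((1,10),[:: (1,0,4); (5,1,1)]); ((1,14),[:: (1,0,7); (9,2,1); (5,3,6)]);
     ((1,15),[:: (1,0,8); (10,0,0); (5,1,5)]); ((1,19),[:: (1,0,12); (14,0,0);
     (9,2,5); (5,3,11)]); ((1,20),[:: (1,0,13); (10,0,3); (5,1,9); (15,3,2)]);
     ((1,23),[:: (1,0,18); (10,0,7); (5,1,14); (20,2,1); (15,3,6)]);
     ((2,6),[:: (2,2,1)]); ((2,11),[:: (6,0,0); (2,2,5)]); ((2,16),[:: (6,0,3);
     (2,2,9); (11,3,2)]); ((2,17),[:: (6,0,4); (11,1,1); (2,2,10)]);
     ((2,21),[:: (6,0,8); (17,0,0); (11,1,5); (2,2,15)])]
     [:: ((0,22),[:: (1,1,0)]); ((1,10),[:: (0,0,1)]); ((1,15),[:: (0,0,5)]);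
     ((1,20),[:: (0,0,9); (0,0,20); (8,0,9); (8,0,20); (12,0,9); (4,1,3);
     (3,2,2); (13,2,2)]); ((1,23),[:: (0,0,14); (12,0,10); (22,0,1); (7,1,4);
     (3,2,6); (3,2,17)]); ((2,14),[:: (11,0,10); (21,0,1); (6,1,4); (2,2,6);
     (2,2,17)]); ((2,19),[:: (6,1,0); (2,2,11)]); ((2,20),[:: (2,2,2)]);
     ((2,23),[:: (11,0,10); (21,0,1); (6,1,4); (2,2,17)]); ((3,16),[:: (0,0,20);
     (8,0,9); (8,0,20); (12,0,9); (4,1,3); (3,2,2); (13,2,2)]);
     ((3,17),[:: (0,0,10); (8,0,1)]); ((3,21),[:: (0,0,15); (8,0,5)])]
     [:: ((0,19),[:: (4,0,11); (0,1,0); (0,1,8); (3,2,0)]); ((0,20),[:: (4,0,2);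
     (7,0,2)]); ((0,23),[:: (7,0,6); (0,1,4); (8,1,4); (13,2,4); (4,3,1)]);
     ((1,3),[:: (1,0,2); (14,0,2)]); ((1,4),[:: (1,0,6); (5,1,4); (9,2,4);
     (1,3,1); (10,3,1)]); ((1,7),[:: (1,0,6); (15,1,4); (20,2,4); (14,3,1)]);
     ((1,8),[:: (1,0,11); (10,0,11); (5,1,0); (1,3,5); (10,3,5)]);
     ((1,12),[:: (1,0,11); (19,1,0); (20,2,8)]); ((1,13),[:: (9,2,3); (1,3,9)]);
     ((1,18),[:: (1,0,17); (20,2,4); (1,3,23)]); ((1,22),[:: (1,0,21);
     (20,2,0)]); ((2,16),[:: (6,0,2); (17,0,2); (2,2,3)]); ((2,17),[:: (11,1,4);
     (2,2,4); (17,3,1)]); ((2,21),[:: (17,0,11); (11,1,0); (2,2,0); (17,3,5)])]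
    (Contraction
     [:: [:: (0,22)]; [:: (1,23)]; [:: (2,16)]; [:: (0,12); (1,14)]; [:: (0,0);
     (1,1); (2,2)]]
     [:: ((0,22),[:: 0]); ((1,14),[:: 3]); ((1,23),[:: 1]); ((2,2),[:: 4]);
     ((2,16),[:: 2])]
     [::]
     [:: ((1,18),[:: (0,12)]); ((2,6),[:: (1,1)]); ((2,17),[:: (1,10)]);
     ((3,3),[:: (0,0)]); ((3,13),[:: (0,8)])])
    (Contraction
     [:: [:: (0,19)]; [:: (1,7)]]
     [:: ((0,19),[:: 0]); ((1,7),[:: 1]); ((1,18),[:: 0]); ((2,17),[:: 1]);
     ((3,13),[:: 1])]
     [:: ((1,18),[:: (0,12)]); ((2,6),[:: (1,1)]); ((2,17),[:: (1,10)]);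
     ((3,3),[:: (0,0)]); ((3,13),[:: (0,8)])]
     [:: ((0,7),[:: (0,5); (1,4)]); ((0,18),[:: (0,15); (1,4)]);
     ((2,16),[:: (1,4)])])
    (Contraction
     [:: [:: (0,4); (1,19)]; [:: (0,4); (1,15); (2,2)]]
     [:: ((1,19),[:: 0]); ((2,2),[:: 1])]
     [:: ((0,7),[:: (0,5); (1,4)]); ((0,18),[:: (0,15); (1,4)]);
     ((2,16),[:: (1,4)])]
     [:: ((3,10),[:: (0,4); (1,5); (1,15)]); ((3,14),[:: (0,4); (1,15)]);
     ((3,23),[:: (0,4)])]).

(** Letter 4 is σ. The rules include γβ -> α^2, α^3 -> δσ and βαγ -> βγ; the first derivation step
    gives δσδ = 0. *)
Definition path_basis5 : path_basis :=
  PathBasis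
     [:: (0,[::]); (1,[::]); (2,[::]); (0,[:: 1]); (1,[:: 0]); (1,[:: 2]);
     (1,[:: 3]); (2,[:: 4]); (0,[:: 1; 0]); (0,[:: 1; 2]); (1,[:: 0; 0]);
     (1,[:: 0; 2]); (1,[:: 3; 4]); (2,[:: 4; 3])]
     [:: [:: 14; 3; 14; 14; 14]; [:: 4; 14; 5; 6; 14]; [:: 14; 14; 14; 14; 7];
     [:: 8; 14; 9; 14; 14]; [:: 10; 14; 11; 14; 14]; [:: 14; 10; 14; 14; 14];
     [:: 14; 14; 14; 14; 12]; [:: 14; 14; 14; 13; 14]; [:: 14; 14; 9; 14; 14];
     [:: 14; 14; 14; 14; 14]; [:: 12; 14; 14; 14; 14]; [:: 14; 12; 14; 14; 14];
     [:: 14; 14; 14; 14; 14]; [:: 14; 14; 14; 14; 14]]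
     [:: [:: [:: 0; 0]; [:: 2; 1]]; [:: [:: 0; 0; 0]; [:: 3; 4]]; [:: [:: 1;
     3]]; [:: [:: 4; 2]]; [:: [:: 0; 3]]; [:: [:: 4; 0]]; [:: [:: 1; 2]; [:: 1;
     0; 2]]]
     [:: [:: ([::],1,[:: 3]); ([:: 0; 0],4,[::])]; [:: ([::],5,[:: 0; 0]);
     ([:: 4],1,[::])]; [:: ([::],0,[:: 0; 2]); ([::],0,[:: 2]); ([::],1,[:: 2]);
     ([:: 2],6,[::]); ([:: 3],3,[::])]; [:: ([::],2,[:: 4]); ([::],6,[:: 1]);
     ([:: 1],0,[::]); ([:: 1],1,[::]); ([:: 1; 0],0,[::])];
     [:: ([:: 1],4,[::])]; [:: ([::],10,[::]); ([:: 1],0,[::])];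
     [:: ([:: 0],4,[::])]; [:: ([::],1,[::]); ([:: 0],0,[::])];
     [:: ([:: 3],5,[::])]; [:: ([:: 3],3,[::])]].

(** The arrows come in the order γ, β, α, σ, δ, and α^3 is differentiated as αγβ. The centre has
    basis βγ, α^2, δσ, σδ, 1; HH^1 has α -> α^2 and α -> δσ. *)
Definition resolution5 : resolution :=
  Resolution
     [:: (0,0); (1,1); (2,2)]
     [:: (1,0); (0,1); (1,1); (2,1); (1,2)]
     [:: (2,1); (2,0); (0,2); (1,2); (1,1); (0,0); (1,1)]
     [:: (2,2); (1,2); (2,1); (1,0); (0,1); (1,1); (1,1)]
     [:: [:: (5,0,0); (1,1,5)]; [:: (0,0,3); (3,1,1)]; [:: (1,1,4); (4,1,1)];
     [:: (7,1,1); (2,2,7)]; [:: (1,1,6); (6,2,2)]]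
     [:: [:: (7,2,1); (2,3,4)]; [:: (7,0,0); (2,3,5)]; [:: (0,1,6); (3,4,2)];
     [:: (1,2,6); (4,4,2)]; [:: (1,0,3); (5,1,1); (1,2,4); (4,2,1)];
     [:: (3,0,0); (8,0,0); (0,1,5); (0,1,11); (3,2,5)]; [:: (4,0,3); (11,1,1);
     (1,2,10); (6,3,1); (1,4,7)]]
     [:: [:: (2,0,6); (7,3,2)]; [:: (5,2,2); (4,3,2); (1,4,6)]; [:: (2,0,4);
     (2,1,3); (7,4,1)]; [:: (6,0,11); (6,1,0); (4,4,11); (10,4,5); (10,4,11);
     (11,5,0); (1,6,5)]; [:: (0,2,7); (8,3,7); (3,4,4); (3,4,10); (8,4,1);
     (8,4,4); (8,4,10); (0,5,8); (3,6,1)]; [:: (6,0,4); (6,0,10); (6,1,3);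
     (6,1,8); (1,3,7); (1,4,10); (10,4,4); (10,4,10); (5,5,3); (5,5,8);
     (4,6,1)]; [:: (6,0,1); (6,0,4); (6,0,10); (6,1,3); (6,1,8); (1,4,10);
     (4,4,4); (10,4,1); (10,4,4); (10,4,10); (5,5,3); (5,5,8); (1,6,4)]]
     [:: ((0,3),[:: (0,1,1)]); ((0,8),[:: (0,1,4); (3,2,1)]);
     ((0,9),[:: (3,0,0); (0,1,5)]); ((1,4),[:: (1,2,1)]); ((1,5),[:: (1,0,0)]);
     ((1,6),[:: (1,4,2)]); ((1,10),[:: (1,0,3); (5,1,1)]); ((1,11),[:: (4,0,0);
     (1,2,5)]); ((1,12),[:: (6,3,1); (1,4,7)]); ((2,7),[:: (2,3,1)]);
     ((2,13),[:: (2,3,6); (7,4,2)])]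
     [:: ((0,8),[:: (1,4,4); (4,4,1); (1,6,1)]); ((0,9),[:: (6,1,0); (1,4,11);
     (4,4,5); (5,5,0); (1,6,5)]); ((1,6),[:: (0,2,2)]); ((1,10),[:: (0,2,7);
     (0,5,3); (3,6,1)]); ((1,11),[:: (0,5,0)]); ((1,12),[:: (0,2,7)]);
     ((2,4),[:: (1,4,1)]); ((2,6),[:: (1,3,2)]); ((2,10),[:: (1,6,1)]);
     ((2,11),[:: (6,1,0); (1,4,5); (1,4,11); (4,4,5); (5,5,0); (1,6,5)]);
     ((2,12),[:: (1,3,7)]); ((3,4),[:: (2,0,1)]); ((3,5),[:: (2,1,0)]);
     ((3,10),[:: (2,1,3)]); ((3,11),[:: (2,0,5)]); ((3,12),[:: (2,0,10);
     (7,6,1)]); ((4,13),[:: (11,2,2); (1,6,6)])]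
     [:: ((0,4),[:: (2,2,1)]); ((0,6),[:: (2,0,2)]); ((0,11),[:: (2,2,5);
     (2,2,11); (7,3,0); (7,5,5)]); ((0,12),[:: (2,0,7)]); ((1,8),[:: (2,2,4)]);
     ((1,9),[:: (2,2,11); (7,3,0); (7,5,5)]); ((2,13),[:: (8,1,2); (0,4,6);
     (8,5,6)]); ((3,13),[:: (1,5,6)]); ((4,6),[:: (1,1,2)]);
     ((4,10),[:: (6,2,1); (6,2,4); (5,4,1); (1,5,1); (12,5,1)]);
     ((4,11),[:: (1,3,0); (1,5,5)]); ((4,12),[:: (1,1,7)]); ((5,8),[:: (0,4,1);
     (3,5,1); (8,5,1)]); ((5,9),[:: (8,3,0); (0,4,5)]); ((6,4),[:: (1,5,1);
     (1,6,1)]); ((6,5),[:: (1,3,0); (1,5,5)]); ((6,10),[:: (4,1,7); (1,3,3);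
     (10,5,1); (1,6,12)]); ((6,11),[:: (1,5,5); (1,6,5)]); ((6,12),[:: (4,1,7);
     (10,5,1); (1,6,10); (1,6,12)])]
    (Contraction
     [:: [:: (0,9)]; [:: (1,10)]; [:: (1,12)]; [:: (2,13)]; [:: (0,0); (1,1);
     (2,2)]]
     [:: ((0,9),[:: 0]); ((1,10),[:: 1]); ((1,12),[:: 2]); ((2,2),[:: 4]);
     ((2,13),[:: 3])]
     [::]
     [:: ((1,3),[:: (0,0)]); ((1,8),[:: (1,4)]); ((4,6),[:: (0,0); (1,1)])])
    (Contraction
     [:: [:: (2,10)]; [:: (2,12)]]
     [:: ((2,10),[:: 0]); ((2,12),[:: 1])]
     [:: ((1,3),[:: (0,0)]); ((1,8),[:: (1,4)]); ((4,6),[:: (0,0); (1,1)])]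
     [:: ((4,10),[:: (0,5); (3,7)]); ((4,12),[:: (0,11); (2,4); (3,7)]);
     ((5,9),[:: (2,4); (3,7)]); ((6,10),[:: (2,1); (2,4); (3,7)]);
     ((6,12),[:: (3,7)])])
    (Contraction
     [:: [:: (0,7); (3,6); (4,4)]; [:: (0,7); (3,6); (5,0); (6,4)]]
     [:: ((4,4),[:: 0]); ((6,4),[:: 1])]
     [:: ((4,10),[:: (0,5); (3,7)]); ((4,12),[:: (0,11); (2,4); (3,7)]);
     ((5,9),[:: (2,4); (3,7)]); ((6,10),[:: (2,1); (2,4); (3,7)]);
     ((6,12),[:: (3,7)])]
     [:: ((4,8),[:: (4,1); (5,0)]); ((5,12),[:: (3,6)]); ((6,4),[:: (6,1)]);
     ((6,10),[:: (0,7); (3,6); (4,1)]); ((6,12),[:: (0,7)])]).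

(** The rules include δγδγ -> βα and αδγβ -> αβ; the first derivation step gives αβα = 0. *)
Definition path_basis6 : path_basis :=
  PathBasis
     [:: (0,[::]); (1,[::]); (2,[::]); (0,[:: 0]); (1,[:: 1]); (1,[:: 3]);
     (2,[:: 2]); (0,[:: 0; 1]); (0,[:: 0; 3]); (1,[:: 1; 0]); (1,[:: 3; 2]);
     (2,[:: 2; 1]); (2,[:: 2; 3]); (0,[:: 0; 3; 2]); (1,[:: 1; 0; 3]); (1,[:: 3;
     2; 1]); (1,[:: 3; 2; 3]); (2,[:: 2; 1; 0]); (2,[:: 2; 3; 2]); (1,[:: 1; 0;
     3; 2]); (2,[:: 2; 1; 0; 3]); (2,[:: 2; 3; 2; 3])]
     [:: [:: 3; 22; 22; 22]; [:: 22; 4; 22; 5]; [:: 22; 22; 6; 22]; [:: 22; 7;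
     22; 8]; [:: 9; 22; 22; 22]; [:: 22; 22; 10; 22]; [:: 22; 11; 22; 12];
     [:: 22; 22; 22; 22]; [:: 22; 22; 13; 22]; [:: 22; 22; 22; 14]; [:: 22; 15;
     22; 16]; [:: 17; 22; 22; 22]; [:: 22; 22; 18; 22]; [:: 22; 7; 22; 22];
     [:: 22; 22; 19; 22]; [:: 19; 22; 22; 22]; [:: 22; 22; 9; 22]; [:: 22; 22;
     22; 20]; [:: 22; 22; 22; 21]; [:: 22; 22; 22; 22]; [:: 22; 22; 22; 22];
     [:: 22; 22; 17; 22]]
     [:: [:: [:: 0; 3; 2; 3]]; [:: [:: 2; 3; 2; 1]]; [:: [:: 0; 1]; [:: 0; 3; 2;
     1]]; [:: [:: 1; 0]; [:: 3; 2; 3; 2]]]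
     [:: [:: ([::],0,[:: 2]); ([:: 0],3,[::])]; [:: ([::],3,[:: 1]);
     ([:: 3],1,[::])]; [:: ([::],3,[:: 3; 2]); ([:: 3; 2],3,[::])];
     [:: ([::],1,[:: 0]); ([:: 2],6,[::])]; [:: ([:: 2],5,[::])];
     [:: ([::],5,[::]); ([:: 1],2,[::])]; [:: ([:: 1],0,[::])];
     [:: ([:: 2],3,[::])]].

(** The arrows come in the order β, α, γ, δ. The centre has basis αβ, βαδγ, γβαδ, βα + γδγδ, 1; HH^1
    has γ -> γβα and γ -> γδγ. *)
Definition resolution6 : resolution :=
  Resolution
     [:: (0,0); (1,1); (2,2)]
     [:: (1,0); (0,1); (2,1); (1,2)]
     [:: (2,0); (0,2); (0,0); (1,1)]
     [:: (2,2); (1,0); (0,1)]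
     [:: [:: (4,0,0); (1,1,4)]; [:: (0,0,3); (3,1,1)]; [:: (6,1,1); (2,2,6)];
     [:: (1,1,5); (5,2,2)]]
     [:: [:: (18,0,0); (2,2,15); (12,2,4); (6,3,11)]; [:: (0,1,16); (8,2,5);
     (3,3,12); (13,3,2)]; [:: (3,0,0); (13,0,0); (0,1,4); (0,1,15); (8,2,4);
     (3,3,11)]; [:: (1,0,3); (4,1,1); (5,2,10); (16,2,1); (1,3,18); (10,3,6)]]
     [:: [:: (2,0,8); (11,1,2); (6,3,16); (18,3,5)]; [:: (5,0,0); (16,0,0);
     (4,2,0); (1,3,4); (1,3,15)]; [:: (0,1,6); (0,1,18); (0,2,3); (3,3,1);
     (13,3,1)]]
     [:: ((0,3),[:: (0,1,1)]); ((0,7),[:: (3,0,0); (0,1,4)]);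
     ((0,8),[:: (0,1,5); (3,3,2)]); ((0,13),[:: (0,1,10); (8,2,1); (3,3,6)]);
     ((1,4),[:: (1,0,0)]); ((1,5),[:: (1,3,2)]); ((1,9),[:: (1,0,3); (4,1,1)]);
     ((1,10),[:: (5,2,1); (1,3,6)]); ((1,14),[:: (1,0,8); (4,1,5); (9,3,2)]);
     ((1,15),[:: (10,0,0); (5,2,4); (1,3,11)]); ((1,16),[:: (5,2,5); (1,3,12);
     (10,3,2)]); ((1,19),[:: (1,0,13); (4,1,10); (14,2,1); (9,3,6)]);
     ((2,6),[:: (2,2,1)]); ((2,11),[:: (6,0,0); (2,2,4)]); ((2,12),[:: (2,2,5);
     (6,3,2)]); ((2,17),[:: (6,0,3); (11,1,1); (2,2,9)]); ((2,18),[:: (2,2,10);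
     (12,2,1); (6,3,6)]); ((2,20),[:: (6,0,8); (11,1,5); (2,2,14); (17,3,2)]);
     ((2,21),[:: (2,2,16); (12,2,5); (6,3,12); (18,3,2)])]
     [:: ((0,7),[:: (5,0,0); (1,3,4)]); ((1,9),[:: (0,1,6); (3,3,1)]);
     ((1,14),[:: (0,1,12); (3,3,5)]); ((1,15),[:: (0,2,0)]);
     ((1,16),[:: (0,1,2)]); ((1,19),[:: (0,1,18); (3,3,10)]);
     ((2,15),[:: (2,0,0)]); ((2,19),[:: (2,0,3); (6,3,10); (18,3,1)]);
     ((3,17),[:: (1,3,10); (10,3,1)]); ((3,18),[:: (1,3,1)]);
     ((3,20),[:: (4,1,2); (1,3,16); (10,3,5)]); ((3,21),[:: (1,3,5)])]
     [:: ((0,7),[:: (2,0,11); (12,0,11); (21,0,11); (6,1,7); (17,1,0); (18,1,0);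
     (11,2,4)]); ((0,8),[:: (2,0,2)]); ((0,13),[:: (2,0,6); (2,0,18); (12,0,17);
     (12,0,18); (6,1,3); (17,1,3); (18,1,3); (11,2,1)]); ((1,11),[:: (3,1,0);
     (13,1,0); (0,2,4); (0,2,15)]); ((1,17),[:: (3,1,3); (13,1,3); (0,2,9);
     (0,2,19)]); ((1,20),[:: (8,0,2); (3,1,8); (13,1,8); (0,2,14)]);
     ((1,21),[:: (8,0,2); (3,1,8); (13,1,8); (0,2,14); (0,2,16)]);
     ((2,3),[:: (0,2,1)]); ((2,7),[:: (3,1,0); (13,1,0); (0,2,15)]);
     ((2,8),[:: (8,0,2); (3,1,8); (13,1,8); (0,2,5); (0,2,14); (0,2,16)]);
     ((2,13),[:: (3,1,3); (13,1,3); (0,2,9); (0,2,10); (0,2,19)]);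
     ((3,9),[:: (5,0,6); (5,0,18); (16,0,6); (16,0,18); (1,1,3); (1,1,13);
     (9,1,3); (10,1,3); (4,2,1); (4,2,9); (4,2,10); (15,2,1)]);
     ((3,14),[:: (5,0,2); (14,0,12); (16,0,2); (16,0,12); (1,1,8); (4,2,5);
     (4,2,14); (4,2,16)]); ((3,15),[:: (1,1,0)]); ((3,19),[:: (5,0,6); (5,0,18);
     (16,0,6); (16,0,18); (1,1,13); (9,1,3); (10,1,3); (4,2,9); (4,2,10);
     (15,2,1)])]
    (Contraction
     [:: [:: (0,7)]; [:: (1,19)]; [:: (2,20)]; [:: (1,9); (2,21)]; [:: (0,0);
     (1,1); (2,2)]]
     [:: ((0,7),[:: 0]); ((1,19),[:: 1]); ((2,2),[:: 4]); ((2,20),[:: 2]);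
     ((2,21),[:: 3])]
     [::]
     [:: ((1,3),[:: (0,0)]); ((1,13),[:: (1,10); (2,12)]); ((3,5),[:: (0,0);
     (1,1)]); ((3,14),[:: (1,9)]); ((3,16),[:: (2,12)])])
    (Contraction
     [:: [:: (2,17)]; [:: (2,18)]]
     [:: ((2,17),[:: 0]); ((2,18),[:: 1]); ((3,14),[:: 0]); ((3,16),[:: 1])]
     [:: ((1,3),[:: (0,0)]); ((1,13),[:: (1,10); (2,12)]); ((3,5),[:: (0,0);
     (1,1)]); ((3,14),[:: (1,9)]); ((3,16),[:: (2,12)])]
     [:: ((2,7),[:: (2,6)]); ((3,9),[:: (0,4)]); ((3,19),[:: (0,15); (2,6)])])
    (Contraction
     [:: [:: (0,11); (1,8); (3,10)]; [:: (0,11); (1,8); (2,0); (3,1)]]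
     [:: ((3,1),[:: 1]); ((3,10),[:: 0])]
     [:: ((2,7),[:: (2,6)]); ((3,9),[:: (0,4)]); ((3,19),[:: (0,15); (2,6)])]
     [:: ((1,15),[:: (0,11)]); ((2,3),[:: (2,0)]); ((2,13),[:: (1,8)])]).

Definition path_basis7 : path_basis :=
  PathBasis
     [:: (0,[::]); (1,[::]); (2,[::]); (0,[:: 0]); (0,[:: 3]); (0,[:: 4]);
     (1,[:: 1]); (2,[:: 2]); (0,[:: 0; 0]); (0,[:: 0; 3]); (1,[:: 1; 0]);
     (1,[:: 1; 3]); (1,[:: 1; 4]); (2,[:: 2; 1]); (0,[:: 0; 0; 0]); (2,[:: 2; 1;
     4])]
     [:: [:: 3; 16; 16; 4; 5]; [:: 16; 6; 16; 16; 16]; [:: 16; 16; 7; 16; 16];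
     [:: 8; 16; 16; 9; 16]; [:: 16; 8; 16; 16; 16]; [:: 16; 16; 9; 16; 16];
     [:: 10; 16; 16; 11; 12]; [:: 16; 13; 16; 16; 16]; [:: 14; 16; 16; 16; 16];
     [:: 16; 14; 16; 16; 16]; [:: 16; 16; 16; 11; 16]; [:: 16; 16; 16; 16; 16];
     [:: 16; 16; 11; 16; 16]; [:: 16; 16; 16; 16; 15]; [:: 16; 16; 16; 16; 16];
     [:: 16; 16; 16; 16; 16]]
     [:: [:: [:: 1; 3]; [:: 1; 0; 3]]; [:: [:: 0; 4]]; [:: [:: 0; 3]; [:: 4;
     2]]; [:: [:: 2; 1; 0]]; [:: [:: 0; 0]; [:: 3; 1]]]
     [:: [:: ([::],1,[:: 2]); ([:: 0],2,[::])]; [:: ([::],3,[:: 3]);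
     ([:: 2],0,[::])]; [:: ([::],5,[:: 1]); ([:: 0; 0],4,[::])];
     [:: ([::],0,[:: 1]); ([:: 1],4,[::]); ([:: 1; 0],4,[::])];
     [:: ([::],8,[::]); ([::],8,[:: 0]); ([:: 1],7,[::])]; [:: ([:: 0],1,[::])];
     [:: ([:: 0],4,[::])]; [:: ([:: 1],1,[::])]; [:: ([::],9,[::]);
     ([:: 1],4,[::])]; [:: ([::],0,[::]); ([:: 1],2,[::])];
     [:: ([:: 0],5,[::])]; [:: ([:: 0; 0],1,[::])]; [:: ([::],6,[::]);
     ([:: 2],0,[::]); ([:: 2; 1],2,[::])]].

(** The arrows come in the order α, β, δ, γ, σ. The centre has basis α^2, α^3, βδ, γβσ, 1; HH^1 has
    α -> α^2 and α -> α^3. The first class of HH^2 sends the relations ασ, γβα, α^2 - δβ to σ, γβ,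
    α. *)
Definition resolution7 : resolution :=
  Resolution
     [:: (0,0); (1,1); (2,2)]
     [:: (0,0); (1,0); (0,1); (2,1); (0,2)]
     [:: (0,2); (2,0); (0,0); (0,1); (1,1)]
     [:: (2,2); (1,2); (2,0); (0,0); (0,1)]
     [:: [:: (0,0,3); (3,0,0)]; [:: (6,0,0); (1,1,6)]; [:: (0,0,4); (4,1,1)];
     [:: (7,1,1); (2,2,7)]; [:: (0,0,5); (5,2,2)]]
     [:: [:: (0,0,5); (3,4,2)]; [:: (13,0,0); (7,1,3); (2,3,10)]; [:: (0,0,3);
     (3,0,0); (4,1,0); (0,2,6)]; [:: (0,0,4); (3,2,1); (5,3,1); (0,4,7)];
     [:: (6,0,4); (1,1,4); (1,1,9); (6,2,1); (10,2,1)]]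
     [:: [:: (13,0,2); (2,1,5)]; [:: (10,0,2); (6,2,5); (10,2,5); (1,4,12)];
     [:: (2,1,3); (2,1,8); (13,2,0); (7,4,6)]; [:: (0,0,13); (5,1,0); (3,2,3);
     (8,2,0); (0,3,10); (3,3,6)]; [:: (0,0,7); (3,0,7); (0,2,4); (0,2,9);
     (3,3,1); (8,3,1); (4,4,1)]]
     [:: ((0,3),[:: (0,0,0)]); ((0,4),[:: (0,2,1)]); ((0,5),[:: (0,4,2)]);
     ((0,8),[:: (0,0,3); (3,0,0)]); ((0,9),[:: (0,0,4); (3,2,1)]);
     ((0,14),[:: (0,0,8); (3,0,3); (8,0,0)]); ((1,6),[:: (1,1,0)]);
     ((1,10),[:: (6,0,0); (1,1,3)]); ((1,11),[:: (1,1,4); (6,2,1)]);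
     ((1,12),[:: (1,1,5); (6,4,2)]); ((2,7),[:: (2,3,1)]); ((2,13),[:: (7,1,0);
     (2,3,6)]); ((2,15),[:: (7,1,5); (2,3,12); (13,4,2)])]
     [:: ((0,5),[:: (0,0,2)]); ((0,9),[:: (0,0,7); (3,3,1)]);
     ((0,14),[:: (0,0,13); (8,2,0); (3,3,6)]); ((1,8),[:: (12,1,0); (6,2,0);
     (6,2,3); (10,2,0); (6,3,10); (1,4,6); (1,4,10)]); ((1,9),[:: (1,4,1)]);
     ((1,14),[:: (12,1,0); (6,2,3); (6,3,10); (1,4,10)]); ((2,6),[:: (0,2,0)]);
     ((2,10),[:: (0,2,3)]); ((2,11),[:: (0,0,7); (0,2,4); (3,3,1)]);
     ((2,12),[:: (3,0,2); (0,2,5)]); ((3,10),[:: (2,1,0)]); ((3,11),[:: (2,1,4);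
     (7,4,1)]); ((4,7),[:: (0,3,1)]); ((4,13),[:: (3,2,0); (0,3,6)]);
     ((4,15),[:: (8,0,2); (3,2,5); (0,3,12)])]
     [:: ((0,15),[:: (5,0,2); (0,3,5)]); ((1,3),[:: (2,0,13); (2,2,0); (2,2,3);
     (13,3,0)]); ((1,5),[:: (2,0,2)]); ((1,8),[:: (2,0,13); (2,2,3); (13,3,0)]);
     ((1,9),[:: (2,0,7)]); ((1,14),[:: (2,0,13)]); ((2,8),[:: (3,3,0); (0,4,6);
     (0,4,10)]); ((2,9),[:: (0,4,1)]); ((2,14),[:: (3,3,0); (0,4,10)]);
     ((3,10),[:: (0,3,0)]); ((3,11),[:: (5,0,7); (0,3,4); (0,3,9); (3,4,1);
     (8,4,1)]); ((4,10),[:: (6,3,0)]); ((4,11),[:: (1,1,7); (6,4,1); (10,4,1)]);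
     ((4,12),[:: (1,1,2)])]
    (Contraction
     [:: [:: (0,8)]; [:: (0,14)]; [:: (1,11)]; [:: (2,15)]; [:: (0,0); (1,1);
     (2,2)]]
     [:: ((0,8),[:: 0]); ((0,14),[:: 1]); ((1,11),[:: 2]); ((2,2),[:: 4]);
     ((2,15),[:: 3])]
     [::]
     [:: ((2,9),[:: (0,3)]); ((3,7),[:: (1,1)]); ((4,5),[:: (0,0)])])
    (Contraction
     [:: [:: (0,8)]; [:: (0,14)]]
     [:: ((0,8),[:: 0]); ((0,14),[:: 1])]
     [:: ((2,9),[:: (0,3)]); ((3,7),[:: (1,1)]); ((4,5),[:: (0,0)])]
     [:: ((2,8),[:: (1,6)]); ((2,14),[:: (0,3); (1,6); (1,10); (2,4)]);
     ((3,4),[:: (0,0); (0,3); (1,6); (2,4)]); ((3,9),[:: (1,6); (2,4)]);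
     ((4,11),[:: (0,3); (1,6); (2,4)])])
    (Contraction
     [:: [:: (0,5); (1,13); (2,3)]; [:: (0,5); (1,13); (2,0); (4,1)]]
     [:: ((2,3),[:: 0]); ((4,1),[:: 1])]
     [:: ((2,8),[:: (1,6)]); ((2,14),[:: (0,3); (1,6); (1,10); (2,4)]);
     ((3,4),[:: (0,0); (0,3); (1,6); (2,4)]); ((3,9),[:: (1,6); (2,4)]);
     ((4,11),[:: (0,3); (1,6); (2,4)])]
     [:: ((3,14),[:: (1,13)]); ((4,4),[:: (0,5); (1,13); (2,0)]);
     ((4,9),[:: (0,5); (1,13)])]).

(** This algebra is the opposite of the preceding one, all words being reversed. It has tables of
    its own because reversal would turn left linear homotopies into right linear ones. *)
Definition path_basis8 : path_basis :=
  PathBasis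
     [:: (0,[::]); (1,[::]); (2,[::]); (0,[:: 0]); (0,[:: 1]); (1,[:: 2]);
     (1,[:: 3]); (2,[:: 4]); (0,[:: 0; 0]); (0,[:: 0; 1]); (0,[:: 1; 2]);
     (1,[:: 2; 4]); (1,[:: 3; 1]); (2,[:: 4; 1]); (0,[:: 0; 0; 0]); (2,[:: 4; 1;
     2])]
     [:: [:: 3; 4; 16; 16; 16]; [:: 16; 16; 5; 6; 16]; [:: 16; 16; 16; 16; 7];
     [:: 8; 9; 16; 16; 16]; [:: 16; 16; 10; 8; 16]; [:: 16; 16; 16; 16; 11];
     [:: 11; 12; 16; 16; 16]; [:: 16; 13; 16; 16; 16]; [:: 14; 16; 16; 16; 16];
     [:: 16; 16; 16; 14; 16]; [:: 16; 16; 16; 16; 14]; [:: 16; 12; 16; 16; 16];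
     [:: 16; 16; 16; 16; 16]; [:: 16; 16; 15; 16; 16]; [:: 16; 16; 16; 16; 16];
     [:: 16; 16; 16; 16; 16]]
     [:: [:: [:: 3; 1]; [:: 3; 0; 1]]; [:: [:: 4; 0]]; [:: [:: 3; 0]; [:: 2;
     4]]; [:: [:: 0; 1; 2]]; [:: [:: 0; 0]; [:: 1; 3]]]
     [:: [:: ([::],4,[:: 0]); ([:: 1],2,[::])]; [:: ([::],0,[::]);
     ([::],2,[:: 1])]; [:: ([::],5,[:: 0]); ([:: 1; 2],1,[::])];
     [:: ([::],4,[:: 1]); ([::],5,[:: 1]); ([:: 1],6,[::])];
     [:: ([::],7,[:: 1]); ([::],8,[::]); ([:: 0],8,[::])]; [:: ([::],2,[:: 1;
     2]); ([::],6,[:: 2]); ([:: 3],3,[::])]; [:: ([:: 0],4,[::])];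
     [:: ([:: 2],1,[::])]; [:: ([::],2,[:: 0]); ([:: 2],1,[::]);
     ([:: 3],4,[::])]; [:: ([::],1,[:: 0]); ([:: 4],4,[::])];
     [:: ([:: 0],9,[::])]; [:: ([::],1,[:: 0; 0]); ([:: 4],5,[::])]].

Definition resolution8 : resolution :=
  Resolution
     [:: (0,0); (1,1); (2,2)]
     [:: (0,0); (1,0); (0,1); (2,0); (1,2)]
     [:: (2,0); (0,2); (0,0); (1,0); (1,1)]
     [:: (2,2); (0,2); (2,1); (0,0); (1,0)]
     [:: [:: (0,0,3); (3,0,0)]; [:: (6,0,0); (1,1,6)]; [:: (0,0,4); (4,1,1)];
     [:: (7,0,0); (2,2,7)]; [:: (1,1,5); (5,2,2)]]
     [:: [:: (7,0,0); (2,3,3)]; [:: (0,0,10); (3,2,5); (9,4,2)]; [:: (0,0,3);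
     (3,0,0); (4,1,0); (0,2,6)]; [:: (6,0,0); (1,1,3); (5,3,0); (1,4,7)];
     [:: (6,0,4); (1,1,4); (1,1,9); (6,2,1); (11,2,1)]]
     [:: [:: (2,0,10); (7,1,2)]; [:: (3,1,2); (8,1,2); (0,2,10); (4,4,5)];
     [:: (2,0,9); (7,2,4); (7,2,9); (13,4,1)]; [:: (10,0,0); (0,1,7); (0,2,8);
     (3,2,3); (4,3,3); (9,3,0)]; [:: (5,0,0); (5,0,3); (6,2,0); (11,2,0);
     (1,3,3); (1,3,8); (1,4,6)]]
     [:: ((0,3),[:: (0,0,0)]); ((0,4),[:: (0,2,1)]); ((0,8),[:: (0,0,3);
     (3,0,0)]); ((0,9),[:: (0,0,4); (3,2,1)]); ((0,10),[:: (0,2,5); (4,4,2)]);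
     ((0,14),[:: (0,0,8); (3,0,3); (8,0,0)]); ((1,5),[:: (1,4,2)]);
     ((1,6),[:: (1,1,0)]); ((1,11),[:: (6,0,0); (1,1,3)]); ((1,12),[:: (1,1,4);
     (6,2,1)]); ((2,7),[:: (2,3,0)]); ((2,13),[:: (7,2,1); (2,3,4)]);
     ((2,15),[:: (7,2,5); (2,3,10); (13,4,2)])]
     [:: ((0,9),[:: (0,1,13); (0,2,4); (0,2,9); (3,2,4); (9,3,4); (4,4,1);
     (9,4,1)]); ((0,10),[:: (0,1,2)]); ((0,14),[:: (0,1,7); (3,2,3); (9,3,0)]);
     ((1,8),[:: (5,0,0); (1,3,3)]); ((1,9),[:: (1,4,1)]); ((1,10),[:: (6,1,2);
     (1,4,5)]); ((1,14),[:: (5,0,3); (1,3,8)]); ((2,6),[:: (0,2,0)]);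
     ((2,11),[:: (0,2,3)]); ((2,12),[:: (0,1,13); (0,2,9); (3,2,4); (9,3,4);
     (4,4,1); (9,4,1)]); ((3,3),[:: (2,0,0)]); ((3,8),[:: (2,0,3)]);
     ((3,9),[:: (2,0,4)]); ((3,14),[:: (2,0,8)]); ((4,7),[:: (1,3,0)]);
     ((4,13),[:: (1,3,4); (1,4,1)]); ((4,15),[:: (6,1,2); (1,3,10)])]
     [:: ((0,9),[:: (2,0,13); (2,2,1)]); ((0,10),[:: (2,0,2)]);
     ((0,14),[:: (2,0,7)]); ((1,13),[:: (0,1,13); (10,2,1); (0,3,4); (8,3,4);
     (4,4,4)]); ((1,15),[:: (10,0,2); (0,3,10)]); ((2,8),[:: (0,3,0)]);
     ((2,9),[:: (0,1,13); (10,2,1); (0,3,4); (8,3,4); (4,4,4)]);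
     ((2,10),[:: (0,1,2)]); ((2,14),[:: (0,3,3); (3,3,0)]); ((3,9),[:: (6,3,4);
     (6,3,9); (1,4,4); (1,4,9)]); ((3,14),[:: (5,0,7); (6,3,0); (11,3,0);
     (1,4,8)]); ((4,6),[:: (1,4,0)]); ((4,11),[:: (5,0,7); (6,3,0); (11,3,0);
     (1,4,3); (1,4,8)]); ((4,12),[:: (5,2,1); (6,3,4); (11,3,4); (1,4,9)])]
    (Contraction
     [:: [:: (0,8)]; [:: (0,14)]; [:: (1,12)]; [:: (2,15)]; [:: (0,0); (1,1);
     (2,2)]]
     [:: ((0,8),[:: 0]); ((0,14),[:: 1]); ((1,12),[:: 2]); ((2,2),[:: 4]);
     ((2,15),[:: 3])]
     [::]
     [:: ((2,9),[:: (0,3)]); ((3,7),[:: (0,0)]); ((4,5),[:: (1,1)])])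
    (Contraction
     [:: [:: (0,8)]; [:: (0,14)]]
     [:: ((0,8),[:: 0]); ((0,14),[:: 1])]
     [:: ((2,9),[:: (0,3)]); ((3,7),[:: (0,0)]); ((4,5),[:: (1,1)])]
     [:: ((2,8),[:: (2,4)]); ((2,14),[:: (0,3); (1,6); (1,11); (2,4)]);
     ((3,6),[:: (0,0); (0,3); (1,6); (2,4)]); ((3,11),[:: (1,6); (2,4)]);
     ((4,12),[:: (0,3); (1,6); (2,4)])])
    (Contraction
     [:: [:: (0,7); (1,10); (2,3)]; [:: (0,7); (1,10); (2,0); (4,1)]]
     [:: ((2,3),[:: 0]); ((4,1),[:: 1])]
     [:: ((2,8),[:: (2,4)]); ((2,14),[:: (0,3); (1,6); (1,11); (2,4)]);
     ((3,6),[:: (0,0); (0,3); (1,6); (2,4)]); ((3,11),[:: (1,6); (2,4)]);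
     ((4,12),[:: (0,3); (1,6); (2,4)])]
     [:: ((3,14),[:: (1,10)]); ((4,6),[:: (0,7); (1,10); (2,0)]);
     ((4,11),[:: (0,7); (1,10)])]).

Local Close Scope nat_scope.

Theorem proposition7p2 (K : closedFieldType) (charK : 2%N \in [pchar K])
    (A : falgType K)
    (hA : is_Lambda4 A \/ is_Lambda5 A \/ is_Lambda6 A \/
          is_Lambda7 A \/ is_Lambda8 A) :
  [/\ dim_HH_is 0 A 5, dim_HH_is 1 A 2 & dim_HH_is 2 A 2].
Proof.
(* Turns the differences in the relations into the sums of words given by [poly_val]. *)
have opp2 (Q : quiver) (x y : path_algebra K Q) : x - y = x + y.
  by congr (_ + _); apply/eqP; rewrite eq_sym -addr_eq0 char2_vect.
have K4 : cancel index4 letter4 by case.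
have K5 : cancel index5 letter5 by case.
have i4 a : (index4 a < 4)%N by case: a.
have i5 a : (index5 a < 5)%N by case: a.
have l4 a : (a < 4)%N -> index4 (letter4 a) = a by case: a => [|[|[|[|]]]].
have l5 a : (a < 5)%N -> index5 (letter5 a) = a by case: a => [|[|[|[|[|]]]]].
case: hA => [|[|[|[|]]]].
- apply: (presented_HH522 (st := ends (@source Q4) (@target Q4)) charK
    K4 i4 l4 (B := path_basis4) (r := resolution4)); first by vm_compute.
  rewrite /rels4 /poly_val /word_val /= !big_cons !big_nil.
  by rewrite !opp2 ?exprS ?expr0 !addr0 !mulr1 !mulrA.
- apply: (presented_HH522 (st := ends (@source Q5) (@target Q5)) charK
    K5 i5 l5 (B := path_basis5) (r := resolution5)); first by vm_compute.
  rewrite /rels5 /poly_val /word_val /= !big_cons !big_nil.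
  by rewrite !opp2 ?exprS ?expr0 !addr0 !mulr1 !mulrA.
- apply: (presented_HH522 (st := ends (@source Q6) (@target Q6)) charK
    K4 i4 l4 (B := path_basis6) (r := resolution6)); first by vm_compute.
  rewrite /rels6 /poly_val /word_val /= !big_cons !big_nil.
  by rewrite !opp2 ?exprS ?expr0 !addr0 !mulr1 !mulrA.
- apply: (presented_HH522 (st := ends (@source Q7) (@target Q7)) charK
    K5 i5 l5 (B := path_basis7) (r := resolution7)); first by vm_compute.
  rewrite /rels7 /poly_val /word_val /= !big_cons !big_nil.
  by rewrite !opp2 ?exprS ?expr0 !addr0 !mulr1 !mulrA.
- apply: (presented_HH522 (st := ends (@source Q8) (@target Q8)) charK
    K5 i5 l5 (B := path_basis8) (r := resolution8)); first by vm_compute.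
  rewrite /rels8 /poly_val /word_val /= !big_cons !big_nil.
  by rewrite !opp2 ?exprS ?expr0 !addr0 !mulr1 !mulrA.
Qed.
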